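(* Let $p_1(\cdot),p_2(\cdot)\in\mathcal{P}(\mathbb{R}^n)$ both satisfy the log-Hölder conditions $$|p_i(x)-p_i(y)|\le\frac{C}{-\log|x-y|}\quad (x,y\in\mathbb{R}^n,\ |x-y|\le 1/2),\qquad |p_i(x)-p_i(y)|\le\frac{C}{\log(|x|+e)}\quad (x,y\in\mathbb{R}^n,\ |y|\ge|x|),$$ for some constant $C>0$, $i=1,2$. Let $0<\gamma<n/p_1^+$, $1\le q,\alpha\le\infty$, and suppose $p_1(x)<\alpha<q<\infty$ and $p_2(x)<\beta<q<\infty$ for all $x$. Assume that $\frac{n}{p_1(x)}-\frac{n}{p_2(x)}=\gamma$ for all $x\in\mathbb{R}^n$. Then the fractional integral operator $I_\gamma$ is bounded from $(L^{p_1(\cdot)},L^{q})^{\alpha}(\mathbb{R}^n)$ to $(L^{p_2(\cdot)},L^{q})^{\beta}(\mathbb{R}^n)$ if and only if $$\gamma=\frac{n}{\alpha}-\frac{n}{\beta}.$$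
   Context: $\mathcal{P}(\mathbb{R}^n)$ is the set of measurable $p(\cdot):\mathbb{R}^n\to[1,\infty)$ with $p_-=\operatorname{ess\,inf}p>1$ and $p^+=\operatorname{ess\,sup}p<\infty$. For such $p(\cdot)$, $L^{p(\cdot)}(\mathbb{R}^n)$ is the space of measurable $f$ with finite Luxemburg norm $\|f\|_{L^{p(\cdot)}}=\inf\{\lambda>0:\int_{\mathbb{R}^n}(|f(x)|/\lambda)^{p(x)}dx\le1\}$, and $L^{p(\cdot)}_{loc}$ consists of $f$ with $f\chi_F\in L^{p(\cdot)}$ for all compact $F$. For $1\le q,\alpha\le\infty$, the variable Fofana space $(L^{p(\cdot)},L^q)^\alpha(\mathbb{R}^n)$ is the set of $f\in L^{p(\cdot)}_{loc}(\mathbb{R}^n)$ with $$\|f\|_{(L^{p(\cdot)},L^q)^\alpha}=\sup_{r>0}\Big\|\,|B(\cdot,r)|^{\frac1\alpha-\frac1{p(\cdot)}-\frac1q}\,\|f\chi_{B(\cdot,r)}\|_{L^{p(\cdot)}}\Big\|_{L^q(\mathbb{R}^n)}<\infty,$$ i.e. the $L^q$ norm in $x$ of $x\mapsto |B(x,r)|^{1/\alpha-1/p(x)-1/q}\|f\chi_{B(x,r)}\|_{L^{p(\cdot)}}$, where $B(x,r)$ is the open Euclidean ball and $|B(x,r)|$ its Lebesgue measure. The fractional integral operator is $I_\gamma f(x)=\int_{\mathbb{R}^n}\frac{f(y)}{|x-y|^{n-\gamma}}dy$, $0<\gamma<n$. *)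

(* Defs.v *)
(* Points of R^n are n.-tuple R, equipped with the
   library's product (= Borel) sigma-algebra (measure_tuple_display). *)
From HB Require Import structures.
From mathcomp Require Import all_boot all_order all_algebra.
From mathcomp Require Import all_classical all_reals all_analysis.
From mathcomp Require Import measurable_realfun.
Set Implicit Arguments. Unset Strict Implicit. Unset Printing Implicit Defensive.
Import Order.TTheory GRing.Theory Num.Theory.
Import numFieldNormedType.Exports.
Local Open Scope classical_set_scope.
Local Open Scope ring_scope.

Section Defs.
Context {R : realType}.

Definition edist {n : nat} (x y : n.-tuple R) : R :=
  Num.sqrt (\sum_(i < n) (tnth x i - tnth y i) ^+ 2).
Definition enorm {n : nat} (x : n.-tuple R) : R :=
  Num.sqrt (\sum_(i < n) (tnth x i) ^+ 2).
Definition eball {n : nat} (x : n.-tuple R) (r : R) : set (n.-tuple R) :=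
  [set y | edist x y < r].

(* Lebesgue integral on R^n of a (nonnegative) function, as the iterated
   one-dimensional Lebesgue integral (Tonelli). *)
Fixpoint iint (n : nat) : (n.-tuple R -> \bar R) -> \bar R :=
  match n return (n.-tuple R -> \bar R) -> \bar R with
  | 0 => fun f => f [tuple]
  | m.+1 => fun f =>
      (\int[@lebesgue_measure R]_t iint (fun y : m.-tuple R => f (cons_tuple t y)))%E
  end.

Definition lebn {n : nat} (A : set (n.-tuple R)) : \bar R :=
  iint (fun x => (\1_A x)%:E).

Definition ae {n : nat} (P : n.-tuple R -> Prop) : Prop :=
  exists N : set (n.-tuple R),
    measurable N /\ lebn N = 0%E /\ (forall x, ~ P x -> N x).

Definition essinf {n : nat} (p : n.-tuple R -> R) : \bar R :=
  ereal_sup [set c%:E | c in [set c : R | ae (fun x => c <= p x)]].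
Definition esssup {n : nat} (p : n.-tuple R -> R) : \bar R :=
  ereal_inf [set c%:E | c in [set c : R | ae (fun x => p x <= c)]].

Definition var_exp {n : nat} (p : n.-tuple R -> R) : Prop :=
  measurable_fun setT p /\ (forall x, 1 <= p x) /\
  (1%:E < essinf p)%E /\ (esssup p < +oo)%E.

Definition log_holder {n : nat} (C : R) (p : n.-tuple R -> R) : Prop :=
  (forall x y, edist x y <= 1 / 2 -> `|p x - p y| <= C / (- ln (edist x y))) /\
  (forall x y, enorm x <= enorm y -> `|p x - p y| <= C / ln (enorm x + expR 1)).

Definition modular {n : nat} (p : n.-tuple R -> R) (g : n.-tuple R -> \bar R)
    (lam : R) : \bar R :=
  iint (fun x => poweR (`|g x| * (lam^-1)%:E)%E (p x)).
Definition lux_norm {n : nat} (p : n.-tuple R -> R) (g : n.-tuple R -> \bar R)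
    : \bar R :=
  ereal_inf [set lam%:E | lam in [set lam : R | 0 < lam /\ (modular p g lam <= 1)%E]].

Definition Lq_norm {n : nat} (q : R) (h : n.-tuple R -> \bar R) : \bar R :=
  poweR (iint (fun x => poweR `|h x|%E q)) q^-1.

Definition restr {n : nat} (g : n.-tuple R -> \bar R) (x : n.-tuple R) (r : R) :=
  fun y => ((\1_(eball x r) y)%:E * g y)%E.

Definition fofana_norm {n : nat} (p : n.-tuple R -> R) (q alpha : R)
    (g : n.-tuple R -> \bar R) : \bar R :=
  ereal_sup [set Lq_norm q (fun x =>
      ((powR (fine (lebn (eball x r))) (alpha^-1 - (p x)^-1 - q^-1))%:E
        * lux_norm p (restr g x r))%E) | r in [set r : R | 0 < r]].

(* L^{p(.)}_loc : f chi_F in L^{p(.)} for bounded (equivalently compact) F *)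
Definition Lp_loc {n : nat} (p : n.-tuple R -> R) (g : n.-tuple R -> \bar R) :=
  forall x r, 0 < r -> (lux_norm p (restr g x r) < +oo)%E.

Definition in_fofana {n : nat} (p : n.-tuple R -> R) (q alpha : R)
    (g : n.-tuple R -> \bar R) : Prop :=
  measurable_fun setT g /\ Lp_loc p g /\ (fofana_norm p q alpha g < +oo)%E.

Definition frac_int {n : nat} (gamma : R) (f : n.-tuple R -> R) :
    n.-tuple R -> \bar R := fun x =>
  (iint (fun y => (Num.max (f y) 0 * powR (edist x y) (gamma - n%:R))%:E)
   - iint (fun y => (Num.max (- f y) 0 * powR (edist x y) (gamma - n%:R))%:E))%E.

Definition frac_bounded {n : nat} (gamma : R) (p1 : n.-tuple R -> R)
    (q alpha : R) (p2 : n.-tuple R -> R) (beta : R) : Prop :=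
  exists C : R, 0 <= C /\
    forall f : n.-tuple R -> R, in_fofana p1 q alpha (fun x => (f x)%:E) ->
      in_fofana p2 q beta (frac_int gamma f) /\
      (fofana_norm p2 q beta (frac_int gamma f)
        <= C%:E * fofana_norm p1 q alpha (fun x => (f x)%:E))%E.

End Defs.

(* Main.v *)
(* Sufficiency. Sum over the radii e^k, k integer: I_gamma f(x) is at most a
   constant times the sum of r^(gamma - n) times the mass of |f| over B(x, r). A
   Carleson-type estimate (G being cut at the height where r^n G^s = 1) bounds
   the integral of the sum over r of r^(n(t - 1)) (average of G over B(x, r))^(s
   t) by that of G^s, for all s, t > 1, and Hedberg's balance of two geometric
   series bounds I_gamma f(x) by a power of that sum, so that no maximal
   function is needed; log-Hoelder continuity allows one to freeze the exponent
   on the balls B(x, r) with 4 r <= 1 + |x| and to replace it by its limit at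
   infinity on the others. Hence I_gamma is bounded from L^p1 to L^p2. Next, on
   B(x, r) the part of f in B(x, 2 r) is treated by this bound, and the scales
   rho > r contribute at most (r / rho)^(n (1/beta - 1/q)) times the Fofana
   weight of f at scale rho, which is summable over rho since beta < q.

   Necessity. For f the indicator of B(x0, rho), with 8 rho <= 1 + |x0|, the norm
   of f is O(rho^(n/alpha)) and that of I_gamma f is at least c rho^(gamma +
   n/beta). This applies with x0 = 0 and rho -> 0, and with |x0| = rho^(2 q) and
   rho -> oo, the center being taken so far away because the weights at x depend
   on p1(x). *)
Require Import Defs.
From HB Require Import structures.
From mathcomp Require Import all_boot all_order all_algebra.
From mathcomp Require Import all_classical all_reals all_analysis.
From mathcomp Require Import measurable_realfun.
From mathcomp Require Import ring lra zify.
Set Implicit Arguments. Unset Strict Implicit. Unset Printing Implicit Defensive.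
Import Order.TTheory GRing.Theory Num.Theory.
Import numFieldNormedType.Exports.
Local Open Scope classical_set_scope.
Local Open Scope ring_scope.
Import Defs.

(* [lra] reads the whole context, which dominates its running time: try it first
   with the premises of the goal only, then with the latest inequalities. *)
Ltac drop_props := repeat match goal with
  | H : ?T |- _ => lazymatch type of T with Prop => clear H end
  end.
Ltac pull_order k := lazymatch k with
  | O => idtac
  | S ?m => lazymatch goal with
      | H : is_true (Order.le _ _) |- _ => revert H; pull_order m
      | H : is_true (Order.lt _ _) |- _ => revert H; pull_order m
      | _ => idtac
      end
  end.
Ltac ord_lra := first [drop_props; lra | pull_order 6%N; drop_props; lra
  | pull_order 99%N; drop_props; lra | lra].

(** * Calculus of the iterated integral: monotonicity, additivity, Tonelli *)

Section IteratedIntegral.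
Context {R : realType}.
Implicit Types n : nat.
Local Open Scope ereal_scope.

(** Two obstacles shape the proof. Additivity of [iint] requires measurable integrands, while the
    dependence of the Luxemburg norm over B(x, r) on the center x is not shown to be measurable.
    Monotonicity, and homogeneity as an inequality, hold for all nonnegative integrands; so the
    integrand of the Fofana norm is first compared with a measurable substitute, and only that one
    is split into pieces. Secondly, the weight at x carries the exponent 1/p(x), which cannot be
    frozen over balls that are large against 1 + |x|. There the exponent at infinity takes over, and
    where it does not match p(x) the norm is estimated from other, more distant centers. The two
    relations between the exponents say together that 1/alpha - 1/p1(x) = 1/beta - 1/p2(x): both
    spaces have the same weight at every point, so the local part asks only for the bound from L^p1
    to L^p2. Instead of Hölder's inequality, z <= 1 + z^m is applied to f / lam and the height lam
    is optimized; this works for variable m and needs no duality. *)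

Lemma ge0_le_integralT d (T : measurableType d) (mu : {measure set T -> \bar R})
    (f g : T -> \bar R) :
  (forall x, 0 <= f x) -> (forall x, f x <= g x) ->
  \int[mu]_x f x <= \int[mu]_x g x.
Proof.
move=> f0 fg; have g0 x : 0 <= g x by rewrite (le_trans (f0 x)).
rewrite !ge0_integralTE//; apply: ereal_sup_le => _ [h hf <-].
by exists h => // x; rewrite (le_trans (hf x)).
Qed.

Lemma iint_ge0 n (f : n.-tuple R -> \bar R) : (forall x, 0 <= f x) -> 0 <= iint f.
Proof.
elim: n f => [|n ih] f f0 //=.
by apply: integral_ge0 => t _; apply: ih.
Qed.

(** Valid for arbitrary nonnegative functions, because the integral is a supremum over the simple
    functions below the integrand. The integrands of the Fofana norm are compared through it. *)
Lemma le_iint n (f g : n.-tuple R -> \bar R) :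
  (forall x, 0 <= f x) -> (forall x, f x <= g x) -> iint f <= iint g.
Proof.
elim: n f g => [|n ih] f g f0 fg //=.
by apply: ge0_le_integralT => [t|t]; [apply: iint_ge0|apply: ih].
Qed.

Lemma eq_iint n (f g : n.-tuple R -> \bar R) : f =1 g -> iint f = iint g.
Proof. by move=> /funext ->. Qed.

Lemma measurable_cons_tuple n d (T : measurableType d) (f : T -> R) (g : T -> n.-tuple R) :
  measurable_fun setT f -> measurable_fun setT g ->
  measurable_fun setT (fun x => cons_tuple (f x) (g x)).
Proof.
move=> mf mg; have := measurable_cons mf mg.
by congr measurable_fun; apply/funext => x; apply/val_inj.
Qed.

(** The parameter space varies in the induction: the first coordinate joins the parameter, so that
    the inner integral is measurable in the pair and the one-dimensional Tonelli theorem applies. *)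
Lemma measurable_iint d (T : measurableType d) n (f : T * n.-tuple R -> \bar R) :
  measurable_fun setT f -> (forall x, 0 <= f x) ->
  measurable_fun setT (fun t => iint (fun y => f (t, y))).
Proof.
elim: n d T f => [|n ih] d T f mf f0 /=.
  by apply: (measurableT_comp mf); apply: measurable_fun_pair.
pose F (z : T * R) := iint (fun y => f (z.1, cons_tuple z.2 y)).
have mF : measurable_fun setT F.
  apply: (ih _ _ (fun z : (T * R) * n.-tuple R => f (z.1.1, cons_tuple z.1.2 z.2))) => //.
  apply: (measurableT_comp mf); apply: measurable_fun_pair.
    exact: (measurableT_comp measurable_fst measurable_fst).
  apply: measurable_cons_tuple => //.
  exact: (measurableT_comp measurable_snd measurable_fst).
have F0 z : 0 <= F z by apply: iint_ge0.
have := @measurable_fun_fubini_tonelli_F _ _ _ _ R (@lebesgue_measure R) F mF F0.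
exact.
Qed.

Lemma measurable_iint_cons n (f : n.+1.-tuple R -> \bar R) :
  measurable_fun setT f -> (forall x, 0 <= f x) ->
  measurable_fun setT (fun t : R => iint (fun y => f (cons_tuple t y))).
Proof.
move=> mf f0.
apply: (@measurable_iint _ R n (fun z => f (cons_tuple z.1 z.2))) => //.
by apply: (measurableT_comp mf); apply: measurable_cons_tuple.
Qed.

Lemma measurable_cons_r n (f : n.+1.-tuple R -> \bar R) (t : R) :
  measurable_fun setT f -> measurable_fun setT (fun y => f (cons_tuple t y)).
Proof. by move=> mf; apply: (measurableT_comp mf); apply: measurable_cons_tuple. Qed.

Lemma iintD n (f g : n.-tuple R -> \bar R) :
  measurable_fun setT f -> measurable_fun setT g ->
  (forall x, 0 <= f x) -> (forall x, 0 <= g x) ->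
  iint (fun x => f x + g x) = iint f + iint g.
Proof.
elim: n f g => [|n ih] f g mf mg f0 g0 //=.
rewrite -ge0_integralD//; first last.
- exact: measurable_iint_cons.
- by move=> t _; apply: iint_ge0.
- exact: measurable_iint_cons.
- by move=> t _; apply: iint_ge0.
apply: eq_integral => t _; apply: ih => //; exact: measurable_cons_r.
Qed.

Lemma iintZl n (k : \bar R) (f : n.-tuple R -> \bar R) :
  measurable_fun setT f -> (forall x, 0 <= f x) -> 0 <= k ->
  iint (fun x => k * f x) = k * iint f.
Proof.
elim: n f => [|n ih] f mf f0 k0 //=.
rewrite -ge0_integralZl//; first last.
- by move=> t _; apply: iint_ge0.
- exact: measurable_iint_cons.
by apply: eq_integral => t _; apply: ih => //; exact: measurable_cons_r.
Qed.

Lemma iint_nneseries n (f : nat -> n.-tuple R -> \bar R) :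
  (forall i, measurable_fun setT (f i)) -> (forall i x, 0 <= f i x) ->
  iint (fun x => \sum_(i <oo) f i x) = \sum_(i <oo) iint (f i).
Proof.
elim: n f => [|n ih] f mf f0 //=.
rewrite -integral_nneseries//; first last.
- by move=> i t _; apply: iint_ge0.
- by move=> i; exact: measurable_iint_cons.
by apply: eq_integral => t _; apply: ih => // i; exact: measurable_cons_r.
Qed.

Lemma iint_int_swap n (f : R * n.-tuple R -> \bar R) :
  measurable_fun setT f -> (forall z, 0 <= f z) ->
  \int[@lebesgue_measure R]_t iint (fun y => f (t, y)) =
  iint (fun y => \int[@lebesgue_measure R]_t f (t, y)).
Proof.
elim: n f => [|n ih] f mf f0 //=.
pose F (z : R * R) := iint (fun y => f (z.1, cons_tuple z.2 y)).
have mF : measurable_fun setT F.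
  apply: (@measurable_iint _ (R * R)%type n
    (fun z => f (z.1.1, cons_tuple z.1.2 z.2))) => //.
  apply: (measurableT_comp mf); apply: measurable_fun_pair.
    exact: (measurableT_comp measurable_fst measurable_fst).
  apply: measurable_cons_tuple => //.
  exact: (measurableT_comp measurable_snd measurable_fst).
have F0 z : 0 <= F z by apply: iint_ge0.
have := @fubini_tonelli _ _ _ _ R (@lebesgue_measure R) (@lebesgue_measure R) F mF F0.
rewrite /fubini_F /fubini_G /F/= => ->; apply: eq_integral => u _.
apply: (ih (fun z => f (z.1, cons_tuple u z.2))) => //.
apply: (measurableT_comp mf); apply: measurable_fun_pair => //.
exact: measurable_cons_tuple.
Qed.

Lemma iint_swap m n (f : m.-tuple R * n.-tuple R -> \bar R) :
  measurable_fun setT f -> (forall z, 0 <= f z) ->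
  iint (fun x => iint (fun y => f (x, y))) = iint (fun y => iint (fun x => f (x, y))).
Proof.
elim: m f => [|m ih] f mf f0 //=.
under eq_integral => t _.
  rewrite (ih (fun z => f (cons_tuple t z.1, z.2)))//; last first.
    apply: (measurableT_comp mf); apply: measurable_fun_pair => //.
    exact: measurable_cons_tuple.
  over.
rewrite (iint_int_swap (f := fun z => iint (fun x => f (cons_tuple z.1 x, z.2))))//.
  apply: (@measurable_iint _ (R * n.-tuple R)%type m
    (fun z => f (cons_tuple z.1.1 z.2, z.1.2))) => //.
  apply: (measurableT_comp mf); apply: measurable_fun_pair => //.
    apply: measurable_cons_tuple => //.
    exact: (measurableT_comp measurable_fst measurable_fst).
  exact: (measurableT_comp measurable_snd measurable_fst).
by move=> z; apply: iint_ge0.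
Qed.

End IteratedIntegral.

(** * Euclidean distance, norm and balls on tuples *)

Section Geometry.
Context {R : realType} {n : nat}.
Implicit Types x y z : n.-tuple R.

Lemma tsum_ge0 (u : 'I_n -> R) : 0 <= \sum_(i < n) u i ^+ 2.
Proof. by apply: sumr_ge0 => i _; rewrite sqr_ge0. Qed.

(** Sum the weighted inequality (u + v)^2 <= (1 + b/a) u^2 + (1 + a/b) v^2: with the two norms as a
    and b the right side becomes (a + b)^2. Both norms are first enlarged by e > 0, so that the
    quotients make sense when a norm vanishes. *)
Lemma sqrt_sum_triangle (u v : 'I_n -> R) :
  Num.sqrt (\sum_(i < n) (u i + v i) ^+ 2) <=
  Num.sqrt (\sum_(i < n) u i ^+ 2) + Num.sqrt (\sum_(i < n) v i ^+ 2).
Proof.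
set A := Num.sqrt (\sum_(i < n) u i ^+ 2); set B := Num.sqrt (\sum_(i < n) v i ^+ 2).
have A0 : 0 <= A by exact: sqrtr_ge0.
have B0 : 0 <= B by exact: sqrtr_ge0.
have A2 : A ^+ 2 = \sum_(i < n) u i ^+ 2 by rewrite sqr_sqrtr ?tsum_ge0.
have B2 : B ^+ 2 = \sum_(i < n) v i ^+ 2 by rewrite sqr_sqrtr ?tsum_ge0.
rewrite -[leRHS]ger0_norm ?addr_ge0// -sqrtr_sqr ler_wsqrtr//.
have key (e : R) : 0 < e -> \sum_(i < n) (u i + v i) ^+ 2 <= (A + e + (B + e)) ^+ 2.
  move=> e0; set a := A + e; set b := B + e.
  have a0 : 0 < a by rewrite /a; ord_lra.
  have b0 : 0 < b by rewrite /b; ord_lra.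
  apply: (@le_trans _ _ (\sum_(i < n) ((1 + b / a) * u i ^+ 2 + (1 + a / b) * v i ^+ 2))).
    apply: ler_sum => i _; rewrite -subr_ge0.
    have -> : (1 + b / a) * u i ^+ 2 + (1 + a / b) * v i ^+ 2 - (u i + v i) ^+ 2 =
        (b * u i - a * v i) ^+ 2 / (a * b).
      by field; rewrite !gt_eqF.
    by rewrite divr_ge0 ?sqr_ge0// mulr_ge0 ?ltW.
  rewrite big_split/= -!mulr_sumr -A2 -B2.
  have -> : (A + e + (B + e)) ^+ 2 = (1 + b / a) * a ^+ 2 + (1 + a / b) * b ^+ 2.
    by rewrite -/a -/b; field; rewrite !gt_eqF.
  apply: lerD; apply: ler_wpM2l; rewrite ?addr_ge0 ?divr_ge0 ?(ltW a0) ?(ltW b0)//.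
    by rewrite lerXn2r ?nnegrE ?(ltW a0)// /a; ord_lra.
  by rewrite lerXn2r ?nnegrE ?(ltW b0)// /b; ord_lra.
apply/ler_addgt0Pr => e e0.
have [d [d0 hd]] : exists d, 0 < d /\ (A + d + (B + d)) ^+ 2 <= (A + B) ^+ 2 + e.
  (* For d <= 1 the excess 4 d (A + B) + 4 d^2 is at most d (4 (A + B) + 4). *)
  exists (Num.min 1 (e / (4 * (A + B) + 4))); split.
    by rewrite lt_min ltr01 divr_gt0// ltr_wpDl ?mulr_ge0 ?addr_ge0.
  set d := Num.min _ _.
  have d1 : d <= 1 by rewrite ge_min lexx.
  have d0 : 0 <= d by rewrite le_min ler01 divr_ge0 ?ltW// ltr_wpDl ?mulr_ge0 ?addr_ge0.
  have : d * (4 * (A + B) + 4) <= e.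
    by rewrite -ler_pdivlMr ?ltr_wpDl ?mulr_ge0 ?addr_ge0// ge_min lexx orbT.
  nra.
exact: le_trans (key d d0) hd.
Qed.

Lemma eudist_ge0 x y : 0 <= edist x y. Proof. exact: sqrtr_ge0. Qed.

Lemma eudistC x y : edist x y = edist y x.
Proof. by congr Num.sqrt; apply: eq_bigr => i _; rewrite -sqrrN opprB. Qed.

Lemma eudist_triangle y x z : edist x z <= edist x y + edist y z.
Proof.
rewrite /edist; have := sqrt_sum_triangle
  (fun i => tnth x i - tnth y i) (fun i => tnth y i - tnth z i).
apply: le_trans; rewrite ler_wsqrtr//; apply: ler_sum => i _.
by rewrite addrA subrK.
Qed.

Lemma enorm_ge0 x : 0 <= enorm x. Proof. exact: sqrtr_ge0. Qed.

Lemma enorm_le_edist x y : enorm x <= enorm y + edist x y.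
Proof.
rewrite /enorm /edist; have := sqrt_sum_triangle
  (fun i => tnth y i) (fun i => tnth x i - tnth y i).
apply: le_trans; rewrite ler_wsqrtr//; apply: ler_sum => i _.
by rewrite addrC subrK.
Qed.

Definition cst_tuple (a : R) : n.-tuple R := [tuple a | i < n].

Lemma edist_cst_tuple0 x : edist x (cst_tuple 0) = enorm x.
Proof.
by congr Num.sqrt; apply: eq_bigr => i _; rewrite tnth_mktuple subr0.
Qed.

Lemma enorm_cst_tuple a : 0 <= a -> enorm (cst_tuple a) = Num.sqrt n%:R * a.
Proof.
move=> a0; rewrite /enorm (eq_bigr (fun=> a ^+ 2)).
  by rewrite sumr_const card_ord -(mulr_natl (a ^+ 2)) sqrtrM ?ler0n// sqrtr_sqr ger0_norm.
by move=> i _; rewrite tnth_mktuple.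
Qed.

Lemma exists_enorm (a : R) : (0 < n)%N -> 0 <= a -> exists x, enorm x = a.
Proof.
move=> n0 a0; exists (cst_tuple (a / Num.sqrt n%:R)).
rewrite enorm_cst_tuple ?divr_ge0 ?sqrtr_ge0// mulrC divfK// sqrtr_eq0 -ltNge ltr0n//.
Qed.

(** A function of both points, symmetric in them and jointly measurable, so that Tonelli can
    exchange center and variable. *)
Definition ball_ind (r : R) x y : R := if edist x y < r then 1 else 0.

Lemma ball_ind_ge0 r x y : 0 <= ball_ind r x y.
Proof. by rewrite /ball_ind; case: ifP. Qed.

Lemma ball_ind_le1 r x y : ball_ind r x y <= 1.
Proof. by rewrite /ball_ind; case: ifP. Qed.

Lemma ball_indC r x y : ball_ind r x y = ball_ind r y x.
Proof. by rewrite /ball_ind eudistC. Qed.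

Lemma ball_ind_indic r x y : \1_(eball x r) y = ball_ind r x y.
Proof.
rewrite indicE /ball_ind; case: ifPn => h; first by rewrite mem_set.
by rewrite memNset//; apply/negP.
Qed.

Lemma ball_ind_sub r s x y z : edist x y + r <= s -> ball_ind r x z <= ball_ind s y z.
Proof.
move=> h; rewrite /ball_ind; case: ifP => h1; last by case: ifP.
rewrite ifT//; have := eudist_triangle x y z; rewrite (eudistC y x); ord_lra.
Qed.

End Geometry.

(** * Measurability of distances; volumes of balls compared with cubes *)

Section MeasurableGeometry.
Context {R : realType}.

Lemma measurable_edist n d (T : measurableType d) (f g : T -> n.-tuple R) :
  measurable_fun setT f -> measurable_fun setT g ->
  measurable_fun setT (fun t => edist (f t) (g t)).
Proof.
move=> mf mg; rewrite /edist.
have -> : (fun t => Num.sqrt (\sum_(i < n) (tnth (f t) i - tnth (g t) i) ^+ 2)) =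
    (fun t => powR (\sum_(i < n) (tnth (f t) i - tnth (g t) i) ^+ 2) 2^-1).
  by apply/funext => t; rewrite powR12_sqrt// sumr_ge0// => i _; rewrite sqr_ge0.
apply: (measurableT_comp (measurable_powR _)).
apply: measurable_sum => i; apply: measurable_funX; apply: measurable_funB.
  exact: (measurableT_comp (measurable_tnth i)).
exact: (measurableT_comp (measurable_tnth i)).
Qed.

Lemma measurable_enorm n : measurable_fun setT (@enorm R n).
Proof.
have -> : @enorm R n = fun x => edist x (cst_tuple 0).
  by apply/funext => x; rewrite edist_cst_tuple0.
exact: measurable_edist.
Qed.

Lemma measurable_ball_ind n d (T : measurableType d) r (f g : T -> n.-tuple R) :
  measurable_fun setT f -> measurable_fun setT g ->
  measurable_fun setT (fun t => ball_ind r (f t) (g t)).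
Proof.
move=> mf mg; apply: measurable_fun_ifT => //.
by apply: measurable_fun_ltr => //; exact: measurable_edist.
Qed.

Lemma measurable_powR2 d (T : measurableType d) (f g : T -> R) :
  measurable_fun setT f -> measurable_fun setT g ->
  measurable_fun setT (fun t => powR (f t) (g t)).
Proof.
move=> mf mg; rewrite /powR; apply: measurable_fun_ifT.
- exact: measurable_fun_eqr.
- have -> : (fun t => (g t == 0)%:R : R) = (fun t => if g t == 0 then 1 else 0).
    by apply/funext => t; case: ifP.
  by apply: measurable_fun_ifT => //; exact: measurable_fun_eqr.
- apply: (measurableT_comp (@measurable_expR R)); apply: measurable_funM => //.
  exact: (measurableT_comp (@measurable_ln R)).
Qed.

Lemma integral_interval (a s : R) : 0 <= s ->
  (\int[@lebesgue_measure R]_t (if `|a - t| < s then 1 else 0 : R)%:E = (2 * s)%:E)%E.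
Proof.
move=> s0.
have -> : (fun t => (if `|a - t| < s then 1 else 0 : R)%:E) =
    (fun t => (\1_(`]a - s, a + s[%classic : set R) t)%:E).
  apply/funext => t; rewrite indicE; congr EFin.
  have -> : (t \in (`]a - s, a + s[%classic : set R)) = (`|a - t| < s); last by case: ifP.
  apply/idP/idP; rewrite inE/= in_itv/= ltr_norml; first by move=> /andP[? ?]; ord_lra.
  by move=> /andP[? ?]; ord_lra.
rewrite integral_indic// setIT.
transitivity ((if (a - s)%:E < (a + s)%:E then (a + s)%:E - (a - s)%:E else 0)%E : \bar R).
  exact: (lebesgue_measure_itv (`]a - s, a + s[ : interval R)).
rewrite /= lte_fin; case: ifPn => h; first by rewrite -EFinD; congr EFin; ord_lra.
by congr EFin; lra.
Qed.

Lemma iint_cube n (x : n.-tuple R) (s : R) : 0 <= s ->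
  iint (fun y => (\prod_(i < n) (if `|tnth x i - tnth y i| < s then 1 else 0))%:E)
  = ((2 * s) ^+ n)%:E.
Proof.
move=> s0; elim: n x => [|n ih] x.
  by rewrite /= big_ord0 expr0.
have [a [x' ->]] : exists a x', x = cons_tuple a x'.
  by case/tupleP: x => a x'; exists a, x'; apply: val_inj.
rewrite /=; transitivity (\int[@lebesgue_measure R]_t
   (((2 * s) ^+ n)%:E * (if `|a - t| < s then 1 else 0 : R)%:E))%E.
  apply: eq_integral => t _.
  under eq_iint => y.
    rewrite big_ord_recl/= !tnth0 EFinM.
    under eq_bigr do rewrite !tnthS.
    over.
  rewrite iintZl ?ih 1?muleC//.
  - apply/measurable_EFinP; apply: measurable_prod => i _.
    apply: measurable_fun_ifT => //; apply: measurable_fun_ltr => //.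
    apply: measurableT_comp => //; apply: measurable_funB => //.
    exact: measurable_tnth.
  - by move=> y; rewrite lee_fin prodr_ge0// => i _; case: ifP.
  - by rewrite lee_fin; case: ifP.
rewrite ge0_integralZl//=.
- by rewrite integral_interval// -EFinM exprSr.
- apply/measurable_EFinP; apply: measurable_fun_ifT => //.
  apply: measurable_fun_ltr => //; apply: measurableT_comp => //.
  exact: measurable_funB.
- by move=> t _; rewrite lee_fin; case: ifP.
- by rewrite lee_fin exprn_ge0// mulr_ge0.
Qed.

Lemma coord_le_edist n (x y : n.-tuple R) i : `|tnth x i - tnth y i| <= edist x y.
Proof.
rewrite -sqrtr_sqr ler_wsqrtr// (bigD1 i)//= lerDl.
by apply: sumr_ge0 => j _; rewrite sqr_ge0.
Qed.

Lemma ball_ind_le_cube n r (x y : n.-tuple R) :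
  ball_ind r x y <= \prod_(i < n) (if `|tnth x i - tnth y i| < r then 1 else 0).
Proof.
rewrite /ball_ind; case: ifP => h.
  rewrite big1// => i _; rewrite ifT//; exact: le_lt_trans (coord_le_edist _ _ _) h.
by apply: prodr_ge0 => i _; case: ifP.
Qed.

(** With half side r/(n+1) the squared distance is at most n (r/(n+1))^2 < r^2. Using n+1 instead of
    the square root of n keeps the inequality strict, also for n = 0. *)
Lemma cube_le_ball_ind n r (x y : n.-tuple R) : 0 < r ->
  \prod_(i < n) (if `|tnth x i - tnth y i| < r / n.+1%:R then 1 else 0)
  <= ball_ind r x y.
Proof.
move=> r0; have [/forallP h|] := boolP [forall i, `|tnth x i - tnth y i| < r / n.+1%:R].
  rewrite big1; last by move=> i _; rewrite h.
  rewrite /ball_ind ifT//.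
  have rn0 : 0 < r / n.+1%:R by rewrite divr_gt0.
  rewrite -[ltRHS](@ger0_norm _ r) ?ltW// -sqrtr_sqr ltr_sqrt ?exprn_gt0//.
  apply: (@le_lt_trans _ _ (\sum_(i < n) (r / n.+1%:R) ^+ 2)).
    apply: ler_sum => i _; rewrite -real_normK ?num_real//.
    by rewrite lerXn2r ?nnegrE ?normr_ge0 ?(ltW rn0) ?(ltW (h i)).
  rewrite sumr_const card_ord -(mulr_natl (_ ^+ 2)) expr_div_n mulrA.
  rewrite ltr_pdivrMr ?exprn_gt0// mulrC ltr_pM2l ?exprn_gt0//.
  by rewrite -natrX ltr_nat expnS expn1 mulSn; lia.
rewrite negb_forall => /existsP[i hi].
by rewrite (bigD1 i)//= (negbTE hi) mul0r ball_ind_ge0.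
Qed.

Lemma iint_ball_le n r (x : n.-tuple R) : 0 <= r ->
  (iint (fun y => (ball_ind r x y)%:E) <= ((2 * r) ^+ n)%:E)%E.
Proof.
move=> r0; rewrite -(iint_cube x r0); apply: le_iint => y; rewrite lee_fin.
  exact: ball_ind_ge0.
exact: ball_ind_le_cube.
Qed.

Lemma iint_ball_ge n r (x : n.-tuple R) : 0 < r ->
  (((2 * (r / n.+1%:R)) ^+ n)%:E <= iint (fun y => (ball_ind r x y)%:E))%E.
Proof.
move=> r0; have s0 : 0 <= r / n.+1%:R by rewrite divr_ge0 ?ltW.
rewrite -(iint_cube x s0); apply: le_iint => y; rewrite lee_fin.
  by apply: prodr_ge0 => i _; case: ifP.
exact: cube_le_ball_ind.
Qed.

End MeasurableGeometry.

(** * Geometric series over the radii exp k *)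

Section Series.
Context {R : realType}.

Lemma nneseries_le_bound (u : nat -> \bar R) (C : \bar R) :
  (forall i, 0 <= u i)%E -> (forall N, \sum_(0 <= i < N) u i <= C)%E ->
  (\sum_(i <oo) u i <= C)%E.
Proof.
move=> u0 h; apply: lime_le; first by apply: is_cvg_nneseries => i _ _; exact: u0.
by apply: nearW.
Qed.

Lemma nneseries_ge_term (u : nat -> \bar R) i :
  (forall i, 0 <= u i)%E -> (u i <= \sum_(i <oo) u i)%E.
Proof.
move=> u0; rewrite (@nneseriesD1 _ u i xpredT)//= leeDl//.
by apply: nneseries_ge0 => ? _ _; exact: u0.
Qed.

Lemma le_nneseries (u v : nat -> \bar R) : (forall i, 0 <= u i)%E ->
  (forall i, u i <= v i)%E -> (\sum_(i <oo) u i <= \sum_(i <oo) v i)%E.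
Proof. by move=> u0 uv; apply: lee_nneseries => i *; [exact: u0|exact: uv]. Qed.

Lemma measurable_nneseries d (T : measurableType d) (u : nat -> T -> \bar R) :
  (forall i, measurable_fun setT (u i)) -> (forall i x, 0 <= u i x)%E ->
  measurable_fun setT (fun x => \sum_(i <oo) u i x)%E.
Proof. by move=> mu u0; apply: ge0_emeasurable_sum => // i x _ _; exact: u0. Qed.

Lemma geometric_sum_le (q : R) N : 0 <= q -> q < 1 ->
  \sum_(i < N) q ^+ i <= (1 - q)^-1.
Proof.
move=> q0 q1; rewrite -[leRHS]mul1r ler_pdivlMr ?subr_gt0//.
have := subrX1 q N => h.
have qN : 0 <= q ^+ N by rewrite exprn_ge0.
move: h; set S := \sum_(i < N) _ => h; ord_lra.
Qed.

Lemma ler_sum_ord (F : nat -> R) N M : (N <= M)%N -> (forall i, 0 <= F i) ->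
  \sum_(i < N) F i <= \sum_(i < M) F i.
Proof.
move=> NM F0; rewrite -!(big_mkord xpredT F) [leRHS](@big_cat_nat _ _ _ N)//= lerDl.
by apply: sumr_ge0 => i _.
Qed.

(** The point is uniformity in [t]: on either side of the integer part of [t] the terms are
    dominated by the geometric series of ratio exp (- dl). *)
Lemma sum_exp_dist_nat (dl : R) : 0 < dl -> exists2 C : R, 0 <= C &
  forall (t : R) N, \sum_(i < N) expR (- dl * `|i%:R - t|) <= C.
Proof.
move=> d0; pose q := expR (- dl).
have q0 : 0 <= q by exact: expR_ge0.
have q1 : q < 1 by rewrite /q expR_lt1 oppr_lt0.
have qX i : q ^+ i = expR (- dl * i%:R) by rewrite mulrC expRM_natl.
have iq0 : 0 <= (1 - q)^-1 by rewrite invr_ge0 subr_ge0 ltW.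
exists ((1 - q)^-1 + (1 - q)^-1); first by rewrite addr_ge0.
move=> t N; have [t0|t0] := ltP t 0.
  apply: (@le_trans _ _ (\sum_(i < N) q ^+ i)).
    apply: ler_sum => i _; rewrite qX ler_expR ler_nM2l ?oppr_lt0//.
    by rewrite ger0_norm; have := ler0n R i; ord_lra.
  by apply: le_trans (geometric_sum_le N q0 q1) _; rewrite lerDl.
pose m := Num.truncn t.
have /andP[mt tm] := truncn_itv t0; rewrite -/m in mt tm.
apply: (@le_trans _ _ (\sum_(i < m.+1 + N) expR (- dl * `|i%:R - t|))).
  apply: (ler_sum_ord (F := fun i => expR (- dl * `|i%:R - t|))) => [|i].
    exact: leq_addl.
  exact: expR_ge0.
rewrite big_split_ord/=; apply: lerD.
  apply: (@le_trans _ _ (\sum_(i < m.+1) q ^+ i)); last exact: geometric_sum_le.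
  rewrite [leRHS](reindex_inj rev_ord_inj)/=; apply: ler_sum => i _.
  have im : (i <= m)%N by rewrite -ltnS.
  rewrite qX ler_expR ler_nM2l ?oppr_lt0// subSS natrB// distrC.
  rewrite ger0_norm; first by rewrite lerD2r.
  by rewrite subr_ge0 (le_trans _ mt)// ler_nat.
apply: (@le_trans _ _ (\sum_(i < N) q ^+ i)); last exact: geometric_sum_le.
apply: ler_sum => i _; rewrite qX ler_expR ler_nM2l ?oppr_lt0//.
move: tm; rewrite natrD -(addn1 m) natrD => tm.
have := ler0n R i => i0; rewrite ger0_norm; ord_lra.
Qed.

(* Enumerates the integers: 0, -1, 1, -2, 2, and so on. *)
Definition zidx (i : nat) : R := if odd i then - (i./2.+1)%:R else (i./2)%:R.
Definition erad (i : nat) : R := expR (zidx i).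

Lemma erad_gt0 i : 0 < erad i. Proof. exact: expR_gt0. Qed.

Lemma erad_ge0 i : 0 <= erad i. Proof. exact: expR_ge0. Qed.

Lemma ln_erad i : ln (erad i) = zidx i. Proof. exact: expRK. Qed.

Lemma exists_erad (d : R) : 0 < d -> exists i, d < erad i <= expR 1 * d.
Proof.
move=> d0; pose m := Num.floor (ln d).
have /andP[h1 h2] := floor_itv (ln d); rewrite -/m in h1 h2.
suff [i hi] : exists i, zidx i = (m + 1)%:~R.
  exists i; rewrite /erad hi -{1}(lnK d0) ltr_expR h2/=.
  by rewrite -[X in _ * X](lnK d0) -expRD ler_expR intrD addrC lerD2l.
have hz (z : int) : exists i, zidx i = z%:~R.
  case: z => k.
    by exists k.*2; rewrite /zidx odd_double doubleK.
  exists k.*2.+1; rewrite /zidx/= odd_double/= uphalf_double NegzE mulrNz//.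
exact: hz.
Qed.

Lemma sum_zidx_double (F : R -> R) N :
  \sum_(i < N.*2) F (zidx i) = \sum_(i < N) F i%:R + \sum_(i < N) F (- i.+1%:R).
Proof.
elim: N => [|N ih]; first by rewrite !big_ord0 addr0.
rewrite doubleS !big_ord_recr/= ih /zidx/= odd_double/= uphalf_double doubleK; ring.
Qed.

Lemma series_exp_dist (dl : R) : 0 < dl -> exists2 C : R, 0 <= C &
  forall t : R, (\sum_(i <oo) (expR (- dl * `|zidx i - t|))%:E <= C%:E)%E.
Proof.
move=> d0; have [C C0 hC] := sum_exp_dist_nat d0.
exists (C + C); first by rewrite addr_ge0.
move=> t; apply: nneseries_le_bound => [i|N]; first by rewrite lee_fin expR_ge0.
rewrite sumEFin lee_fin.
apply: (@le_trans _ _ (\sum_(i < N.*2) expR (- dl * `|zidx i - t|))).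
  rewrite big_mkord -addnn.
  apply: (ler_sum_ord (F := fun i => expR (- dl * `|zidx i - t|))) => [|i].
    exact: leq_addr.
  exact: expR_ge0.
have -> := sum_zidx_double (fun z => expR (- dl * `|z - t|)) N.
apply: lerD; first exact: hC.
apply: le_trans (hC (- t - 1) N); apply: ler_sum => i _.
by rewrite ler_expR ler_nM2l ?oppr_lt0// -normrN -natr1 le_eqVlt; apply/orP; left;
  apply/eqP; congr (`| _ |); ring.
Qed.

(** For v > 0 and dl >= 0 this is exp (- dl |ln v|): geometric decay in both directions away from v
    = 1. It is the common majorant for the sums over scales. *)
Definition kap (dl v : R) : R := Num.min (powR v dl) (powR v (- dl)).

Lemma kapE dl v : 0 < v -> 0 <= dl -> kap dl v = expR (- dl * `|ln v|).
Proof.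
move=> v0 d0; rewrite /kap /powR gt_eqF//.
have [l0|l0] := leP 0 (ln v); last first.
  rewrite ler0_norm ?ltW//; case: leP; rewrite ?ler_expR ?ltr_expR => h; congr expR; nra.
rewrite ger0_norm//; case: leP; rewrite ?ler_expR ?ltr_expR => h; congr expR; nra.
Qed.

Lemma kap_ge0 dl v : 0 <= kap dl v.
Proof. by rewrite le_min !powR_ge0. Qed.

Lemma powR_le_kap (dl v a : R) : 0 <= dl -> 0 < v -> v <= 1 -> dl <= a ->
  powR v a <= kap dl v.
Proof.
move=> d0 v0 v1 da; rewrite le_min; apply/andP; split.
  by apply: ger_powR; rewrite ?v0.
apply: ger_powR; rewrite ?v0//; ord_lra.
Qed.

Lemma powRN_le_kap (dl v a : R) : 0 <= dl -> 1 <= v -> dl <= a ->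
  powR v (- a) <= kap dl v.
Proof.
move=> d0 v1 da; rewrite le_min; apply/andP; split; apply: ler_powR => //; ord_lra.
Qed.

(** The factor [X] only translates the logarithmic grid of radii, hence a bound independent of
    it. *)
Lemma series_kap (a dl : R) : 0 < a -> 0 < dl -> exists2 C : R, 0 <= C &
  forall X : R, 0 < X -> (\sum_(i <oo) (kap dl (powR (erad i) a * X))%:E <= C%:E)%E.
Proof.
move=> a0 d0; have [C C0 hC] := series_exp_dist (mulr_gt0 d0 a0).
exists C => // X X0; apply: le_trans (hC (- ln X / a)).
apply: le_nneseries => i; rewrite lee_fin ?kap_ge0//.
have r0 : 0 < powR (erad i) a by rewrite powR_gt0 ?erad_gt0.
rewrite kapE ?mulr_gt0 ?(ltW d0)// ler_expR lnM ?posrE// ln_powR ln_erad.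
rewrite -mulNr -mulrA ler_nM2l ?oppr_lt0//.
rewrite -{1}(gtr0_norm a0) -normrM le_eqVlt; apply/orP; left; apply/eqP.
by congr (`| _ |); field; rewrite gt_eqF.
Qed.

End Series.

(** * Elementary inequalities for powers *)

Section Powers.
Context {R : realType}.

Lemma powR_expR (x a : R) : 0 < x -> powR x a = expR (a * ln x).
Proof. by move=> x0; rewrite /powR gt_eqF. Qed.

Lemma powRDp (x a b : R) : 0 < x -> powR x (a + b) = powR x a * powR x b.
Proof. by move=> x0; rewrite powRD// (gt_eqF x0); case: eqP. Qed.

Lemma ler_powR2r (x y a : R) : 0 <= a -> 0 <= x -> x <= y -> powR x a <= powR y a.
Proof.
by move=> a0 x0 xy; apply: ge0_ler_powR; rewrite ?nnegrE// (le_trans x0).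
Qed.

Lemma le_poweR (x y : \bar R) (a : R) : (0 <= a)%R ->
  (0 <= x)%E -> (x <= y)%E -> (poweR x a <= poweR y a)%E.
Proof.
move=> a0 x0 xy; apply: gt0_ler_poweR => //; rewrite in_itv/= leey andbT//.
exact: le_trans xy.
Qed.

Lemma poweRD_le (x y : \bar R) (a : R) : 0 <= a -> (0 <= x)%E -> (0 <= y)%E ->
  (poweR (x + y) a <= (powR 2 a)%:E * (poweR x a + poweR y a))%E.
Proof.
move=> a0; wlog xy : x y / (x <= y)%E => [wlg x0 y0|x0 y0].
  have [xy|yx] := leP x y; first exact: wlg.
  by rewrite addeC [X in (_ * X)%E]addeC; apply: wlg => //; exact: ltW.
have h : (x + y <= 2%:E * y)%E.
  by rewrite -[2]/(1 + 1)%R EFinD ge0_muleDl// mul1e leeD2r.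
apply: le_trans (le_poweR a0 _ h) _; first exact: adde_ge0.
rewrite poweRM//.
by apply: lee_wpmul2l; [rewrite lee_fin powR_ge0|rewrite leeDr// poweR_ge0].
Qed.

(** The substitute for Hölder's inequality: used with z = f / lam, where m may vary with the
    point. *)
Lemma le_young (z m : R) : 0 <= z -> 1 <= m -> z <= 1 + powR z m.
Proof.
move=> z0 m1; have [z1|/ltW z1] := leP z 1; first by rewrite ler_wpDr ?powR_ge0.
by rewrite ler_wpDl//; apply: le1r_powR.
Qed.

(* Optimal scale: [lam = b ^ (1 / s)]. *)
Lemma young_optimal (s c : R) (a b : \bar R) : 1 <= s -> 0 <= c ->
  (0 <= a)%E -> (0 <= b)%E ->
  (forall lam : R, (0 < lam)%R ->
    (a <= (c * lam)%:E + (powR lam (1 - s))%:E * b)%E) ->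
  (poweR a s <= (powR (c + 1) s)%:E * b)%E.
Proof.
move=> s1 c0 a0 b0 h; have s0 : 0 < s by exact: lt_le_trans s1.
have c1 : 0 < powR (c + 1) s by rewrite powR_gt0// ltr_wpDl.
case: b b0 h => [b| |]//; last by move=> _ _; rewrite gt0_muley ?lte_fin// leey.
rewrite lee_fin le_eqVlt => /orP[/eqP <-|b0] h.
  suff -> : a = 0%E by rewrite poweR0r ?gt_eqF// mule0.
  apply/eqP; rewrite eq_le a0 andbT; apply/lee_addgt0Pr => e e0.
  have l0 : 0 < e / (c + 1) by rewrite divr_gt0// ltr_wpDl.
  have := h _ l0; rewrite mule0 adde0 add0e => /le_trans; apply; rewrite lee_fin.
  by rewrite mulrA ler_pdivrMr ?ltr_wpDl// mulrC ler_pM2l// lerDl.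
pose lam := powR b s^-1.
have l0 : 0 < lam by rewrite powR_gt0.
have := h _ l0; have -> : ((powR lam (1 - s))%:E * b%:E = lam%:E)%E.
  rewrite -EFinM; congr EFin; rewrite /lam -powRrM -{2}[b]powRr1 ?ltW//.
  rewrite -powRDp//.
  by congr powR; field; rewrite gt_eqF.
rewrite -EFinD -{2}[lam]mul1r -mulrDl => /(le_poweR (ltW s0) a0) /le_trans; apply.
rewrite /= lee_fin powRM ?addr_ge0// ?(ltW l0)//.
have -> : powR lam s = b by rewrite /lam -powRrM mulVf ?gt_eqF// powRr1 ?ltW.
exact: lexx.
Qed.

End Powers.

(** * Averages over balls and their Jensen-type bounds *)

Section Averages.
Context {R : realType} {n : nat}.
Implicit Types (f g : n.-tuple R -> R) (x y : n.-tuple R).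

Definition mass f x (r : R) : \bar R := iint (fun y => (ball_ind r x y * f y)%:E).

(** Normalized by r^n and not by the volume; the average of a constant k is then only bounded by 2^n
    k, whence the powers of 2 in the constants. *)
Definition avg f x r : \bar R := ((powR r (- n%:R))%:E * mass f x r)%E.

Lemma mass_ge0 f x r : (forall y, 0 <= f y) -> (0 <= mass f x r)%E.
Proof. by move=> f0; apply: iint_ge0 => y; rewrite lee_fin mulr_ge0 ?ball_ind_ge0. Qed.

Lemma avg_ge0 f x r : (forall y, 0 <= f y) -> (0 <= avg f x r)%E.
Proof. by move=> f0; rewrite mule_ge0 ?mass_ge0// lee_fin powR_ge0. Qed.

Lemma measurable_ball_indM f r x : measurable_fun setT f ->
  measurable_fun setT (fun y => (ball_ind r x y * f y)%:E).
Proof.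
move=> mf; apply/measurable_EFinP; apply: measurable_funM => //.
exact: measurable_ball_ind.
Qed.

Lemma measurable_mass f r : measurable_fun setT f -> (forall y, 0 <= f y) ->
  measurable_fun setT (mass f ^~ r).
Proof.
move=> mf f0.
apply: (@measurable_iint _ _ (n.-tuple R) n (fun z => (ball_ind r z.1 z.2 * f z.2)%:E)).
  apply/measurable_EFinP; apply: measurable_funM; first exact: measurable_ball_ind.
  exact: measurableT_comp.
by move=> z; rewrite lee_fin mulr_ge0 ?ball_ind_ge0.
Qed.

Lemma measurable_avg f r : measurable_fun setT f -> (forall y, 0 <= f y) ->
  measurable_fun setT (avg f ^~ r).
Proof. by move=> mf f0; apply: measurable_funeM; exact: measurable_mass. Qed.

Lemma le_mass f g x r : (forall y, 0 <= f y) -> (forall y, f y <= g y) ->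
  (mass f x r <= mass g x r)%E.
Proof.
move=> f0 fg; apply: le_iint => y; rewrite lee_fin ?mulr_ge0 ?ball_ind_ge0//.
by rewrite ler_wpM2l ?ball_ind_ge0.
Qed.

Lemma le_avg f g x r : (forall y, 0 <= f y) -> (forall y, f y <= g y) ->
  (avg f x r <= avg g x r)%E.
Proof. by move=> f0 fg; apply: lee_wpmul2l; rewrite ?lee_fin ?powR_ge0//; exact: le_mass. Qed.

Lemma le_mass_iint f x r : (forall y, 0 <= f y) ->
  (mass f x r <= iint (fun y => (f y)%:E))%E.
Proof.
move=> f0; apply: le_iint => y; rewrite lee_fin ?mulr_ge0 ?ball_ind_ge0//.
by rewrite ler_piMl ?ball_ind_le1.
Qed.

Lemma massD f g x r : measurable_fun setT f -> measurable_fun setT g ->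
  (forall y, 0 <= f y) -> (forall y, 0 <= g y) ->
  mass (fun y => f y + g y) x r = (mass f x r + mass g x r)%E.
Proof.
move=> mf mg f0 g0; rewrite /mass -iintD.
- by apply: eq_iint => y; rewrite mulrDr EFinD.
- exact: measurable_ball_indM.
- exact: measurable_ball_indM.
- by move=> y; rewrite lee_fin mulr_ge0 ?ball_ind_ge0.
- by move=> y; rewrite lee_fin mulr_ge0 ?ball_ind_ge0.
Qed.

Lemma avgD f g x r : measurable_fun setT f -> measurable_fun setT g ->
  (forall y, 0 <= f y) -> (forall y, 0 <= g y) ->
  avg (fun y => f y + g y) x r = (avg f x r + avg g x r)%E.
Proof. by move=> mf mg f0 g0; rewrite /avg massD// ge0_muleDr// mass_ge0. Qed.

Lemma massZ f x r (k : R) : measurable_fun setT f -> (forall y, 0 <= f y) -> 0 <= k ->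
  mass (fun y => k * f y) x r = (k%:E * mass f x r)%E.
Proof.
move=> mf f0 k0; rewrite /mass -iintZl.
- by apply: eq_iint => y; rewrite -EFinM mulrCA.
- exact: measurable_ball_indM.
- by move=> y; rewrite lee_fin mulr_ge0 ?ball_ind_ge0.
- by rewrite lee_fin.
Qed.

Lemma mass_cst x r (k : R) : 0 <= r -> 0 <= k ->
  (mass (fun=> k) x r <= (k * (2 * r) ^+ n)%:E)%E.
Proof.
move=> r0 k0; rewrite (_ : mass _ _ _ = k%:E * iint (fun y => (ball_ind r x y)%:E))%E.
  by rewrite EFinM lee_wpmul2l ?lee_fin// iint_ball_le.
rewrite -iintZl.
- by apply: eq_iint => y; rewrite -EFinM mulrC.
- by apply/measurable_EFinP; exact: measurable_ball_ind.
- by move=> y; rewrite lee_fin ball_ind_ge0.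
- by rewrite lee_fin.
Qed.

Lemma iint_avg f r : measurable_fun setT f -> (forall y, 0 <= f y) -> 0 < r ->
  (iint (fun x => avg f x r) <= (2 ^+ n)%:E * iint (fun y => (f y)%:E))%E.
Proof.
move=> mf f0 r0; have mEf : measurable_fun setT (fun y => (f y)%:E) by exact/measurable_EFinP.
have Ef0 y : (0 <= (f y)%:E)%E by rewrite lee_fin.
rewrite /avg iintZl; last 3 first.
- exact: measurable_mass.
- by move=> x; exact: mass_ge0.
- by rewrite lee_fin powR_ge0.
rewrite /mass (iint_swap (f := fun z => (ball_ind r z.1 z.2 * f z.2)%:E)); last 2 first.
- apply/measurable_EFinP; apply: measurable_funM; first exact: measurable_ball_ind.
  exact: measurableT_comp.
- by move=> z; rewrite lee_fin mulr_ge0 ?ball_ind_ge0.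
have -> : ((2 ^+ n)%:E = (powR r (- n%:R))%:E * ((2 * r) ^+ n)%:E :> \bar R)%E.
  rewrite -EFinM; congr EFin; rewrite exprMn powRN powR_mulrn ?ltW//.
  by rewrite mulrCA mulVf ?mulr1// expf_neq0// gt_eqF.
rewrite -muleA; apply: lee_wpmul2l; first by rewrite lee_fin powR_ge0.
rewrite -iintZl//; last by rewrite lee_fin exprn_ge0// mulr_ge0// ltW.
apply: le_iint => y.
  by apply: iint_ge0 => x; rewrite lee_fin mulr_ge0 ?ball_ind_ge0.
under eq_iint => x do rewrite /= mulrC ball_indC EFinM.
rewrite iintZl//; last 2 first.
- by apply/measurable_EFinP; exact: measurable_ball_ind.
- by move=> x; rewrite lee_fin ball_ind_ge0.
by rewrite muleC lee_wpmul2r// iint_ball_le// ltW.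
Qed.

Lemma mass_young f x r (m : n.-tuple R -> R) (lam : R) :
  measurable_fun setT f -> measurable_fun setT m ->
  (forall y, 0 <= f y) -> (forall y, 1 <= m y) -> 0 < lam -> 0 <= r ->
  (mass f x r <= (lam * (2 * r) ^+ n)%:E +
     mass (fun y => lam * powR (f y / lam) (m y))%R x r)%E.
Proof.
move=> mf mm f0 m1 l0 r0.
apply: (@le_trans _ _ (mass (fun=> lam) x r +
     mass (fun y => lam * powR (f y / lam) (m y))%R x r)%E); last first.
  by rewrite leeD2r// mass_cst// ltW.
have h0 y : 0 <= lam * powR (f y / lam) (m y) by rewrite mulr_ge0 ?powR_ge0// ltW.
rewrite -massD//; last 2 first.
- apply: measurable_funM => //; apply: measurable_powR2 => //.
  exact: measurable_funM.
- by move=> y; rewrite ltW.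
apply: le_mass => // y; rewrite -{1}[lam]mulr1 -mulrDr.
have := @le_young _ (f y / lam) (m y); rewrite divr_ge0 ?(ltW l0)//.
by move=> /(_ isT (m1 y)); rewrite ler_pdivrMr// mulrC.
Qed.

Lemma avg_young f x r (s lam : R) :
  measurable_fun setT f -> (forall y, 0 <= f y) -> 1 <= s -> 0 < lam -> 0 < r ->
  (avg f x r <= (2 ^+ n * lam)%:E +
     (powR lam (1 - s))%:E * avg (fun y => powR (f y) s) x r)%E.
Proof.
move=> mf f0 s1 l0 r0.
have /= := mass_young x mf (measurable_cst s) f0 (fun=> s1) l0 (ltW r0).
move=> /(@lee_wpmul2l _ (powR r (- n%:R))%:E); rewrite lee_fin powR_ge0 => /(_ isT).
move=> /le_trans; apply.
have rn0 : 0 < r ^+ n by rewrite exprn_gt0.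
rewrite ge0_muleDr; last 2 first.
- by rewrite lee_fin mulr_ge0 ?exprn_ge0// ?mulr_ge0 ?ltW.
- by apply: mass_ge0 => y; rewrite mulr_ge0 ?powR_ge0// ltW.
apply: leeD.
  rewrite -EFinM lee_fin exprMn powRN powR_mulrn ?(ltW r0)//.
  by rewrite le_eqVlt; apply/orP; left; apply/eqP; field; rewrite gt_eqF.
have -> : mass (fun y => lam * powR (f y / lam) s) x r =
    mass (fun y => powR lam (1 - s) * powR (f y) s) x r.
  congr mass; apply/funext => y; rewrite powRM// ?invr_ge0 ?ltW//.
  rewrite mulrCA mulrC; congr (_ * _); rewrite -powR_inv1 ?ltW// -powRrM.
  rewrite -{1}[lam]powRr1 ?(ltW l0)// -powRDp//.
  by rewrite mulN1r.
rewrite massZ ?powR_ge0//; first by rewrite /avg muleCA.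
- by apply: measurable_powR2.
- by move=> y; exact: powR_ge0.
Qed.

Lemma avg_jensen f x r (s : R) :
  measurable_fun setT f -> (forall y, 0 <= f y) -> 1 <= s -> 0 < r ->
  (poweR (avg f x r) s <=
   (powR (2 ^+ n + 1) s)%:E * avg (fun y => powR (f y) s) x r)%E.
Proof.
move=> mf f0 s1 r0; apply: young_optimal => //.
- exact: avg_ge0.
- by apply: avg_ge0 => y; exact: powR_ge0.
- by move=> lam l0; exact: avg_young.
Qed.

Lemma avg_le_Ls f x r (s M : R) :
  measurable_fun setT f -> (forall y, 0 <= f y) -> 1 <= s -> 0 < r ->
  (iint (fun y => (powR (f y) s)%:E) <= M%:E)%E ->
  (avg f x r <= ((2 ^+ n + M) * powR r (- n%:R / s))%:E)%E.
Proof.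
move=> mf f0 s1 r0 hM; have s0 : 0 < s by exact: lt_le_trans s1.
(* At this height both terms of [avg_young] are multiples of r^(-n/s). *)
have l0 : 0 < powR r (- n%:R / s) by rewrite powR_gt0.
apply: le_trans (avg_young x mf f0 s1 l0 r0) _.
rewrite mulrDl EFinD leeD2l// /avg muleA.
apply: (@le_trans _ _ ((powR (powR r (- n%:R / s)) (1 - s))%:E *
    (powR r (- n%:R))%:E * M%:E)%E).
  apply: lee_wpmul2l; first by rewrite mule_ge0// lee_fin powR_ge0.
  by apply: le_trans (le_mass_iint x r _) hM => y; exact: powR_ge0.
rewrite -!EFinM lee_fin -powRrM -powRDp//.
rewrite mulrC le_eqVlt; apply/orP; left; apply/eqP; congr (_ * powR _ _).
by field; rewrite gt_eqF.
Qed.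

End Averages.

(** * The Carleson-type estimate *)

Section Carleson.
Context {R : realType} {n : nat}.
Implicit Types (f G : n.-tuple R -> R).

(** Since avg^s is at most a multiple of r^(-n), the weight r^(n (t - 1)) just compensates the
    surplus power t - 1 of avg^s. Summability over r comes from the fact that each value of [G] is
    felt only near one scale. *)
Definition carleson_sum (s t : R) G x : \bar R :=
  (\sum_(i <oo) (powR (erad i) (n%:R * (t - 1)))%:E * poweR (avg G x (erad i)) (s * t))%E.

Lemma carleson_term_ge0 s t G x i : (forall y, 0 <= G y) ->
  (0 <= (powR (erad i) (n%:R * (t - 1)))%:E * poweR (avg G x (erad i)) (s * t))%E.
Proof. by move=> G0; rewrite mule_ge0 ?poweR_ge0// lee_fin powR_ge0. Qed.

Lemma measurable_carleson_term s t G i : measurable_fun setT G -> (forall y, 0 <= G y) ->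
  measurable_fun setT (fun x =>
    (powR (erad i) (n%:R * (t - 1)))%:E * poweR (avg G x (erad i)) (s * t))%E.
Proof.
move=> mG G0; apply: measurable_funeM.
by apply: (measurableT_comp (measurable_poweR _)); exact: measurable_avg.
Qed.

Lemma measurable_carleson_sum s t G : measurable_fun setT G -> (forall y, 0 <= G y) ->
  measurable_fun setT (carleson_sum s t G).
Proof.
move=> mG G0; apply: measurable_nneseries => i.
  exact: measurable_carleson_term.
by move=> x; exact: carleson_term_ge0.
Qed.

Lemma carleson_sum_ge0 s t G x : (forall y, 0 <= G y) -> (0 <= carleson_sum s t G x)%E.
Proof. by move=> G0; apply: nneseries_ge0 => i _ _; exact: carleson_term_ge0. Qed.

(** The factor 2^(s t) pays for splitting [G] in two, the first summand for Jensen's inequality on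
    the low part, the second for the uniform bound to the power s t - 1 on the high part, and 2^n
    for integrating averages. *)
Definition carleson_cst (s t M : R) :=
  powR 2 (s * t) * ((powR (2 ^+ n + 1) (s * t) + powR (2 ^+ n + M) (s * t - 1)) * 2 ^+ n).

Lemma carleson_cst_ge0 s t M : 0 <= carleson_cst s t M.
Proof. by rewrite /carleson_cst !mulr_ge0 ?addr_ge0 ?powR_ge0// exprn_ge0. Qed.

(* [G] is cut at the height where [r ^ n * G ^ s = 1]: below it Jensen's
   inequality is used, above it the uniform bound [avg G <= C r ^ (- n / s)]. *)
Lemma carleson_scale (s t M r dl : R) G : 1 < s -> 1 < t -> 0 <= M ->
  measurable_fun setT G -> (forall y, 0 <= G y) ->
  (iint (fun y => (powR (G y) s)%:E) <= M%:E)%E -> 0 < r ->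
  0 <= dl -> dl <= t - 1 -> dl <= 1 - s^-1 ->
  (iint (fun x => (powR r (n%:R * (t - 1)))%:E * poweR (avg G x r) (s * t)) <=
   (carleson_cst s t M)%:E * iint (fun y => (powR (G y) s * kap dl (powR r n%:R * powR (G y) s))%:E))%E.
Proof.
move=> s1 t1 M0 mG G0 GM r0 dl0 dl1 dl2.
pose K1 := powR (2 ^+ n + 1) (s * t); pose K2 := powR (2 ^+ n + M) (s * t - 1).
have s0 : 0 < s by ord_lra.
have st1 : 1 < s * t by nra.
pose lo y : bool := powR r n%:R * powR (G y) s <= 1.
pose G1 y := if lo y then G y else 0.
pose G2 y := if lo y then 0 else G y.
have mlo : measurable_fun setT lo.
  apply: measurable_fun_ler => //; apply: measurable_funM => //.
  exact: measurable_powR2.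
have mG1 : measurable_fun setT G1 by apply: measurable_fun_ifT.
have mG2 : measurable_fun setT G2 by apply: measurable_fun_ifT.
have G10 y : 0 <= G1 y by rewrite /G1; case: ifP.
have G20 y : 0 <= G2 y by rewrite /G2; case: ifP.
pose H1 y := powR (G1 y) (s * t).
have mH1 : measurable_fun setT H1 by exact: measurable_powR2.
have H10 y : 0 <= H1 y by exact: powR_ge0.
pose a := powR r (n%:R * (t - 1)).
(* Of the s t powers of avg G2 one is kept; the other s t - 1 are estimated by the uniform bound,
   and [b] is the power of r that they produce. *)
pose b := powR r (- n%:R / s * (s * t - 1)).
have a0 : 0 <= a by exact: powR_ge0.
have b0 : 0 <= b by exact: powR_ge0.
have K10 : 0 <= K1 by exact: powR_ge0.
have K20 : 0 <= K2 by exact: powR_ge0.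
have pw x : (a%:E * poweR (avg G x r) (s * t) <=
    (powR 2 (s * t))%:E * ((K1 * a)%:E * avg H1 x r + (K2 * (a * b))%:E * avg G2 x r))%E.
  have -> : avg G x r = (avg G1 x r + avg G2 x r)%E.
    rewrite -avgD//; congr avg; apply/funext => y.
    by rewrite /G1 /G2; case: ifP; rewrite ?addr0 ?add0r.
  have A1 := avg_ge0 x r G10; have A2 := avg_ge0 x r G20.
  have : (poweR (avg G1 x r + avg G2 x r) (s * t) <=
      (powR 2 (s * t))%:E * (K1%:E * avg H1 x r + (K2 * b)%:E * avg G2 x r))%E.
    apply: le_trans (poweRD_le _ A1 A2) _; first by rewrite ltW//; ord_lra.
    apply: lee_wpmul2l; first by rewrite lee_fin powR_ge0.
    apply: leeD; first by apply: avg_jensen => //; ord_lra.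
    have fin2 : (avg G2 x r <= ((2 ^+ n + M) * powR r (- n%:R / s))%:E)%E.
      apply: le_trans (avg_le_Ls x mG G0 (ltW s1) r0 GM).
      by apply: le_avg => // y; rewrite /G2; case: ifP.
    rewrite -[X in poweR _ X](subrK 1) poweRD; last first.
      by apply: add_neq0_poweRD_def; rewrite subrK gt_eqF//; ord_lra.
    rewrite poweRe1//; apply: lee_wpmul2r => //.
    apply: le_trans (le_poweR _ _ fin2) _ => //; first by ord_lra.
    rewrite /= lee_fin powRM ?powR_ge0 ?addr_ge0//.
    by rewrite -powRrM.
  move=> /(@lee_wpmul2l _ a%:E); rewrite lee_fin a0 => /(_ isT) /le_trans; apply.
  rewrite muleCA; apply: lee_wpmul2l; first by rewrite lee_fin powR_ge0.
  rewrite ge0_muleDr; last 2 first.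
  - by rewrite mule_ge0 ?avg_ge0// lee_fin.
  - by rewrite mule_ge0 ?avg_ge0// lee_fin mulr_ge0.
  by rewrite !muleA -!EFinM mulrCA [a * K1]mulrC.
apply: le_trans (le_iint _ pw) _.
  by move=> x; rewrite mule_ge0 ?poweR_ge0// lee_fin.
have mA1 : measurable_fun setT (fun x => (K1 * a)%:E * avg H1 x r)%E.
  by apply: measurable_funeM; exact: measurable_avg.
have mA2 : measurable_fun setT (fun x => (K2 * (a * b))%:E * avg G2 x r)%E.
  by apply: measurable_funeM; exact: measurable_avg.
have p1 x : (0 <= (K1 * a)%:E * avg H1 x r)%E.
  by rewrite mule_ge0 ?avg_ge0// lee_fin mulr_ge0.
have p2 x : (0 <= (K2 * (a * b))%:E * avg G2 x r)%E.
  by rewrite mule_ge0 ?avg_ge0// lee_fin !mulr_ge0.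
rewrite iintZl//; last 2 first.
- exact: (emeasurable_funD mA1 mA2).
- by move=> x; rewrite adde_ge0.
rewrite iintD// /carleson_cst [(_ * (_ * 2 ^+ n))%:E]EFinM -[X in (_ <= X)%E]muleA; apply: lee_wpmul2l.
  by rewrite lee_fin powR_ge0.
pose k y := kap dl (powR r n%:R * powR (G y) s).
pose F y := powR (G y) s * k y.
have k0 y : 0 <= k y by exact: kap_ge0.
have F0 y : 0 <= F y by rewrite mulr_ge0 ?powR_ge0.
have mF : measurable_fun setT F.
  apply: measurable_funM; first exact: measurable_powR2.
  apply: measurable_minr; apply: measurable_powR2 => //.
    by apply: measurable_funM => //; exact: measurable_powR2.
  by apply: measurable_funM => //; exact: measurable_powR2.
have rn0 : 0 < powR r n%:R by exact: powR_gt0.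
(* In terms of v = r^n G^s, the low part is G^s v^(t - 1) with v <= 1 and the high part is G^s
   v^(-(1 - 1/s)) with v >= 1; this explains the two upper bounds imposed on [dl]. *)
have bd1 y : a * H1 y <= F y.
  rewrite /H1 /G1; case: ifPn => [loy|_]; last by rewrite powR0 ?mulr0 ?gt_eqF//; ord_lra.
  have [Gy0|Gy0] := eqVneq (G y) 0.
    by rewrite Gy0 powR0 ?mulr0 ?F0// gt_eqF//; ord_lra.
  have Gp : 0 < G y by rewrite lt_neqAle eq_sym Gy0 G0.
  have v0 : 0 < powR r n%:R * powR (G y) s by rewrite mulr_gt0 ?powR_gt0.
  have := powR_le_kap dl0 v0 loy dl1.
  move=> /(ler_wpM2l (powR_ge0 (G y) s)); apply: le_trans.
  rewrite le_eqVlt; apply/orP; left; apply/eqP.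
  rewrite powRM ?powR_ge0// -!powRrM /a mulrCA -powRDp//; congr (_ * powR _ _); ring.
have bd2 y : (a * b) * G2 y <= F y.
  rewrite /G2; case: ifPn => [_|hi]; first by rewrite mulr0.
  have hv : 1 <= powR r n%:R * powR (G y) s by rewrite ltW// ltNge.
  have [Gy0|Gy0] := eqVneq (G y) 0; first by rewrite Gy0 mulr0 F0.
  have Gp : 0 < G y by rewrite lt_neqAle eq_sym Gy0 G0.
  have := powRN_le_kap dl0 hv dl2.
  move=> /(ler_wpM2l (powR_ge0 (G y) s)); apply: le_trans.
  rewrite le_eqVlt; apply/orP; left; apply/eqP.
  rewrite powRM ?powR_ge0// -!powRrM /a /b mulrCA -!powRDp// -{1}[G y]powRr1//.
  by congr (powR _ _ * powR _ _); field; rewrite gt_eqF.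
have i1 : (iint (fun x => (K1 * a)%:E * avg H1 x r) <=
    (K1 * 2 ^+ n)%:E * iint (fun y => (F y)%:E))%E.
  rewrite iintZl; last 3 first.
  - exact: measurable_avg.
  - by move=> x; exact: avg_ge0.
  - by rewrite lee_fin mulr_ge0.
  rewrite (EFinM K1 a) (EFinM K1 (2 ^+ n)) -!muleA; apply: lee_wpmul2l; first by rewrite lee_fin.
  apply: (@le_trans _ _ (a%:E * ((2 ^+ n)%:E * iint (fun y => (H1 y)%:E)))%E).
    by apply: lee_wpmul2l; rewrite ?lee_fin//; exact: iint_avg.
  rewrite muleCA; apply: lee_wpmul2l; first by rewrite lee_fin exprn_ge0.
  rewrite -iintZl//; last by exact/measurable_EFinP.
  by apply: le_iint => y; rewrite -EFinM lee_fin ?mulr_ge0.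
have i2 : (iint (fun x => (K2 * (a * b))%:E * avg G2 x r) <=
    (K2 * 2 ^+ n)%:E * iint (fun y => (F y)%:E))%E.
  rewrite iintZl; last 3 first.
  - exact: measurable_avg.
  - by move=> x; exact: avg_ge0.
  - by rewrite lee_fin !mulr_ge0.
  rewrite (EFinM K2 (a * b)) (EFinM K2 (2 ^+ n)) -!muleA; apply: lee_wpmul2l; first by rewrite lee_fin.
  apply: (@le_trans _ _ ((a * b)%:E * ((2 ^+ n)%:E * iint (fun y => (G2 y)%:E)))%E).
    by apply: lee_wpmul2l; rewrite ?lee_fin ?mulr_ge0//; exact: iint_avg.
  rewrite muleCA; apply: lee_wpmul2l; first by rewrite lee_fin exprn_ge0.
  rewrite -iintZl//.
  - by apply: le_iint => y; rewrite -EFinM lee_fin ?mulr_ge0.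
  - exact/measurable_EFinP.
  - by rewrite lee_fin mulr_ge0.
apply: le_trans (leeD i1 i2) _; rewrite -ge0_muleDl ?lee_fin ?mulr_ge0 ?exprn_ge0//.
by rewrite -EFinD -mulrDl.
Qed.

(** For fixed y the argument of [kap] runs through a geometric progression in the radius, of ratio a
    power of exp n, so the sum over the scales costs a constant whatever the value of [G] at y. *)
Lemma carleson (s t M : R) : (0 < n)%N -> 1 < s -> 1 < t -> 0 <= M -> exists2 C : R, 0 <= C &
  forall G, measurable_fun setT G -> (forall y, 0 <= G y) ->
  (iint (fun y => (powR (G y) s)%:E) <= M%:E)%E ->
  (iint (carleson_sum s t G) <= C%:E)%E.
Proof.
move=> n0 s1 t1 M0; pose dl := Num.min (t - 1) (1 - s^-1).
have s0 : 0 < s by ord_lra.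
have dl0 : 0 < dl by rewrite /dl lt_min !subr_gt0 t1/= invf_lt1//.
have n0R : 0 < n%:R :> R by rewrite ltr0n.
have [Ck Ck0 hk] := series_kap n0R dl0.
pose K := carleson_cst s t M.
have K0 : 0 <= K := carleson_cst_ge0 s t M.
exists (K * (Ck * M)); first by apply: mulr_ge0 => //; exact: mulr_ge0.
move=> G mG G0 GM; rewrite /carleson_sum iint_nneseries; last 2 first.
- by move=> i; exact: measurable_carleson_term.
- by move=> i x; exact: carleson_term_ge0.
pose F i y := powR (G y) s * kap dl (powR (erad i) n%:R * powR (G y) s).
have F0 i y : 0 <= F i y by rewrite mulr_ge0 ?powR_ge0 ?kap_ge0.
have mGs : measurable_fun setT (fun y => powR (G y) s) by exact: measurable_powR2.
have mF i : measurable_fun setT (fun y => (F i y)%:E).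
  apply/measurable_EFinP; apply: measurable_funM => //.
  by apply: measurable_minr; apply: measurable_powR2 => //; apply: measurable_funM.
apply: (@le_trans _ _ (\sum_(i <oo) (K%:E * iint (fun y => (F i y)%:E)))%E).
  apply: le_nneseries => i.
    by apply: iint_ge0 => x; exact: carleson_term_ge0.
  apply: carleson_scale => //; rewrite ?(ltW dl0) ?erad_gt0//.
    by rewrite /dl ge_min lexx.
  by rewrite /dl ge_min lexx orbT.
rewrite nneseriesZl; last by move=> i _; apply: iint_ge0 => y; rewrite lee_fin.
rewrite (EFinM K); apply: lee_wpmul2l; first by rewrite lee_fin.
rewrite -iint_nneseries//.
apply: (@le_trans _ _ (iint (fun y => Ck%:E * (powR (G y) s)%:E)%E)); last first.
  rewrite iintZl ?lee_fin//.
  - by rewrite (EFinM Ck); apply: lee_wpmul2l; rewrite ?lee_fin.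
  - exact/measurable_EFinP.
  - by move=> y; rewrite lee_fin powR_ge0.
apply: le_iint => y; first by apply: nneseries_ge0 => i _ _; rewrite lee_fin.
have [Gy0|Gy0] := eqVneq (G y) 0.
  rewrite eseries0 ?mule_ge0 ?lee_fin ?powR_ge0// => i _ _.
  by rewrite /F Gy0 powR0 ?mul0r// gt_eqF.
have Gp : 0 < G y by rewrite lt_neqAle eq_sym Gy0 G0.
have vp : 0 < powR (G y) s by exact: powR_gt0.
rewrite /F; under eq_eseriesr => i _ do rewrite EFinM.
rewrite nneseriesZl; last by move=> i _; rewrite lee_fin kap_ge0.
rewrite [leRHS]muleC; apply: lee_wpmul2l; first by rewrite lee_fin ltW.
exact: hk.
Qed.

End Carleson.

(** * Hedberg's balance of two geometric series *)

Section Hedberg.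
Context {R : realType}.

(* With this exponent [t], [1 - 1 / t = gamma / (2 * n)]. *)
Definition carleson_exp (n : nat) (gamma : R) : R := 2 * n%:R / (2 * n%:R - gamma).

(* The two bounds on [a i] (the uniform one and the one through the Carleson
   sum [X]) balance at [r ^ n * X = 1]; both decay geometrically away from it. *)
Lemma hedberg (n : nat) (gamma s bt K c : R) : (0 < n)%N -> 0 < gamma -> gamma < n%:R -> 1 <= s -> 1 <= bt ->
  0 <= K -> 0 <= c -> exists2 C : R, 0 <= C &
  forall (p1 p2 : R) (a A : nat -> \bar R), 1 <= p1 -> 1 <= p2 -> p2 <= bt ->
  n%:R / p1 - n%:R / p2 = gamma ->
  (forall i, 0 <= a i)%E -> (forall i, 0 <= A i)%E ->
  (forall i, A i <= (c * powR (erad i) (- n%:R / s))%:E)%E ->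
  (forall i, a i <= K%:E * poweR (A i) (s / p1))%E ->
  (poweR (\sum_(i <oo) ((powR (erad i) gamma)%:E * a i)) p2 <=
   C%:E * \sum_(i <oo) (powR (erad i) (n%:R * (carleson_exp n gamma - 1)))%:E *
      poweR (A i) (s * carleson_exp n gamma))%E.
Proof.
move=> n0 g0 gn s1 b1 K0 c0.
have n0R : 0 < n%:R :> R by rewrite ltr0n.
(* Decay rates on the two sides of v = r^n X = 1. For v >= 1 the exponent is 1/p2 >= 1/bt. For v <=
   1 it is 1/(t p1) - 1/p2 = gamma/n - gamma/(2 n p1) >= gamma/(2 n), since p1 >= 1. *)
pose dl := Num.min bt^-1 (gamma / (2 * n%:R)).
have dl0 : 0 < dl.
  by rewrite /dl lt_min invr_gt0 divr_gt0 ?mulr_gt0// andbT (lt_le_trans ltr01).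
have [Ck Ck0 hk] := series_kap n0R dl0.
pose c1 := powR (1 + c) s.
have c10 : 0 <= c1 by exact: powR_ge0.
have c11 : 1 <= c1.
  by rewrite /c1 -[leLHS](powRr0 (1 + c)); apply: ler_powR; ord_lra.
pose K1 := 1 + K * c1 * Ck.
have K11 : 1 <= K1 by rewrite lerDl !mulr_ge0.
exists (powR K1 bt); first exact: powR_ge0.
move=> p1 p2 a A p11 p21 p2b hp a0 A0 hA ha; set t := carleson_exp n gamma.
have p1p : 0 < p1 by ord_lra.
have p2p : 0 < p2 by ord_lra.
have d2 : 0 < 2 * n%:R - gamma by ord_lra.
have tE : t^-1 = 1 - gamma / (2 * n%:R).
  by rewrite /t /carleson_exp invf_div; field; rewrite !gt_eqF.
have t0 : 0 < t by rewrite /t /carleson_exp divr_gt0// mulr_gt0.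
have st0 : 0 < s * t by rewrite mulr_gt0//; ord_lra.
set X := (\sum_(i <oo) _ * poweR (A i) _)%E.
pose Y i := ((powR (erad i) (n%:R * (t - 1)))%:E * poweR (A i) (s * t))%E.
have Y0 i : (0 <= Y i)%E by rewrite mule_ge0 ?poweR_ge0// lee_fin powR_ge0.
have YX i : (Y i <= X)%E by exact: (nneseries_ge_term (u := Y)).
have X0 : (0 <= X)%E by apply: nneseries_ge0 => i _ _; exact: Y0.
have Kb0 : 0 < powR K1 bt by rewrite powR_gt0//; ord_lra.
have Afin i : A i = (fine (A i))%:E.
  rewrite fineK// ge0_fin_numE//; apply: le_lt_trans (hA i) _; exact: ltry.
pose u i := fine (A i).
have u0 i : 0 <= u i by rewrite fine_ge0.
have hu i : u i <= c * powR (erad i) (- n%:R / s) by rewrite -lee_fin -Afin.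
have sp0 : 0 < s / p1 by rewrite divr_gt0//; ord_lra.
have hau i : (a i <= (K * powR (u i) (s / p1))%:E)%E.
  by have := ha i; rewrite Afin.
case: X X0 YX => [x| |]//; last first.
  by move=> _ _; rewrite gt0_muley ?lte_fin// leey.
rewrite lee_fin le_eqVlt => /orP[/eqP <-|x0] YX.
  have uz i : u i = 0.
    have := YX i; rewrite /Y Afin /= -EFinM lee_fin.
    have r1 : 0 < powR (erad i) (n%:R * (t - 1)) by rewrite powR_gt0 ?erad_gt0.
    rewrite pmulr_rle0// => h; apply/eqP.
    have : powR (u i) (s * t) == 0 by rewrite eq_le h powR_ge0.
    by rewrite powR_eq0 => /andP[].
  rewrite eseries0 ?poweR0r ?mule0//; first by rewrite gt_eqF.
  move=> i _ _; suff -> : a i = 0%E by rewrite mule0.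
  apply/eqP; rewrite eq_le a0 andbT; apply: le_trans (hau i) _.
  by rewrite uz powR0 ?mulr0// gt_eqF.
have key i : powR (erad i) gamma * (K * powR (u i) (s / p1)) <=
    K * c1 * powR x p2^-1 * kap dl (powR (erad i) n%:R * x).
  have r0 : 0 < erad i := erad_gt0 i.
  have v0 : 0 < powR (erad i) n%:R * x by rewrite mulr_gt0 ?powR_gt0.
  have lnv : ln (powR (erad i) n%:R * x) = n%:R * ln (erad i) + ln x.
    by rewrite lnM ?posrE ?powR_gt0// ln_powR.
  rewrite mulrCA -[leRHS]mulrA -[leRHS]mulrA; apply: ler_wpM2l => //.
  have [v1|/ltW v1] := leP (powR (erad i) n%:R * x) 1.
    have ux : powR (u i) (s * t) <= powR (erad i) (- (n%:R * (t - 1))) * x.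
      have := YX i; rewrite /Y Afin /= -EFinM lee_fin => h.
      by rewrite powRN [leRHS]mulrC ler_pdivlMr ?powR_gt0// mulrC.
    have ux2 : powR (u i) (s / p1) <=
        powR (powR (erad i) (- (n%:R * (t - 1))) * x) (t * p1)^-1.
      have -> : s / p1 = (s * t) * (t * p1)^-1 by field; rewrite !gt_eqF.
      rewrite powRrM; apply: ler_powR2r; rewrite ?powR_ge0// invr_ge0 mulr_ge0//.
        exact: ltW.
      exact: ltW.
    apply: (@le_trans _ _ (powR x p2^-1 * powR (powR (erad i) n%:R * x)
        ((t * p1)^-1 - p2^-1))).
      apply: le_trans (ler_wpM2l (powR_ge0 _ _) ux2) _.
      rewrite le_eqVlt; apply/orP; left; apply/eqP.
      rewrite !powRM ?powR_ge0 ?(ltW x0)// -!powRrM [LHS]mulrA -powRDp// [RHS]mulrCA -powRDp//.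
      by congr (powR _ _ * powR _ _); rewrite -?hp; field; rewrite !gt_eqF.
    rewrite -[leLHS]mul1r; apply: ler_pM => //.
    - by rewrite mulr_ge0 ?powR_ge0.
    - apply: ler_wpM2l; first exact: powR_ge0.
      apply: powR_le_kap => //; first exact: ltW.
      rewrite invfM tE.
      have -> : p2^-1 = p1^-1 - gamma / n%:R.
        by rewrite -hp; field; rewrite !gt_eqF.
      have p1i : p1^-1 <= 1 by rewrite invf_le1.
      apply: (@le_trans _ _ (gamma / (2 * n%:R))); first by rewrite /dl ge_min lexx orbT.
      have -> : gamma / n%:R = 2 * (gamma / (2 * n%:R)) by field; rewrite gt_eqF.
      have : 0 <= gamma / (2 * n%:R) by rewrite divr_ge0 ?mulr_ge0 ?ltW.
      by move: (gamma / (2 * n%:R)) p1i => w; nra.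
  have ux2 : powR (u i) (s / p1) <= c1 * powR (erad i) (- n%:R / p1).
    apply: le_trans (ler_powR2r (ltW sp0) (u0 i) (hu i)) _.
    rewrite powRM ?powR_ge0// -powRrM.
    have -> : - n%:R / s * (s / p1) = - n%:R / p1 by field; rewrite !gt_eqF//; ord_lra.
    apply: ler_wpM2r; first exact: powR_ge0.
    apply: (@le_trans _ _ (powR (1 + c) (s / p1))).
      by apply: ler_powR2r => //; [exact: ltW|ord_lra].
    by apply: ler_powR; [ord_lra|rewrite ler_pdivrMr//; nra].
  apply: (@le_trans _ _ (c1 * (powR x p2^-1 * powR (powR (erad i) n%:R * x) (- p2^-1)))).
    apply: le_trans (ler_wpM2l (powR_ge0 _ _) ux2) _.
    rewrite mulrCA; apply: ler_wpM2l => //.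
    rewrite le_eqVlt; apply/orP; left; apply/eqP.
    rewrite powRM ?powR_ge0 ?(ltW x0)// -!powRrM mulrCA -!powRDp//.
    have -> : p2^-1 + - p2^-1 = 0 by rewrite subrr.
    by rewrite powRr0 mulr1; congr powR; rewrite -hp; field; rewrite !gt_eqF.
  apply: ler_wpM2l => //; apply: ler_wpM2l; first exact: powR_ge0.
  apply: powRN_le_kap => //; first exact: ltW.
  apply: (@le_trans _ _ bt^-1); first by rewrite /dl ge_min lexx.
  by rewrite lef_pV2 ?posrE//; ord_lra.
have x20 : 0 <= powR x p2^-1 by exact: powR_ge0.
have S0 : (0 <= \sum_(i <oo) ((powR (erad i) gamma)%:E * a i))%E.
  by apply: nneseries_ge0 => i _ _; rewrite mule_ge0// lee_fin powR_ge0.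
have S1 : (\sum_(i <oo) ((powR (erad i) gamma)%:E * a i) <= (K1 * powR x p2^-1)%:E)%E.
  apply: (@le_trans _ _ (\sum_(i <oo)
      ((K * c1 * powR x p2^-1)%:E * (kap dl (powR (erad i) n%:R * x))%:E))%E).
    apply: le_nneseries => i; first by rewrite mule_ge0// lee_fin powR_ge0.
    apply: le_trans (lee_wpmul2l _ (hau i)) _; first by rewrite lee_fin powR_ge0.
    by rewrite -!EFinM lee_fin.
  rewrite nneseriesZl; last by move=> i _; rewrite lee_fin kap_ge0.
  apply: le_trans (lee_wpmul2l _ (hk x x0)) _; first by rewrite lee_fin !mulr_ge0.
  rewrite -EFinM lee_fin mulrAC; apply: ler_wpM2r => //.
  by rewrite /K1 lerDr.
apply: le_trans (le_poweR (ltW p2p) S0 S1) _.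
rewrite /= -EFinM lee_fin powRM//; last by ord_lra.
rewrite -powRrM mulVf ?gt_eqF// powRr1 ?(ltW x0)//.
by apply: ler_wpM2r; [exact: ltW|exact: ler_powR].
Qed.

End Hedberg.

(** * The fractional integral dominated by a sum of averages *)

Section RieszSum.
Context {R : realType} {n : nat}.
Implicit Types f g : n.-tuple R -> R.

Definition riesz_sum (gamma : R) f x : \bar R :=
  (\sum_(i <oo) (powR (erad i) gamma)%:E * avg f x (erad i))%E.

Lemma riesz_term_ge0 (gamma : R) f x i : (forall y, 0 <= f y) ->
  (0 <= (powR (erad i) gamma)%:E * avg f x (erad i))%E.
Proof. by move=> f0; rewrite mule_ge0 ?avg_ge0// lee_fin powR_ge0. Qed.

Lemma riesz_sum_ge0 (gamma : R) f x : (forall y, 0 <= f y) -> (0 <= riesz_sum gamma f x)%E.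
Proof. by move=> f0; apply: nneseries_ge0 => i _ _; exact: riesz_term_ge0. Qed.

Lemma measurable_riesz_sum (gamma : R) f : measurable_fun setT f -> (forall y, 0 <= f y) ->
  measurable_fun setT (riesz_sum gamma f).
Proof.
move=> mf f0; apply: measurable_nneseries => i.
  by apply: measurable_funeM; exact: measurable_avg.
by move=> x; exact: riesz_term_ge0.
Qed.

Lemma le_riesz_sum (gamma : R) f g x : (forall y, 0 <= f y) -> (forall y, f y <= g y) ->
  (riesz_sum gamma f x <= riesz_sum gamma g x)%E.
Proof.
move=> f0 fg; apply: le_nneseries => i; first exact: riesz_term_ge0.
by apply: lee_wpmul2l; rewrite ?lee_fin ?powR_ge0//; exact: le_avg.
Qed.

Lemma riesz_sumD (gamma : R) f g x : measurable_fun setT f -> measurable_fun setT g ->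
  (forall y, 0 <= f y) -> (forall y, 0 <= g y) ->
  riesz_sum gamma (fun y => f y + g y) x = (riesz_sum gamma f x + riesz_sum gamma g x)%E.
Proof.
move=> mf mg f0 g0; rewrite /riesz_sum -nneseriesD.
- by apply: eq_eseriesr => i _; rewrite avgD// ge0_muleDr// avg_ge0.
- by move=> i _ _; exact: riesz_term_ge0.
- by move=> i _ _; exact: riesz_term_ge0.
Qed.

Lemma riesz_sumZ (gamma : R) f x (k : R) : measurable_fun setT f -> (forall y, 0 <= f y) ->
  0 <= k -> riesz_sum gamma (fun y => k * f y) x = (k%:E * riesz_sum gamma f x)%E.
Proof.
move=> mf f0 k0; rewrite /riesz_sum -nneseriesZl; last by move=> i _; exact: riesz_term_ge0.
by apply: eq_eseriesr => i _; rewrite /avg massZ// [RHS]muleCA; congr (_ * _)%E; rewrite muleCA.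
Qed.

(** One term is enough: some radius of the grid lies between d and e d, and replacing d by it costs
    at most exp (n - gamma). *)
Lemma kernel_le_series (gamma d : R) : gamma < n%:R -> 0 < d ->
  ((powR d (gamma - n%:R))%:E <= (expR (n%:R - gamma))%:E *
    \sum_(i <oo) (powR (erad i) (gamma - n%:R) * (if d < erad i then 1 else 0))%:E)%E.
Proof.
move=> gn d0; have [i /andP[di ie]] := exists_erad d0.
set u := fun i => (powR (erad i) (gamma - n%:R) * (if d < erad i then 1 else 0))%:E.
have u0 j : (0 <= u j)%E by rewrite lee_fin mulr_ge0 ?powR_ge0//; case: ifP.
apply: (@le_trans _ _ ((expR (n%:R - gamma))%:E * u i)%E); last first.
  by apply: lee_wpmul2l; [rewrite lee_fin expR_ge0|exact: nneseries_ge_term].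
rewrite /u di mulr1 -EFinM lee_fin.
rewrite !powR_expR ?erad_gt0// -expRD ler_expR.
have : ln (erad i) <= 1 + ln d.
  have -> : 1 + ln d = ln (expR 1 * d) by rewrite lnM ?posrE ?expR_gt0// expRK.
  by rewrite ler_ln ?posrE ?erad_gt0 ?mulr_gt0 ?expR_gt0.
nra.
Qed.

Lemma riesz_le_sum (gamma : R) f x : gamma < n%:R -> measurable_fun setT f ->
  (forall y, 0 <= f y) ->
  (iint (fun y => (f y * powR (edist x y) (gamma - n%:R))%:E) <=
   (expR (n%:R - gamma))%:E * riesz_sum gamma f x)%E.
Proof.
move=> gn mf f0.
pose u i y := ((powR (erad i) (gamma - n%:R))%:E * (ball_ind (erad i) x y * f y)%:E)%E.
have u0 i y : (0 <= u i y)%E.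
  by rewrite mule_ge0// lee_fin ?powR_ge0// mulr_ge0 ?ball_ind_ge0.
have mu i : measurable_fun setT (u i).
  by apply: measurable_funeM; exact: measurable_ball_indM.
have -> : riesz_sum gamma f x = iint (fun y => \sum_(i <oo) u i y)%E.
  rewrite iint_nneseries//; apply: eq_eseriesr => i _.
  rewrite /avg muleA -EFinM -powRDp ?erad_gt0// /u iintZl//.
  - exact: measurable_ball_indM.
  - by move=> y; rewrite lee_fin mulr_ge0 ?ball_ind_ge0.
  - by rewrite lee_fin powR_ge0.
rewrite -iintZl; last 3 first.
- exact: measurable_nneseries.
- by move=> y; apply: nneseries_ge0 => i _ _.
- by rewrite lee_fin expR_ge0.
apply: le_iint => y; first by rewrite lee_fin mulr_ge0 ?powR_ge0.
have R0 : (0 <= (expR (n%:R - gamma))%:E * \sum_(i <oo) u i y)%E.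
  by rewrite mule_ge0 ?lee_fin ?expR_ge0// nneseries_ge0.
(* On the diagonal the kernel is 0, because [powR 0] takes the value 0 at nonzero exponents. *)
have := eudist_ge0 x y; rewrite le_eqVlt => /orP[/eqP d0|d0].
  by rewrite -d0 powR0 ?mulr0// lt_eqF// subr_lt0.
rewrite EFinM; apply: le_trans (lee_wpmul2l _ (kernel_le_series gn d0)) _.
  by rewrite lee_fin.
rewrite muleCA; apply: lee_wpmul2l; first by rewrite lee_fin expR_ge0.
rewrite -nneseriesZl; last first.
  by move=> i _; rewrite lee_fin mulr_ge0 ?powR_ge0//; case: ifP.
apply: le_nneseries => i.
  by rewrite mule_ge0// lee_fin// mulr_ge0 ?powR_ge0//; case: ifP.
by rewrite /u -!EFinM lee_fin /ball_ind mulrCA [f y * _]mulrC.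
Qed.

End RieszSum.

(** * Consequences of log-Hölder continuity: freezing the exponent, the limit at infinity *)

Section LogHolder.
Context {R : realType} {n : nat}.
Implicit Types (x y : n.-tuple R) (p : n.-tuple R -> R).

Definition lognorm x : R := ln (enorm x + expR 1).

Lemma enormD_gt0 x : 0 < enorm x + expR 1 :> R.
Proof. by rewrite ltr_wpDl ?enorm_ge0 ?expR_gt0. Qed.

Lemma lognorm_ge1 x : 1 <= lognorm x.
Proof.
rewrite /lognorm -[leLHS](@expRK R) ler_ln ?posrE ?expR_gt0 ?enormD_gt0//.
by rewrite lerDr enorm_ge0.
Qed.

Lemma expR1_ge2 : 2 <= expR 1 :> R.
Proof. by have := expR_ge1Dx (1 : R); rewrite -natr1. Qed.

Lemma lognorm_half x y : enorm x <= 2 * enorm y + 1 -> lognorm x <= 2 * lognorm y.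
Proof.
move=> h; have e2 := expR1_ge2; have y0 := enorm_ge0 y.
have -> : 2 * lognorm y = ln ((enorm y + expR 1) * (enorm y + expR 1)).
  by rewrite lnM ?posrE ?enormD_gt0// mulr_natl.
rewrite ler_ln ?posrE ?mulr_gt0 ?enormD_gt0//; nra.
Qed.

Lemma exists_lognorm (c : R) : (0 < n)%N -> exists x : n.-tuple R, c <= lognorm x.
Proof.
move=> n0; have [x hx] := exists_enorm n0 (expR_ge0 c).
exists x; rewrite /lognorm hx -[leLHS]expRK ler_ln ?posrE ?addr_gt0 ?expR_gt0//.
by rewrite lerDl expR_ge0.
Qed.

(** The intervals [p x - d x, p x + d x], with d x = C / lognorm x, meet pairwise by the decay
    condition; the supremum of their left ends therefore belongs to all of them. *)
Lemma exists_limit_exponent (C : R) p : (0 < n)%N -> 0 < C -> log_holder C p ->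
  exists pinf, forall x, `|p x - pinf| <= C / lognorm x.
Proof.
move=> n0 C0 [_ hp]; pose d x := C / lognorm x.
have key x y : p x - d x <= p y + d y.
  have [xy|/ltW yx] := leP (enorm x) (enorm y).
    have := hp x y xy; rewrite -/(lognorm x) -/(d x) ler_norml => /andP[_ h].
    have : 0 <= d y by rewrite divr_ge0 ?(ltW C0)// (le_trans ler01)// lognorm_ge1.
    by move: h; ord_lra.
  have := hp y x yx; rewrite -/(lognorm y) -/(d y) ler_norml => /andP[h _].
  have : 0 <= d x by rewrite divr_ge0 ?(ltW C0)// (le_trans ler01)// lognorm_ge1.
  by move: h; ord_lra.
pose E := range (fun x => p x - d x).
have E0 : E !=set0 by exists (p (cst_tuple 0) - d (cst_tuple 0)); exists (cst_tuple 0).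
have ubE y : ubound E (p y + d y) by move=> _ [x _ <-]; exact: key.
exists (sup E) => y; rewrite ler_norml; apply/andP; split.
  by have : sup E <= p y + d y by [apply: ge_sup]; rewrite -/(d y); ord_lra.
have : p y - d y <= sup E.
  by apply: ub_le_sup; [exists (p y + d y)|exists y].
by rewrite -/(d y); ord_lra.
Qed.

Lemma limit_exponent_ge (C s pinf : R) p : (0 < n)%N -> 0 < C ->
  (forall x, `|p x - pinf| <= C / lognorm x) -> (forall x, s <= p x) -> s <= pinf.
Proof.
move=> n0 C0 hp sp; apply/ler_addgt0Pr => e e0.
have [x hx] := exists_lognorm (C / e) n0.
have l0 : 0 < lognorm x by rewrite (lt_le_trans ltr01)// lognorm_ge1.
have : C / lognorm x <= e by rewrite ler_pdivrMr// mulrC -ler_pdivrMr.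
have := hp x; have := sp x; rewrite ler_norml => h1 /andP[h2 h3]; ord_lra.
Qed.

Lemma limit_exponent_le (C s pinf : R) p : (0 < n)%N -> 0 < C ->
  (forall x, `|p x - pinf| <= C / lognorm x) -> (forall x, p x <= s) -> pinf <= s.
Proof.
move=> n0 C0 hp sp; apply/ler_addgt0Pr => e e0.
have [x hx] := exists_lognorm (C / e) n0.
have l0 : 0 < lognorm x by rewrite (lt_le_trans ltr01)// lognorm_ge1.
have : C / lognorm x <= e by rewrite ler_pdivrMr// mulrC -ler_pdivrMr.
have := hp x; have := sp x; rewrite ler_norml => h1 /andP[h2 h3]; ord_lra.
Qed.

(** This bounds r^(p x - p y) from above and below on B(x, 2 r). For r <= 1/4 the local condition
    applies, and dist^2 <= 4 r^2 <= r compares the logarithms. For larger r the decay condition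
    applies: |ln r| is at most 2 [lognorm x] because 4 r <= 1 + |x|, and all points of the ball have
    a comparable [lognorm]. *)
Lemma log_holder_near (C : R) p x y (r : R) : 0 < C -> log_holder C p -> 0 < r ->
  4 * r <= 1 + enorm x -> edist x y < 2 * r -> `|p x - p y| * `|ln r| <= 4 * C.
Proof.
move=> C0 [hloc hinf] r0 rx dxy.
have [r4|r4] := leP r (1 / 4).
  have := hloc x y; have d12 : edist x y <= 1 / 2 by ord_lra.
  move=> /(_ d12) h.
  (* At distance 0 the local condition reads |p x - p y| <= 0, as ln 0 and the inverse of 0 are both
     0. *)
  have := eudist_ge0 x y; rewrite le_eqVlt => /orP[/eqP d0|d0].
    move: h; rewrite -d0 ln0// oppr0 invr0 mulr0 => h.
    have -> : `|p x - p y| = 0 by apply/eqP; rewrite eq_le h normr_ge0.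
    by rewrite mul0r mulr_ge0// ltW.
  have lr : ln r < 0 by rewrite ln_lt0// r0/=; ord_lra.
  have ld : 0 < - ln (edist x y) by rewrite oppr_gt0 ln_lt0// d0/=; ord_lra.
  have h2 : - ln r <= 2 * - ln (edist x y).
    have : ln (edist x y * edist x y) <= ln r.
      by rewrite ler_ln ?posrE ?mulr_gt0//; nra.
    by rewrite lnM ?posrE//; ord_lra.
  rewrite (ltr0_norm lr); apply: le_trans (ler_pM _ _ h h2) _ => //; first by ord_lra.
  rewrite mulrCA divfK ?gt_eqF//; ord_lra.
have lx := lognorm_ge1 x; have ly := lognorm_ge1 y.
have rr : `|ln r| <= 2 * lognorm x.
  rewrite ler_norml; apply/andP; split.
    have : - 2 <= ln r; last by ord_lra.
    rewrite -[leLHS]expRK ler_ln ?posrE ?expR_gt0//.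
    apply: le_trans (ltW r4); rewrite expRN div1r lef_pV2 ?posrE ?expR_gt0//.
    have -> : 2 = 1 + 1 :> R by ord_lra.
    by rewrite expRD; have := expR1_ge2; nra.
  have : ln r <= lognorm x; last by ord_lra.
  rewrite ler_ln ?posrE ?enormD_gt0//.
  by have := expR1_ge2; have := enorm_ge0 x; ord_lra.
have pp : `|p x - p y| <= 2 * (C / lognorm x).
  have [xy|/ltW yx] := leP (enorm x) (enorm y).
    apply: le_trans (hinf x y xy) _; rewrite -/(lognorm x).
    have : 0 <= C / lognorm x by rewrite divr_ge0 ?ltW//; ord_lra.
    ord_lra.
  rewrite distrC; apply: le_trans (hinf y x yx) _; rewrite -/(lognorm y).
  have h : lognorm x <= 2 * lognorm y.
    apply: lognorm_half; have := enorm_le_edist x y; rewrite eudistC.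
    by rewrite eudistC; ord_lra.
  rewrite ler_pdivrMr; last by ord_lra.
  rewrite -[leLHS]mulr1 mulrC -mulrA [C / _ * _]mulrAC mulrA mulrA.
  rewrite ler_pdivlMr; [nra|ord_lra].
apply: le_trans (ler_pM _ _ pp rr) _ => //.
have -> : 2 * (C / lognorm x) * (2 * lognorm x) = 4 * C.
  by field; rewrite gt_eqF//; ord_lra.
exact: lexx.
Qed.

(** An integrable error term, chosen as a power of |x| + e so that - ln (decay x) is a multiple of
    [lognorm x]. *)
Definition decay x : R := powR (enorm x + expR 1) (- n.+1%:R).

Lemma decay_ge0 x : 0 <= decay x. Proof. exact: powR_ge0. Qed.

Lemma measurable_decay : measurable_fun setT decay.
Proof.
apply: measurable_powR2 => //; apply: measurable_funD => //.
exact: measurable_enorm.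
Qed.

(** If v >= decay x, then |ln v| is at most (n+1) lognorm x, so that changing the exponent costs a
    factor exp ((n+1) C). If v < decay x, then v^a <= v is already below the error term. *)
Lemma powR_le_decay (C a b v : R) x : 0 <= C -> `|a - b| <= C / lognorm x ->
  1 <= a -> 1 <= b -> 0 <= v -> v <= 1 ->
  powR v a <= expR (n.+1%:R * C) * powR v b + decay x.
Proof.
move=> C0 ab a1 b1 v0 v1; have d0 := decay_ge0 x.
have [->|vn0] := eqVneq v 0; first by rewrite !powR0 ?mulr0 ?add0r// gt_eqF//; ord_lra.
have vp : 0 < v by rewrite lt_neqAle eq_sym vn0.
have [hv|hv] := leP (decay x) v; last first.
  apply: (@le_trans _ _ v); first by apply: ge1r_powR; rewrite ?vp.
  rewrite (le_trans (ltW hv))// lerDr mulr_ge0 ?powR_ge0// expR_ge0//.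
rewrite -[leLHS]addr0 lerD// !powR_expR// -expRD ler_expR.
have lx := lognorm_ge1 x.
have lv : ln v <= 0 by rewrite ln_le0.
have lv2 : - ln v <= n.+1%:R * lognorm x.
  have : - (n.+1%:R * lognorm x) <= ln v; last by ord_lra.
  have -> : - (n.+1%:R * lognorm x) = ln (decay x).
    by rewrite /decay ln_powR mulNr.
  by rewrite ler_ln ?posrE// /decay powR_gt0// enormD_gt0.
have h : (b - a) * - ln v <= C / lognorm x * (n.+1%:R * lognorm x).
  apply: le_trans (ler_norm _) _; rewrite normrM distrC; apply: ler_pM => //.
  by rewrite ger0_norm//; ord_lra.
have -> : n.+1%:R * C = C / lognorm x * (n.+1%:R * lognorm x).
  by field; rewrite gt_eqF//; ord_lra.
ord_lra.
Qed.

(** Up to a constant, [decay] at x is r^(-n-1) for a grid radius r > |x| with r >= 1. Against the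
    volume of B(0, r) this leaves the sum of 1/r over the radii r >= 1. *)
Lemma iint_decay : exists2 H : R, 0 <= H & (iint (fun x => (decay x)%:E) <= H%:E)%E.
Proof.
have [Ck Ck0 hk] := @series_kap R 1 1 ltr01 ltr01.
pose o : n.-tuple R := cst_tuple 0.
pose K : R := expR n.+1%:R.
exists (K * (2 ^+ n * Ck)); first by rewrite !mulr_ge0 ?expR_ge0 ?exprn_ge0.
pose u i x := ((powR (erad i : R) (- n.+1%:R) * (if 1 <= (erad i : R) then 1 else 0))%:E
  * (ball_ind (erad i) o x)%:E)%E.
have w0 i : 0 <= powR (erad i : R) (- n.+1%:R) * (if 1 <= (erad i : R) then 1 else 0).
  by rewrite mulr_ge0 ?powR_ge0//; case: ifP.
have u0 i x : (0 <= u i x)%E by rewrite mule_ge0 ?lee_fin ?ball_ind_ge0.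
have mb i : measurable_fun setT (fun x => (ball_ind (erad i) o x)%:E).
  by apply/measurable_EFinP; exact: measurable_ball_ind.
have mu i : measurable_fun setT (u i) by apply: measurable_funeM.
have pw x : ((decay x)%:E <= K%:E * \sum_(i <oo) u i x)%E.
  have [i /andP[h1 h2]] := exists_erad (enormD_gt0 x).
  apply: (@le_trans _ _ (K%:E * u i x)%E); last first.
    apply: lee_wpmul2l; first by rewrite lee_fin expR_ge0.
    exact: (nneseries_ge_term (u := fun i => u i x)).
  have e1 : 1 <= expR 1 :> R by have := expR1_ge2; ord_lra.
  have x0 := enorm_ge0 x.
  have r1 : 1 <= erad i :> R by apply: le_trans (ltW h1); rewrite ler_wpDl ?enorm_ge0.
  have bx : ball_ind (erad i) o x = 1.
    rewrite ball_indC /ball_ind edist_cst_tuple0 ifT//; apply: lt_trans h1.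
    by rewrite ltrDl expR_gt0.
  rewrite /u bx r1 mule1 mulr1 -EFinM lee_fin /decay /K.
  rewrite !powR_expR ?erad_gt0 ?enormD_gt0// -expRD ler_expR.
  have : ln (erad i) <= 1 + ln (enorm x + expR 1) :> R.
    rewrite -[X in X + _](@expRK R) -lnM ?posrE ?expR_gt0 ?enormD_gt0//.
    by rewrite ler_ln ?posrE ?mulr_gt0 ?expR_gt0 ?erad_gt0 ?enormD_gt0.
  have : 0 <= n.+1%:R :> R by [].
  by move: (n.+1%:R) => m; nra.
apply: le_trans (le_iint _ pw) _; first by move=> x; rewrite lee_fin decay_ge0.
rewrite iintZl; last 3 first.
- exact: measurable_nneseries.
- by move=> x; apply: nneseries_ge0 => i _ _.
- by rewrite lee_fin expR_ge0.
rewrite (EFinM K); apply: lee_wpmul2l; first by rewrite lee_fin expR_ge0.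
rewrite iint_nneseries// EFinM.
have hk1 := hk 1 ltr01.
apply: le_trans (lee_wpmul2l _ hk1); last by rewrite lee_fin exprn_ge0.
rewrite -nneseriesZl; last by move=> i _; rewrite lee_fin kap_ge0.
apply: le_nneseries => i; first exact: iint_ge0.
rewrite iintZl//; last 2 first.
- by move=> x; rewrite lee_fin ball_ind_ge0.
- by rewrite lee_fin.
apply: le_trans (lee_wpmul2l _ (iint_ball_le o (erad_ge0 i))) _; first by rewrite lee_fin.
rewrite -!EFinM lee_fin; case: ifPn => r1; last first.
  by rewrite mulr0 mul0r mulr_ge0 ?kap_ge0 ?exprn_ge0.
rewrite mulr1 exprMn mulrCA; apply: ler_wpM2l; first by rewrite exprn_ge0.
have r0 := erad_gt0 i.
rewrite powRr1 ?erad_ge0// mulr1.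
have -> : powR (erad i) (- n.+1%:R) * erad i ^+ n = powR (erad i) (- 1) :> R.
  rewrite -powR_mulrn ?erad_ge0// -powRDp//; congr powR; rewrite -natr1; ord_lra.
by apply: powRN_le_kap.
Qed.

End LogHolder.

(** * Sobolev exponents and pointwise estimates with a variable exponent *)

Section StrongType.
Context {R : realType} {n : nat}.
Implicit Types (x y : n.-tuple R) (f G : n.-tuple R -> R).

Lemma carleson_exp_gt1 (gamma : R) : (0 < n)%N -> 0 < gamma -> gamma < n%:R ->
  1 < carleson_exp n gamma.
Proof.
move=> n0 g0 gn; have n0R : 0 < n%:R :> R by rewrite ltr0n.
by rewrite /carleson_exp ltr_pdivlMr; ord_lra.
Qed.

Lemma sobolev_exp_bounds (gamma a b : R) : 0 < n%:R :> R -> 0 < gamma -> 0 < a -> 0 < b ->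
  n%:R / a - n%:R / b = gamma -> a <= b.
Proof.
move=> n0 g0 a0 b0 h.
have : n%:R / b <= n%:R / a by ord_lra.
by rewrite ler_pM2l// lef_pV2 ?posrE.
Qed.

Lemma sobolev_exp_mono (gamma a b c d : R) : 0 < n%:R :> R -> 0 < a -> 0 < b -> 0 < c -> 0 < d ->
  n%:R / a - n%:R / b = gamma -> n%:R / c - n%:R / d = gamma -> a <= c -> b <= d.
Proof.
move=> n0 a0 b0 c0 d0 h1 h2 ac.
have h : n%:R / c <= n%:R / a by rewrite ler_pM2l// lef_pV2 ?posrE.
have : n%:R / d <= n%:R / b by ord_lra.
by rewrite ler_pM2l// lef_pV2 ?posrE.
Qed.

Lemma exists_sobolev_exp (gamma a b c : R) : 0 < n%:R :> R -> 0 < a -> 0 < b -> 0 < c ->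
  n%:R / a - n%:R / b = gamma -> c <= a ->
  exists2 d, 0 < d & n%:R / c - n%:R / d = gamma.
Proof.
move=> n0 a0 b0 c0 h ca.
have h1 : n%:R / a <= n%:R / c by rewrite ler_pM2l// lef_pV2 ?posrE.
have h2 : 0 < n%:R / b by rewrite divr_gt0.
have h3 : 0 < n%:R / c - gamma by ord_lra.
exists (n%:R / (n%:R / c - gamma)); first by rewrite divr_gt0.
rewrite invf_div mulrCA divff ?gt_eqF// mulr1; ord_lra.
Qed.

(** The Hardy-Littlewood-Sobolev case of constant exponents, where [a] and [A] in [hedberg] are both
    the averages of f. *)
Lemma hls_pointwise (gamma s s2 M : R) : (0 < n)%N -> 0 < gamma -> gamma < n%:R ->
  1 < s -> 0 < s2 -> n%:R / s - n%:R / s2 = gamma -> 0 <= M ->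
  exists2 C : R, 0 <= C & forall f, measurable_fun setT f -> (forall y, 0 <= f y) ->
  (iint (fun y => (powR (f y) s)%:E) <= M%:E)%E -> forall x,
  (poweR (riesz_sum gamma f x) s2 <= C%:E * carleson_sum s (carleson_exp n gamma) f x)%E.
Proof.
move=> n0 g0 gn s1 s20 hs M0.
have n0R : 0 < n%:R :> R by rewrite ltr0n.
have ss2 : s <= s2 by apply: (sobolev_exp_bounds n0R g0 _ s20 hs); ord_lra.
have c0 : 0 <= 2 ^+ n + M by rewrite addr_ge0// exprn_ge0.
have s21 : 1 <= s2 by ord_lra.
have [C C0 hC] := hedberg n0 g0 gn (ltW s1) s21 (@ler01 R) c0.
exists C => // f mf f0 fM x.
apply: (hC s s2 _ (fun i => avg f x (erad i))) => //.
- exact: ltW.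
- by move=> i; exact: avg_ge0.
- by move=> i; exact: avg_ge0.
- by move=> i; apply: avg_le_Ls => //; [exact: ltW|exact: erad_gt0].
- move=> i; rewrite divff ?gt_eqF//; last by ord_lra.
  by rewrite poweRe1 ?avg_ge0// mul1e.
Qed.

Lemma le_mass_ball f g x (r : R) : (forall y, 0 <= f y) ->
  (forall y, edist x y < r -> f y <= g y) -> (mass f x r <= mass g x r)%E.
Proof.
move=> f0 fg; apply: le_iint => y; first by rewrite lee_fin mulr_ge0 ?ball_ind_ge0.
by rewrite lee_fin /ball_ind; case: ifPn => h; rewrite ?mul0r// !mul1r fg.
Qed.

(** Divided by [K] the value is at most 1, and lowering the exponent then enlarges the power. *)
Lemma poweR_bounded_change (u : \bar R) (K a b bt : R) : (0 <= u)%E -> 1 <= K ->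
  (u <= K%:E)%E -> 0 < b -> b <= a -> a <= bt ->
  (poweR u a <= (powR K bt)%:E * poweR u b)%E.
Proof.
case: u => [u| |]//; rewrite !lee_fin => u0 K1 uK b0 ba ab.
have K0 : 0 < K by ord_lra.
have [->|un0] := eqVneq u 0.
  by rewrite !powR0 ?mulr0// gt_eqF//; ord_lra.
have up : 0 < u by rewrite lt_neqAle eq_sym un0.
have -> : powR u a = powR K a * powR (u / K) a.
  by rewrite -powRM ?divr_ge0 ?(ltW K0)// mulrCA divff ?gt_eqF// mulr1.
have uK1 : u / K <= 1 by rewrite ler_pdivrMr// mul1r.
have uK0 : 0 < u / K by rewrite divr_gt0.
apply: ler_pM; rewrite ?powR_ge0//; first exact: ler_powR.
apply: (@le_trans _ _ (powR (u / K) b)); first by apply: ger_powR; rewrite ?uK0.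
apply: ler_powR2r; [exact: ltW|exact: ltW|].
by rewrite ler_pdivrMr// ler_peMr.
Qed.

Lemma poweR_bounded_decay (u : \bar R) (K a b bt C : R) x : (0 <= u)%E -> 1 <= K ->
  (u <= K%:E)%E -> 0 <= C -> `|a - b| <= C / lognorm x -> 1 <= a -> 1 <= b -> a <= bt ->
  (poweR u a <= (powR K bt * expR (n.+1%:R * C))%:E * poweR u b +
     (powR K bt * decay x)%:E)%E.
Proof.
case: u => [u| |]//; rewrite !lee_fin => u0 K1 uK C0 abC a1 b1 ab.
have K0 : 0 < K by ord_lra.
have -> : powR u a = powR K a * powR (u / K) a.
  by rewrite -powRM ?divr_ge0 ?(ltW K0)// mulrCA divff ?gt_eqF// mulr1.
have uK1 : u / K <= 1 by rewrite ler_pdivrMr// mul1r.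
have uK0 : 0 <= u / K by rewrite divr_ge0// ltW.
have h := powR_le_decay C0 abC a1 b1 uK0 uK1.
have Kb : powR K a <= powR K bt by exact: ler_powR.
apply: le_trans (ler_pM (powR_ge0 _ _) (powR_ge0 _ _) Kb h) _.
rewrite mulrDr mulrA lerD2r; apply: ler_wpM2l.
  by rewrite mulr_ge0 ?powR_ge0 ?expR_ge0.
by apply: ler_powR2r => //; [ord_lra|rewrite ler_pdivrMr// ler_peMr].
Qed.

(* For [f] valued in [{0} U [1, oo[], averages over small balls satisfy
   [avg f ^ p(x) <= C (avg (f ^ (p / s))) ^ s]: since [avg f <= r ^ (- n)], freezing
   the exponent at the center costs a bounded factor. *)
Lemma local_jensen (C s bt : R) (p : n.-tuple R -> R) : (0 < n)%N -> 0 < C ->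
  log_holder C p -> measurable_fun setT p -> 1 < s -> (forall x, s <= p x) ->
  (forall x, p x <= bt) ->
  exists2 K : R, 0 <= K & forall f, measurable_fun setT f ->
  (forall y, f y = 0 \/ 1 <= f y) ->
  (iint (fun y => (powR (f y) (p y))%:E) <= 1%:E)%E ->
  forall x (r : R), 0 < r -> r <= 1 / 4 ->
  (avg f x r <= K%:E * poweR (avg (fun y => powR (f y) (p y / s)) x r) (s / p x))%E.
Proof.
move=> n0 C0 hp mp s1 sp pb.
have s0 : 0 < s by ord_lra.
pose L : R := bt * (n.+1%:R * ln 2) + n%:R * (4 * C).
have bt0 : 0 < bt by have := pb (cst_tuple 0); have := sp (cst_tuple 0); ord_lra.
have ln2 : 0 <= ln 2 :> R by rewrite ln_ge0//; ord_lra.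
have L0 : 0 <= L by rewrite addr_ge0// ?mulr_ge0// ltW.
have eL : 1 <= expR L by rewrite -[leLHS](@expR0 R) ler_expR.
exists (2 ^+ n.+1 * expR L); first by rewrite mulr_ge0 ?exprn_ge0 ?expR_ge0.
move=> f mf f01 fp x r r0 r4.
have f0 y : 0 <= f y by case: (f01 y) => [->//|]; ord_lra.
pose m y := p y / s.
have m1 y : 1 <= m y by rewrite ler_pdivlMr// mul1r.
have mm : measurable_fun setT m by apply: measurable_funM.
pose G y := powR (f y) (m y).
have G0 y : 0 <= G y by exact: powR_ge0.
have mG : measurable_fun setT G by exact: measurable_powR2.
have fG y : f y <= G y.
  rewrite /G; case: (f01 y) => [->|f1]; first by rewrite powR_ge0.
  exact: le1r_powR.
have fP y : f y <= powR (f y) (p y).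
  case: (f01 y) => [->|f1]; first by rewrite powR_ge0.
  by apply: le1r_powR => //; have := sp y; ord_lra.
have rn0 : 0 < r ^+ n by rewrite exprn_gt0.
have px0 : 0 < p x by have := sp x; ord_lra.
have af : (avg f x r <= (powR r (- n%:R))%:E)%E.
  rewrite /avg -[leRHS]mule1; apply: lee_wpmul2l; first by rewrite lee_fin powR_ge0.
  apply: le_trans (le_mass_iint x r f0) _; apply: le_trans fp.
  by apply: le_iint => y; rewrite lee_fin.
have A0 := avg_ge0 x r f0.
have AG0 := avg_ge0 x r G0.
have afG : (avg f x r <= avg G x r)%E by exact: le_avg.
have sp1 : s / p x <= 1 by rewrite ler_pdivrMr// mul1r.
have sp0 : 0 <= s / p x by rewrite divr_ge0// ltW.
have K1 : 1 <= 2 ^+ n.+1 * expR L.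
  by rewrite -[leLHS]mulr1; apply: ler_pM => //; rewrite -natrX ler1n expn_gt0.
have Afin : avg f x r \is a fin_num.
  by rewrite ge0_fin_numE//; apply: le_lt_trans af _; exact: ltry.
set a := avg f x r in af A0 afG Afin *.
have := fineK Afin; move: (fine a) => av aE; rewrite -aE in af A0 afG *.
rewrite !lee_fin in af A0.
(* Since s / p x <= 1, an average below 1 is at most its own power s / p x, and f <= G concludes. *)
have [a1|/ltW a1] := leP av 1.
  have [a0|an0] := eqVneq av 0.
    by rewrite a0 mule_ge0 ?poweR_ge0// lee_fin (le_trans ler01).
  have ap : 0 < av by rewrite lt_neqAle eq_sym an0.
  apply: (@le_trans _ _ (poweR (avg G x r) (s / p x))).
    apply: le_trans (le_poweR sp0 _ afG); last by rewrite lee_fin.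
    by rewrite /= lee_fin; apply: ger1_powR => //; rewrite ap.
  by rewrite -[leLHS]mul1e; apply: lee_wpmul2r; rewrite ?poweR_ge0 ?lee_fin.
(* At this height the constant term of [mass_young], once normalized, is half of the average and is
   absorbed by the left side. *)
pose lam := av / 2 ^+ n.+1.
have two0 : 0 < 2 ^+ n.+1 :> R by rewrite exprn_gt0.
have l0 : 0 < lam by rewrite divr_gt0//; ord_lra.
have lnlam : `|ln lam| <= n.+1%:R * ln 2 + n%:R * `|ln r|.
  have -> : ln lam = ln av - n.+1%:R * ln 2.
    by rewrite /lam lnM ?posrE ?invr_gt0//; [rewrite lnV ?posrE// lnXn// mulr_natl|ord_lra].
  have h1 : 0 <= ln av by rewrite ln_ge0.
  have h2 : ln av <= n%:R * - ln r.
    have av0 : 0 < av by ord_lra.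
    by rewrite mulrN -mulNr -ln_powR ler_ln ?posrE ?powR_gt0.
  have lr : ln r < 0 by rewrite ln_lt0// r0/=; ord_lra.
  rewrite (ltr0_norm lr); have : 0 <= n.+1%:R * ln 2 :> R by rewrite mulr_ge0.
  move: h1 h2; move: (n%:R * - ln r) (n.+1%:R * ln 2) (ln av) => u v w h1 h2 h3.
  by rewrite ler_norml; apply/andP; split; ord_lra.
(* From 1 <= av <= r^(-n) one has |ln lam| <= (n+1) ln 2 + n |ln r|; the oscillation of p over the
   ball is bounded and is also O(1/|ln r|), so freezing the exponent of [lam] at x costs at most exp
   L. *)
have osc y : edist x y < r -> powR lam (1 - m y) <= expR L * powR lam (1 - m x).
  move=> xy; rewrite !powR_expR// -expRD ler_expR.
  have near : `|p x - p y| * `|ln r| <= 4 * C.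
    apply: log_holder_near => //; last by ord_lra.
    by have := enorm_ge0 x; ord_lra.
  have pxy : `|p x - p y| <= bt.
    have := sp x; have := sp y; have := pb x; have := pb y => *.
    by rewrite ler_norml; apply/andP; split; ord_lra.
  have : (m x - m y) * ln lam <= L; last by ord_lra.
  apply: le_trans (ler_norm _) _; rewrite normrM /m -mulrBl normrM.
  have sv : `|s^-1| <= 1 by rewrite ger0_norm ?invr_ge0 ?(ltW s0)// invf_le1//; ord_lra.
  apply: (@le_trans _ _ (`|p x - p y| * (n.+1%:R * ln 2 + n%:R * `|ln r|))).
    apply: ler_pM => //.
    by rewrite -[leRHS]mulr1; apply: ler_pM.
  rewrite mulrDr /L; apply: lerD; first by apply: ler_wpM2r => //; rewrite mulr_ge0.
  by rewrite mulrCA; apply: ler_wpM2l.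
have half : ((av / 2)%:E <= (expR L * powR lam (1 - m x))%:E * avg G x r)%E.
  have := mass_young x mf mm f0 m1 l0 (ltW r0).
  move=> /(@lee_wpmul2l _ (powR r (- n%:R))%:E); rewrite lee_fin powR_ge0 => /(_ isT).
  rewrite -/(avg f x r) -/a -aE.
  have h1 : powR r (- n%:R) * (lam * (2 * r) ^+ n) = av / 2.
    rewrite /lam exprMn powRN powR_mulrn ?(ltW r0)// exprS.
    by field; rewrite ?gt_eqF// ?exprn_gt0.
  have h0 y : 0 <= lam * powR (f y / lam) (m y) by rewrite mulr_ge0 ?powR_ge0// ltW.
  have h2 : (mass (fun y => lam * powR (f y / lam) (m y))%R x r <=
      (expR L * powR lam (1 - m x))%:E * mass G x r)%E.
    rewrite -massZ ?mulr_ge0 ?expR_ge0 ?powR_ge0//.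
    apply: le_mass_ball => // y /osc ho.
    apply: (@le_trans _ _ (powR lam (1 - m y) * G y)); last by apply: ler_wpM2r.
    rewrite le_eqVlt; apply/orP; left; apply/eqP.
    rewrite powRM// ?invr_ge0 ?(ltW l0)// mulrCA [RHS]mulrC; congr (_ * _).
    by rewrite -powR_inv1 ?(ltW l0)// -powRrM powRDp// powRr1 ?(ltW l0)// mulN1r.
  rewrite ge0_muleDr; last 2 first.
  - by rewrite lee_fin mulr_ge0 ?exprn_ge0 ?mulr_ge0 ?(ltW l0) ?(ltW r0).
  - exact: mass_ge0.
  rewrite -EFinM h1 => h3.
  have h4 : (av%:E <= (av / 2)%:E + (expR L * powR lam (1 - m x))%:E * avg G x r)%E.
    apply: le_trans h3 _; apply: leeD2l.
    apply: le_trans (lee_wpmul2l _ h2) _; first by rewrite lee_fin powR_ge0.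
    by rewrite muleCA.
  have : (av%:E - (av / 2)%:E <= (expR L * powR lam (1 - m x))%:E * avg G x r)%E.
    by rewrite leeBlDl.
  by rewrite -EFinB; congr (_%:E <= _)%E; ord_lra.
have Ll : 0 < expR L * powR lam (1 - m x) by rewrite mulr_gt0 ?expR_gt0 ?powR_gt0.
case: (avg G x r) AG0 half => [g| |]//; last first.
  move=> _ _; rewrite poweRyr; last by rewrite mulf_neq0// ?gt_eqF ?invr_gt0.
  by rewrite gt0_muley ?leey// lte_fin; ord_lra.
rewrite lee_fin => g0; rewrite -EFinM lee_fin => half.
rewrite /= lee_fin.
have hl : powR lam (m x) <= expR L * g.
  have : powR lam (m x - 1) * (av / 2) <= expR L * g.
    apply: le_trans (ler_wpM2l (powR_ge0 _ _) half) _.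
    rewrite mulrA mulrCA -powRDp// le_eqVlt; apply/orP; left; apply/eqP.
    by have -> : m x - 1 + (1 - m x) = 0 by [ord_lra]; rewrite powRr0 mulr1.
  apply: le_trans; rewrite powRDp// powRN powRr1 ?(ltW l0)// -mulrA -[leLHS]mulr1.
  apply: ler_wpM2l; first exact: powR_ge0.
  rewrite ler_pdivlMl// mulr1 /lam ler_pdivrMr// exprS.
  have : 1 <= 2 ^+ n :> R by rewrite -natrX ler1n expn_gt0.
  by move: (2 ^+ n : R) => w; nra.
have -> : av = 2 ^+ n.+1 * lam by rewrite /lam mulrCA divff ?mulr1// gt_eqF.
rewrite -mulrA; apply: ler_wpM2l; first exact: ltW.
have mx0 : 0 < m x by have := m1 x; ord_lra.
have -> : lam = powR (powR lam (m x)) (s / p x).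
  have -> : s / p x = (m x)^-1 by rewrite /m invf_div.
  by rewrite -powRrM divff ?gt_eqF// powRr1// ltW.
apply: le_trans (ler_powR2r sp0 (powR_ge0 _ _) hl) _.
rewrite powRM ?expR_ge0//; apply: ler_wpM2r; first exact: powR_ge0.
by rewrite -[leRHS]powRr1 ?expR_ge0//; apply: ler_powR.
Qed.

End StrongType.

(** * Boundedness from L^p1 to L^p2, in modular form *)

Section StrongTypeTheorem.
Context {R : realType} {n : nat}.
Implicit Types (x y : n.-tuple R) (f G : n.-tuple R -> R).

Lemma iint_lin_le (f g : n.-tuple R -> \bar R) (k l A B : R) :
  measurable_fun setT f -> measurable_fun setT g ->
  (forall x, 0 <= f x)%E -> (forall x, 0 <= g x)%E -> 0 <= k -> 0 <= l ->
  (iint f <= A%:E)%E -> (iint g <= B%:E)%E ->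
  [/\ measurable_fun setT (fun x => k%:E * f x + l%:E * g x)%E,
      (forall x, 0 <= k%:E * f x + l%:E * g x)%E &
      (iint (fun x => k%:E * f x + l%:E * g x) <= (k * A + l * B)%:E)%E].
Proof.
move=> mf mg f0 g0 k0 l0 fA gB.
have mkf : measurable_fun setT (fun x => k%:E * f x)%E by exact: measurable_funeM.
have mlg : measurable_fun setT (fun x => l%:E * g x)%E by exact: measurable_funeM.
split.
- exact: (emeasurable_funD mkf mlg).
- by move=> x; rewrite adde_ge0// mule_ge0// lee_fin.
rewrite iintD//; last 2 first.
- by move=> x; rewrite mule_ge0// lee_fin.
- by move=> x; rewrite mule_ge0// lee_fin.
rewrite !iintZl ?lee_fin// EFinD !EFinM.
by apply: leeD; apply: lee_wpmul2l; rewrite ?lee_fin.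
Qed.

Lemma poweRD3_le (a b c : \bar R) (p bt : R) : 0 <= p -> p <= bt ->
  (0 <= a)%E -> (0 <= b)%E -> (0 <= c)%E ->
  (poweR (a + b + c) p <=
   (powR 4 bt)%:E * (poweR a p + poweR b p + poweR c p))%E.
Proof.
move=> p0 pb a0 b0 c0.
have two : 1 <= powR 2 p :> R by rewrite -[leLHS](powRr0 2); apply: ler_powR; ord_lra.
have h2 : (poweR a p + poweR b p + poweR c p >= 0)%E by rewrite !adde_ge0 ?poweR_ge0.
have h4 : powR 2 p * powR 2 p <= powR 4 bt :> R.
  rewrite -powRM//; apply: (@le_trans _ _ (powR 4 p)); last by apply: ler_powR; ord_lra.
  by rewrite (_ : 2 * 2 = 4 :> R)//; ord_lra.
have ab0 : (0 <= a + b)%E by rewrite adde_ge0.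
apply: le_trans (poweRD_le p0 ab0 c0) _.
apply: (@le_trans _ _ ((powR 2 p * powR 2 p)%:E *
    (poweR a p + poweR b p + poweR c p))%E); last first.
  by apply: lee_wpmul2r; rewrite ?lee_fin.
rewrite EFinM -muleA; apply: lee_wpmul2l; first by rewrite lee_fin powR_ge0.
rewrite ge0_muleDr ?adde_ge0 ?poweR_ge0//; apply: leeD; first exact: poweRD_le.
by rewrite -[leLHS]mul1e; apply: lee_wpmul2r; rewrite ?poweR_ge0 ?lee_fin.
Qed.

Lemma avg_le_iint f x (r : R) : (forall y, 0 <= f y) ->
  (iint (fun y => (f y)%:E) <= 1)%E -> (avg f x r <= (powR r (- n%:R))%:E)%E.
Proof.
move=> f0 f1; rewrite /avg -[leRHS]mule1; apply: lee_wpmul2l.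
  by rewrite lee_fin powR_ge0.
exact: le_trans (le_mass_iint x r f0) f1.
Qed.

Lemma avg_le_sup f x (r : R) : (forall y, 0 <= f y) -> (forall y, f y <= 1) -> 0 < r ->
  (avg f x r <= (2 ^+ n)%:E)%E.
Proof.
move=> f0 f1 r0; have h : (mass f x r <= (1 * (2 * r) ^+ n)%:E)%E.
  apply: le_trans (mass_cst x (ltW r0) (@ler01 R)); exact: le_mass.
apply: le_trans (lee_wpmul2l _ h) _; first by rewrite lee_fin powR_ge0.
rewrite mul1r -EFinM lee_fin powRN powR_mulrn ?(ltW r0)// exprMn.
by rewrite mulrCA mulVf ?mulr1// expf_neq0// gt_eqF.
Qed.

(** As f has integral at most 1, the term of radius r is at most r^(gamma - n), which is summable
    over r > 1/4. *)
Lemma far_series_bound (gamma : R) : gamma < n%:R -> exists2 K : R, 1 <= K &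
  forall f, (forall y, 0 <= f y) -> (iint (fun y => (f y)%:E) <= 1)%E -> forall x,
  (\sum_(i <oo) ((powR (erad i) gamma)%:E *
     (if (erad i <= 1 / 4 :> R)%R then 0 else avg f x (erad i))) <= K%:E)%E.
Proof.
move=> gn; have d0 : 0 < n%:R - gamma by ord_lra.
have [Ck Ck0 hk] := @series_kap R 1 (n%:R - gamma) ltr01 d0.
pose c : R := powR 4 (n%:R - gamma).
have c0 : 0 <= c by exact: powR_ge0.
exists (1 + c * Ck); first by rewrite lerDl mulr_ge0.
move=> f f0 f1 x.
have four : 0 < 4 :> R by [].
apply: (@le_trans _ _ (c%:E * Ck%:E)%E); last by rewrite lee_fin lerDr.
apply: le_trans (lee_wpmul2l _ (hk 4 four)); last by rewrite lee_fin.
rewrite -nneseriesZl; last by move=> i _; rewrite lee_fin kap_ge0.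
apply: le_nneseries => i.
  by rewrite mule_ge0 ?lee_fin ?powR_ge0//; case: ifP => // _; exact: avg_ge0.
case: ifPn => [_|]; first by rewrite mule0 mule_ge0 ?lee_fin ?kap_ge0.
rewrite -ltNge => r4; have r0 : 0 < erad i :> R := erad_gt0 i.
apply: le_trans (lee_wpmul2l _ (avg_le_iint x _ f0 f1)) _; first by rewrite lee_fin powR_ge0.
rewrite -EFinM lee_fin -powRDp// powRr1 ?(ltW r0)//.
have v1 : 1 <= erad i * 4 :> R by ord_lra.
apply: (@le_trans _ _ (c * powR (erad i * 4) (- (n%:R - gamma)))); last first.
  by apply: ler_wpM2l => //; apply: powRN_le_kap => //; exact: ltW.
rewrite powRM ?(ltW r0)// mulrCA -powRDp// subrr powRr0 mulr1.
by rewrite opprB.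
Qed.

(** Small radii use f <= 1 and give r^gamma; large ones use the bound in L^s and give r^(gamma -
    n/s) = r^(-n/s2). *)
Lemma bounded_series_bound (gamma s s2 M : R) : 0 < gamma -> 1 < s -> 0 < s2 -> 0 < n%:R :> R ->
  n%:R / s - n%:R / s2 = gamma -> 0 <= M -> exists2 K : R, 1 <= K &
  forall f, measurable_fun setT f -> (forall y, 0 <= f y) -> (forall y, f y <= 1) ->
  (iint (fun y => (powR (f y) s)%:E) <= M%:E)%E -> forall x,
  (riesz_sum gamma f x <= K%:E)%E.
Proof.
move=> g0 s1 s20 n0R hs M0; pose dl := Num.min gamma (n%:R / s2).
have dl0 : 0 < dl by rewrite /dl lt_min g0 divr_gt0.
have [Ck Ck0 hk] := @series_kap R 1 dl ltr01 dl0.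
pose c : R := 2 ^+ n + M.
have two0 : 0 <= 2 ^+ n :> R by rewrite exprn_ge0.
have c0 : 0 <= c by rewrite addr_ge0.
exists (1 + c * Ck); first by rewrite lerDl mulr_ge0.
move=> f mf f0 f1 fM x.
apply: (@le_trans _ _ (c%:E * Ck%:E)%E); last by rewrite lee_fin lerDr.
apply: le_trans (lee_wpmul2l _ (hk 1 ltr01)); last by rewrite lee_fin.
rewrite -nneseriesZl; last by move=> i _; rewrite lee_fin kap_ge0.
apply: le_nneseries => i; first exact: riesz_term_ge0.
have r0 : 0 < erad i :> R := erad_gt0 i; rewrite mulr1 powRr1 ?(ltW r0)//.
have [r1|/ltW r1] := leP (erad i : R) 1.
  apply: le_trans (lee_wpmul2l _ (avg_le_sup x f0 f1 r0)) _; first by rewrite lee_fin powR_ge0.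
  rewrite -EFinM lee_fin mulrC; apply: ler_pM; rewrite ?powR_ge0 ?lerDl//.
  by apply: powR_le_kap; rewrite ?(ltW dl0)// /dl ge_min lexx.
apply: le_trans (lee_wpmul2l _ (avg_le_Ls x mf f0 (ltW s1) r0 fM)) _.
  by rewrite lee_fin powR_ge0.
rewrite -EFinM lee_fin mulrCA; apply: ler_wpM2l => //.
have -> : powR (erad i) gamma * powR (erad i) (- n%:R / s) = powR (erad i) (- (n%:R / s2)) :> R.
  by rewrite -powRDp//; congr powR; rewrite -hs; ord_lra.
by apply: powRN_le_kap; rewrite ?(ltW dl0)// /dl ge_min lexx orbT.
Qed.

(** Since 1/p1 - 1/p2 is the same constant at x and at infinity, p2 x - p2inf is p1 x - pinf
    multiplied by p2 x p2inf / (p1 x pinf), a factor at most bt^2. *)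
Lemma sobolev_osc (gamma bt C : R) (p1 p2 : n.-tuple R -> R) (pinf p2inf : R) :
  0 < n%:R :> R -> 0 < gamma -> (forall x, 1 <= p1 x) -> (forall x, 0 < p2 x) ->
  (forall x, p2 x <= bt) -> 1 <= pinf -> 0 < p2inf -> p2inf <= bt ->
  (forall x, n%:R / p1 x - n%:R / p2 x = gamma) -> n%:R / pinf - n%:R / p2inf = gamma ->
  0 < C -> (forall x, `|p1 x - pinf| <= C / lognorm x) ->
  forall x, `|p2 x - p2inf| <= (bt * bt * C) / lognorm x.
Proof.
move=> n0 g0 p11 p20 p2b pi1 p2i0 p2ib rel reli C0 hp x.
have p1x := p11 x; have p2x := p20 x; have p2bx := p2b x.
have -> : p2 x - p2inf = (p2 x * p2inf) * ((p1 x)^-1 * pinf^-1) * (p1 x - pinf).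
  have h : n%:R / p2inf - n%:R / p2 x = n%:R / pinf - n%:R / p1 x.
    by have := rel x; have := reli; ord_lra.
  have h2 : p2inf^-1 - (p2 x)^-1 = pinf^-1 - (p1 x)^-1.
    by apply: (mulfI (lt0r_neq0 n0)); rewrite !mulrBr.
  transitivity ((p2 x * p2inf) * (p2inf^-1 - (p2 x)^-1)).
    by field; rewrite !gt_eqF.
  by rewrite h2; field; rewrite !gt_eqF//; ord_lra.
rewrite normrM; have := hp x.
have i1 : (p1 x)^-1 <= 1 by rewrite invf_le1//; ord_lra.
have i2 : pinf^-1 <= 1 by rewrite invf_le1//; ord_lra.
have i3 : 0 <= (p1 x)^-1 by rewrite invr_ge0; ord_lra.
have i4 : 0 <= pinf^-1 by rewrite invr_ge0; ord_lra.
move=> h; rewrite -[leRHS]mulrA; apply: ler_pM => //.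
rewrite ger0_norm; last by rewrite !mulr_ge0// ltW.
rewrite -[leRHS]mulr1; apply: ler_pM; rewrite ?mulr_ge0 ?(ltW p2x) ?(ltW p2i0)//.
  by apply: ler_pM; rewrite ?(ltW p2x) ?(ltW p2i0).
by rewrite -[leRHS]mulr1; apply: ler_pM.
Qed.

(* [pinf] and [p2i] are the limits of [p1] and [p2] at infinity. *)
Record admissible (gamma s bt C C2 pinf p2i : R) (p1 p2 : n.-tuple R -> R) : Prop :=
  Admissible {
    adm_n : (0 < n)%N;
    adm_gamma : 0 < gamma;
    adm_gamma_lt : gamma < n%:R;
    adm_s : 1 < s;
    adm_C : 0 < C;
    adm_C2 : 0 < C2;
    adm_lh1 : log_holder C p1;
    adm_lh2 : log_holder C p2;
    adm_m1 : measurable_fun setT p1;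
    adm_m2 : measurable_fun setT p2;
    adm_s_le : forall x, s <= p1 x;
    adm_p12 : forall x, p1 x <= p2 x;
    adm_le_bt : forall x, p2 x <= bt;
    adm_rel : forall x, n%:R / p1 x - n%:R / p2 x = gamma;
    adm_pinf : forall x, `|p1 x - pinf| <= C / lognorm x;
    adm_p2i : forall x, `|p2 x - p2i| <= C2 / lognorm x;
    adm_s_pinf : s <= pinf;
    adm_pinf_p2i : pinf <= p2i;
    adm_p2i_le : p2i <= bt;
    adm_rel_inf : n%:R / pinf - n%:R / p2i = gamma
  }.

(** [p2i] is obtained from [pinf] by solving the Sobolev relation and not as a limit of p2; the
    relation at infinity then holds exactly, and the decay of p2 towards [p2i] is inherited from
    p1. *)
Lemma exists_admissible (gamma s bt C : R) (p1 p2 : n.-tuple R -> R) : (0 < n)%N ->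
  0 < gamma -> gamma < n%:R -> 1 < s -> 0 < C -> log_holder C p1 -> log_holder C p2 ->
  measurable_fun setT p1 -> measurable_fun setT p2 ->
  (forall x, s <= p1 x) -> (forall x, 0 < p2 x) ->
  (forall x, p2 x <= bt) -> (forall x, n%:R / p1 x - n%:R / p2 x = gamma) ->
  exists C2 pinf p2i, admissible gamma s bt C C2 pinf p2i p1 p2.
Proof.
move=> n0 g0 gn s1 C0 hp hp2 mp1 mp2 sp1 p20 p2b rel.
have n0R : 0 < n%:R :> R by rewrite ltr0n.
pose o : n.-tuple R := cst_tuple 0.
have s0 : 0 < s by ord_lra.
have p10 x : 0 < p1 x by have := sp1 x; ord_lra.
have p12 x : p1 x <= p2 x by exact: (sobolev_exp_bounds n0R g0 (p10 x) (p20 x)).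
have p1b x : p1 x <= bt by exact: le_trans (p12 x) (p2b x).
have p11 x : 1 <= p1 x by have := sp1 x; ord_lra.
have p21 x : 1 <= p2 x by have := p12 x; have := p11 x; ord_lra.
have bt1 : 1 <= bt by exact: le_trans (p21 o) (p2b o).
have [pinf hpi] := exists_limit_exponent n0 C0 hp.
have spi : s <= pinf by exact: (limit_exponent_ge n0 C0 hpi sp1).
have pi0 : 0 < pinf by ord_lra.
(* the exponent conjugate to [bt] bounds [p1], hence [pinf] *)
pose P : R := n%:R / (n%:R / bt + gamma).
have d0 : 0 < n%:R / bt + gamma by rewrite addr_gt0// divr_gt0//; ord_lra.
have P0 : 0 < P by rewrite divr_gt0.
have relP : n%:R / P - n%:R / bt = gamma.
  rewrite /P invf_div mulrCA divff ?gt_eqF// mulr1; ord_lra.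
have bt0 : 0 < bt by ord_lra.
have p1P x : p1 x <= P.
  have h : n%:R / bt <= n%:R / p2 x by rewrite ler_pM2l// lef_pV2 ?posrE.
  have : n%:R / P <= n%:R / p1 x by have := rel x; ord_lra.
  by rewrite ler_pM2l// lef_pV2 ?posrE.
have piP : pinf <= P by exact: (limit_exponent_le n0 C0 hpi p1P).
have [p2i p2i0 rel_pi] := exists_sobolev_exp n0R P0 bt0 pi0 relP piP.
have p2ib : p2i <= bt by exact: (sobolev_exp_mono n0R pi0 p2i0 P0 bt0 rel_pi relP).
have pi1 : 1 < pinf by ord_lra.
have pi2 : pinf <= p2i by exact: (sobolev_exp_bounds n0R g0 pi0 p2i0).
have p2i1 : 1 <= p2i by ord_lra.
have hp2i := sobolev_osc n0R g0 p11 p20 p2b (ltW pi1) p2i0 p2ib rel rel_pi C0 hpi.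
exists (bt * bt * C), pinf, p2i; split => //.
by rewrite !mulr_gt0.
Qed.

(** The function is cut at height 1. For the part [f1] with values 0 or at least 1, radii up to 1/4
    are treated by [local_jensen] through G = f1^(p1/s); over the other radii the sum is uniformly
    bounded, so that p2(x) can be lowered to the constant [s2] paired with [s]. For the part [f2]
    below 1, the whole sum is bounded and the exponents are replaced by [pinf] and [p2i] at the
    price of [decay]. *)
Theorem strong_type (gamma s bt C C2 pinf p2i : R) (p1 p2 : n.-tuple R -> R) :
  admissible gamma s bt C C2 pinf p2i p1 p2 ->
  exists2 C0 : R, 1 <= C0 &
  forall f, measurable_fun setT f -> (forall y, 0 <= f y) ->
  (iint (fun y => (powR (f y) (p1 y))%:E) <= 1%:E)%E ->
  (iint (fun x => poweR (riesz_sum gamma f x) (p2 x)) <= C0%:E)%E.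
Proof.
move=> [n0 g0 gn s1 C0 C2p hp hp2 mp1 mp2 sp1 p12 p2b rel hpi hp2i spi pi2 p2ib rel_pi].
have n0R : 0 < n%:R :> R by rewrite ltr0n.
pose o : n.-tuple R := cst_tuple 0.
have s0 : 0 < s by ord_lra.
have p10 x : 0 < p1 x by have := sp1 x; ord_lra.
have p20 x : 0 < p2 x by have := p12 x; have := p10 x; ord_lra.
have p1b x : p1 x <= bt by exact: le_trans (p12 x) (p2b x).
have p11 x : 1 <= p1 x by have := sp1 x; ord_lra.
have p21 x : 1 <= p2 x by have := p12 x; have := p11 x; ord_lra.
have bt1 : 1 <= bt by exact: le_trans (p21 o) (p2b o).
have bt0 : 0 < bt by ord_lra.
have [s2 s20 hs2] := exists_sobolev_exp n0R (p10 o) (p20 o) s0 (rel o) (sp1 o).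
have s2p x : s2 <= p2 x by apply: (sobolev_exp_mono n0R s0 s20 (p10 x) (p20 x) hs2 (rel x)).
have pi1 : 1 < pinf by ord_lra.
have pi0 : 0 < pinf by ord_lra.
have p2i0 : 0 < p2i by ord_lra.
have p2i1 : 1 <= p2i by ord_lra.
pose t := carleson_exp n gamma.
have t1 : 1 < t by exact: carleson_exp_gt1.
have [H H0 hH] := @iint_decay R n.
pose Cd := expR (n.+1%:R * C).
have Cd0 : 0 <= Cd by exact: expR_ge0.
pose M2 := Cd * 1 + 1 * H.
have M20 : 0 <= M2 by rewrite addr_ge0// mulr_ge0.
have [C1 C10 hC1] := hls_pointwise n0 g0 gn s1 s20 hs2 (@ler01 R).
have [E1 E10 hE1] := carleson n0 s1 t1 (@ler01 R).
have [D2 D20 hD2] := hls_pointwise n0 g0 gn pi1 p2i0 rel_pi M20.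
have [E2 E20 hE2] := carleson n0 pi1 t1 M20.
have [KJ KJ0 hKJ] := local_jensen n0 C0 hp mp1 s1 sp1 p1b.
have c0 : 0 <= 2 ^+ n + 1 :> R by rewrite addr_ge0// exprn_ge0.
have [C3 C30 hC3] := hedberg n0 g0 gn (ltW s1) bt1 KJ0 c0.
have [KU KU1 hKU] := far_series_bound gn.
have [KW KW1 hKW] := bounded_series_bound g0 pi1 p2i0 n0R rel_pi M20.
pose U0 := powR KU bt; have U00 : 0 <= U0 by exact: powR_ge0.
pose W0 := powR KW bt; have W00 : 0 <= W0 by exact: powR_ge0.
pose W1 := W0 * expR (n.+1%:R * C2).
have W10 : 0 <= W1 by rewrite mulr_ge0// expR_ge0.
pose tot := powR 4 bt * (1 * (C3 * E1 + (U0 * C1) * E1) + 1 * ((W1 * D2) * E2 + W0 * H)).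
exists (1 + tot).
  by rewrite lerDl /tot !mulr_ge0 ?powR_ge0// !addr_ge0// !mul1r addr_ge0// !mulr_ge0.
move=> f mf f0 fp.
pose hi y : bool := 1 <= f y.
pose f1 y := if hi y then f y else 0.
pose f2 y := if hi y then 0 else f y.
have mhi : measurable_fun setT hi by exact: measurable_fun_ler.
have mf1 : measurable_fun setT f1 by apply: measurable_fun_ifT.
have mf2 : measurable_fun setT f2 by apply: measurable_fun_ifT.
have f10 y : 0 <= f1 y by rewrite /f1; case: ifP.
have f20 y : 0 <= f2 y by rewrite /f2; case: ifP.
have f1f y : f1 y <= f y by rewrite /f1; case: ifP.
have f2f y : f2 y <= f y by rewrite /f2; case: ifP.
have f21 y : f2 y <= 1 by rewrite /f2; case: ifPn => // h; rewrite ltW// ltNge.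
have f1d y : f1 y = 0 \/ 1 <= f1 y by rewrite /f1; case: ifPn => h; [right|left].
have f12 : f = (fun y => f1 y + f2 y).
  by apply/funext => y; rewrite /f1 /f2; case: ifP; rewrite ?addr0 ?add0r.
have f1p : (iint (fun y => (powR (f1 y) (p1 y))%:E) <= 1%:E)%E.
  apply: le_trans fp; apply: le_iint => y; rewrite lee_fin ?powR_ge0//.
  by apply: ler_powR2r => //; exact: ltW.
have f1L1 : (iint (fun y => (f1 y)%:E) <= 1)%E.
  apply: le_trans f1p; apply: le_iint => y; rewrite lee_fin//.
  by case: (f1d y) => [->|h]; [rewrite powR_ge0|apply: le1r_powR].
have f1s : (iint (fun y => (powR (f1 y) s)%:E) <= 1%:E)%E.
  apply: le_trans f1p; apply: le_iint => y; rewrite lee_fin ?powR_ge0//.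
  case: (f1d y) => [->|h]; last exact: ler_powR.
  by rewrite powR0 ?powR_ge0// gt_eqF.
pose G y := powR (f1 y) (p1 y / s).
have G0 y : 0 <= G y by exact: powR_ge0.
have mG : measurable_fun setT G by apply: measurable_powR2 => //; exact: measurable_funM.
have Gs : (iint (fun y => (powR (G y) s)%:E) <= 1%:E)%E.
  rewrite (_ : (fun y => _) = (fun y => (powR (f1 y) (p1 y))%:E))//.
  by apply/funext => y; rewrite /G -powRrM divfK// gt_eqF.
have f2M : (iint (fun y => (powR (f2 y) pinf)%:E) <= M2%:E)%E.
  have mP : measurable_fun setT (fun y => (powR (f2 y) (p1 y))%:E).
    by apply/measurable_EFinP; exact: measurable_powR2.
  have mD : measurable_fun setT (fun y => (decay y)%:E).
    by apply/measurable_EFinP; exact: measurable_decay.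
  have P0' y : (0 <= (powR (f2 y) (p1 y))%:E)%E by rewrite lee_fin powR_ge0.
  have D0' y : (0 <= (decay y)%:E)%E by rewrite lee_fin decay_ge0.
  have f2p : (iint (fun y => (powR (f2 y) (p1 y))%:E) <= 1%:E)%E.
    apply: le_trans fp; apply: le_iint => y; rewrite lee_fin ?powR_ge0//.
    by apply: ler_powR2r => //; exact: ltW.
  have [_ _ h] := iint_lin_le mP mD P0' D0' Cd0 (@ler01 R) f2p hH.
  apply: le_trans h; apply: le_iint => y; first by rewrite lee_fin powR_ge0.
  rewrite mul1e -EFinM -EFinD lee_fin.
  apply: powR_le_decay => //; [exact: ltW|by rewrite distrC|exact: ltW].
pose near x := (\sum_(i <oo) ((powR (erad i) gamma)%:E *
   (if (erad i <= 1 / 4 :> R)%R then avg f1 x (erad i) else 0)))%E.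
pose far x := (\sum_(i <oo) ((powR (erad i) gamma)%:E *
   (if (erad i <= 1 / 4 :> R)%R then 0 else avg f1 x (erad i))))%E.
have near0 x : (0 <= near x)%E.
  apply: nneseries_ge0 => i _ _; rewrite mule_ge0 ?lee_fin ?powR_ge0//.
  by case: ifP => // _; exact: avg_ge0.
have far0 x : (0 <= far x)%E.
  apply: nneseries_ge0 => i _ _; rewrite mule_ge0 ?lee_fin ?powR_ge0//.
  by case: ifP => // _; exact: avg_ge0.
have nf x : riesz_sum gamma f1 x = (near x + far x)%E.
  rewrite /near /far -nneseriesD.
  - apply: eq_eseriesr => i _; case: ifP => _; first by rewrite mule0 adde0.
    by rewrite mule0 add0e.
  - move=> i _ _; rewrite mule_ge0 ?lee_fin ?powR_ge0//.
    by case: ifP => // _; exact: avg_ge0.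
  - move=> i _ _; rewrite mule_ge0 ?lee_fin ?powR_ge0//.
    by case: ifP => // _; exact: avg_ge0.
(* Here [a] and [A] of [hedberg] differ: the averages of [f1], set to 0 for radii above 1/4, are
   controlled by those of [G]. *)
have nearP x : (poweR (near x) (p2 x) <= C3%:E * carleson_sum s t G x)%E.
  apply: (hC3 (p1 x) (p2 x) (fun i => if (erad i <= 1 / 4 :> R)%R then avg f1 x (erad i) else 0%E)
    (fun i => avg G x (erad i))) => //.
  - by move=> i; case: ifP => // _; exact: avg_ge0.
  - by move=> i; exact: avg_ge0.
  - by move=> i; apply: avg_le_Ls => //; [exact: ltW|exact: erad_gt0].
  - move=> i; case: ifPn => h; last by rewrite mule_ge0 ?poweR_ge0 ?lee_fin.
    by apply: hKJ => //; exact: erad_gt0.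
have farP x : (poweR (far x) (p2 x) <= (U0 * C1)%:E * carleson_sum s t f1 x)%E.
  apply: le_trans (poweR_bounded_change (far0 x) KU1 (hKU f1 f10 f1L1 x) s20 (s2p x) (p2b x)) _.
  rewrite -/U0 (EFinM U0) -muleA; apply: lee_wpmul2l; first by rewrite lee_fin.
  apply: le_trans (hC1 f1 mf1 f10 f1s x); apply: le_poweR => //; first exact: ltW.
  by rewrite nf leeDr.
have f2P x : (poweR (riesz_sum gamma f2 x) (p2 x) <=
    (W1 * D2)%:E * carleson_sum pinf t f2 x + W0%:E * (decay x)%:E)%E.
  apply: le_trans (poweR_bounded_decay (riesz_sum_ge0 gamma x f20) KW1
    (hKW f2 mf2 f20 f21 f2M x) (ltW C2p) (hp2i x) (p21 x) p2i1 (p2b x)) _.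
  rewrite -/W0 -/W1 (EFinM W0 (decay x)); apply: leeD => //.
  rewrite (EFinM W1 D2) -muleA; apply: lee_wpmul2l; first by rewrite lee_fin.
  exact: hD2.
have mcG := measurable_carleson_sum s t mG G0.
have mcf1 := measurable_carleson_sum s t mf1 f10.
have mcf2 := measurable_carleson_sum pinf t mf2 f20.
have mD : measurable_fun setT (fun y : n.-tuple R => (decay y)%:E).
  by apply/measurable_EFinP; exact: measurable_decay.
have [m1 q1 i1] := iint_lin_le mcG mcf1 (fun x => carleson_sum_ge0 s t x G0)
  (fun x => carleson_sum_ge0 s t x f10) C30 (mulr_ge0 U00 C10) (hE1 G mG G0 Gs)
  (hE1 f1 mf1 f10 f1s).
have D0 y : (0 <= (decay (y : n.-tuple R))%:E)%E by rewrite lee_fin decay_ge0.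
have [m2 q2 i2] := iint_lin_le mcf2 mD (fun x => carleson_sum_ge0 pinf t x f20)
  D0 (mulr_ge0 W10 D20) W00 (hE2 f2 mf2 f20 f2M) hH.
have [m3 q3 i3] := iint_lin_le m1 m2 q1 q2 (@ler01 R) (@ler01 R) i1 i2.
apply: (@le_trans _ _ tot%:E); last by rewrite lee_fin lerDr.
rewrite /tot (EFinM (powR 4 bt)); apply: le_trans (lee_wpmul2l _ i3); last by rewrite lee_fin powR_ge0.
rewrite -iintZl ?lee_fin ?powR_ge0//.
apply: le_iint => x; first exact: poweR_ge0.
rewrite f12 riesz_sumD// nf.
apply: le_trans (poweRD3_le _ (p2b x) (near0 x) (far0 x) (riesz_sum_ge0 gamma x f20)) _.
  by have := p21 x; ord_lra.
apply: lee_wpmul2l; first by rewrite lee_fin powR_ge0.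
by rewrite !mul1e; apply: leeD => //; apply: leeD.
Qed.

End StrongTypeTheorem.

(** * Luxemburg norms and their measurable substitute *)

Section Luxemburg.
Context {R : realType} {n : nat}.
Implicit Types (x y : n.-tuple R) (p : n.-tuple R -> R) (g : n.-tuple R -> \bar R).

Lemma lux_norm_le p g (lam : R) : 0 < lam -> (modular p g lam <= 1)%E ->
  (lux_norm p g <= lam%:E)%E.
Proof. by move=> l0 h; apply: ereal_inf_lbound; exists lam. Qed.

Lemma lux_norm_ge0 p g : (0 <= lux_norm p g)%E.
Proof. by apply/ereal_infP => _ [lam [l0 _] <-]; rewrite lee_fin ltW. Qed.

Lemma lux_norm_lb p g (K : R) (y : \bar R) : 0 < K ->
  (forall lam : R, 0 < lam -> (modular p g lam <= 1)%E -> (y <= K%:E * lam%:E)%E) ->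
  (y <= K%:E * lux_norm p g)%E.
Proof.
move=> K0 h; rewrite -lee_pdivrMl//; apply/ereal_infP => _ [lam [l0 hl] <-].
by rewrite lee_pdivrMl//; exact: h.
Qed.

Lemma le_modular p g1 g2 (l1 l2 : R) : (forall y, 0 <= p y) -> 0 < l1 -> l1 <= l2 ->
  (forall y, `|g1 y| <= `|g2 y|)%E -> (modular p g1 l2 <= modular p g2 l1)%E.
Proof.
move=> p0 l10 l12 g12; apply: le_iint => y; first exact: poweR_ge0.
have l20 : 0 < l2 := lt_le_trans l10 l12.
apply: le_poweR => //; first by rewrite mule_ge0// lee_fin invr_ge0 ltW.
by apply: lee_pmul => //; rewrite lee_fin ?invr_ge0 ?(ltW l20)// lef_pV2.
Qed.

Lemma le_lux_norm p g1 g2 : (forall y, 0 <= p y) -> (forall y, `|g1 y| <= `|g2 y|)%E ->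
  (lux_norm p g1 <= lux_norm p g2)%E.
Proof.
move=> p0 g12; apply/ereal_infP => _ [lam [l0 hl] <-].
apply: lux_norm_le => //; apply: le_trans hl; exact: le_modular.
Qed.

Lemma restrE g x r y : restr g x r y = ((ball_ind r x y)%:E * g y)%E.
Proof. by rewrite /restr ball_ind_indic. Qed.

Lemma le_restr g x x' (r r' : R) : edist x x' + r <= r' ->
  forall y, (`|restr g x r y| <= `|restr g x' r' y|)%E.
Proof.
move=> h y; rewrite !restrE !abseM; apply: lee_wpmul2r => //.
by rewrite /= lee_fin !ger0_norm ?ball_ind_ge0// ball_ind_sub.
Qed.

Lemma modular_restr p (f : n.-tuple R -> R) x (r lam : R) : 0 < lam ->
  modular p (restr (fun y => (f y)%:E) x r) lam =
  iint (fun y => (powR (ball_ind r x y * `|f y| / lam) (p y))%:E).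
Proof.
move=> l0; apply: eq_iint => y.
by rewrite restrE /= normrM (@ger0_norm _ (ball_ind _ _ _)) ?ball_ind_ge0.
Qed.

Lemma measurable_poweR2 d (T : measurableType d) (u : T -> \bar R) (p : T -> R) :
  measurable_fun setT u -> measurable_fun setT p -> (forall t, 0 <= u t)%E ->
  (forall t, 0 < p t) -> measurable_fun setT (fun t => poweR (u t) (p t)).
Proof.
move=> mu mp u0 p0.
have -> : (fun t => poweR (u t) (p t)) =
    (fun t => if (u t < +oo)%E then (powR (fine (u t)) (p t))%:E else +oo%E).
  apply/funext => t; have := u0 t; case: (u t) => [r| |]//=.
    by rewrite ltry.
  by move=> _; rewrite (gt_eqF (p0 t)).
apply: measurable_fun_ifT => //; first exact: measurable_fun_lte.
apply/measurable_EFinP; apply: measurable_powR2 => //.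
exact: (measurableT_comp (@fine_measurable _ _ _)).
Qed.

(* Restricting the infimum to the countable grid [erad i] makes it measurable in
   the center of the ball; it changes the norm by a factor at most [e]. *)
Definition grid_norm p (f : n.-tuple R -> R) x (r : R) : \bar R :=
  einfs (fun i => if (modular p (restr (fun y => (f y)%:E) x r) (erad i) <= 1)%E
                  then (erad i)%:E else +oo%E) 0%N.

Lemma grid_norm_lb p f x r (K : R) (y : \bar R) : 0 < K ->
  (forall lam : R, 0 < lam -> (modular p (restr (fun y => (f y)%:E) x r) lam <= 1)%E ->
    (y <= K%:E * lam%:E)%E) ->
  (y <= K%:E * grid_norm p f x r)%E.
Proof.
move=> K0 h; rewrite -lee_pdivrMl//; apply/ereal_infP => _ [i _ <-].
case: ifPn => hi; last by rewrite leey.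
by rewrite lee_pdivrMl//; apply: h => //; exact: erad_gt0.
Qed.

Lemma grid_norm_ge0 p f x r : (0 <= grid_norm p f x r)%E.
Proof.
apply/ereal_infP => _ [i _ <-]; case: ifPn => _; last exact: leey.
by rewrite lee_fin erad_ge0.
Qed.

Lemma grid_norm_le_lux p f x r : (forall y, 0 <= p y) ->
  (grid_norm p f x r <= (expR 1)%:E * lux_norm p (restr (fun y => (f y)%:E) x r))%E.
Proof.
move=> p0; apply: lux_norm_lb; first exact: expR_gt0.
move=> lam l0 hl; have [i /andP[h1 h2]] := exists_erad l0.
apply: (@le_trans _ _ (erad i)%:E); last by rewrite -EFinM lee_fin.
apply: ereal_inf_lbound; exists i => //; rewrite ifT//.
apply: le_trans hl; apply: le_modular => //; exact: ltW.
Qed.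

Lemma measurable_grid_norm p f r : measurable_fun setT p -> (forall y, 0 <= p y) ->
  measurable_fun setT f -> measurable_fun setT (fun x => grid_norm p f x r).
Proof.
move=> mp p0 mf; apply: (measurable_fun_einfs (f := fun i x =>
  if (modular p (restr (fun y => (f y)%:E) x r) (erad i) <= 1)%E
  then (erad i)%:E else +oo%E)) => i.
apply: measurable_fun_ifT => //; apply: measurable_fun_lee => //.
under eq_fun do rewrite modular_restr ?erad_gt0//.
apply: (@measurable_iint _ _ (n.-tuple R) n (fun z =>
  (powR (ball_ind r z.1 z.2 * `|f z.2| / erad i) (p z.2))%:E)).
  apply/measurable_EFinP; apply: measurable_powR2; last exact: measurableT_comp.
  apply: measurable_funM => //; apply: measurable_funM; first exact: measurable_ball_ind.
  by apply: measurableT_comp => //; apply: measurableT_comp.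
by move=> z; rewrite lee_fin powR_ge0.
Qed.

End Luxemburg.

(** * Mass and norm over a single ball *)

Section SingleBall.
Context {R : realType} {n : nat}.
Implicit Types (x y : n.-tuple R) (f : n.-tuple R -> R).
Context (gamma s bt C C2 pinf p2i : R) (p1 p2 : n.-tuple R -> R).

Lemma mass_modular (p : n.-tuple R -> R) f x (r lam : R) : 0 < lam ->
  (forall y, 0 < p y) ->
  mass (fun y => powR (`|f y| / lam) (p y)) x r =
  modular p (restr (fun y => (f y)%:E) x r) lam.
Proof.
move=> l0 p0; rewrite modular_restr//; apply: eq_iint => y; congr EFin.
rewrite /ball_ind; case: ifP => _; first by rewrite !mul1r.
by rewrite !mul0r powR0// gt_eqF.
Qed.

(** Stands for the norm of the indicator of B(x, r) in the space with the conjugate exponent, as n -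
    n/p is n divided by the conjugate of p. *)
Definition mass_rate x (r : R) : R :=
  if 4 * r <= 1 + enorm x then powR r (n%:R - n%:R / p1 x) else powR r (n%:R - n%:R / pinf).

(** Stands for the norm of the indicator of B(x, r) in L^p2. *)
Definition ball_rate x (r : R) : R :=
  if 4 * r <= 1 + enorm x then powR r (n%:R / p2 x) else powR r (n%:R / p2i).

Lemma mass_rate_gt0 x r : 0 < r -> 0 < mass_rate x r.
Proof. by move=> r0; rewrite /mass_rate; case: ifP => _; exact: powR_gt0. Qed.

Lemma ball_rate_gt0 x r : 0 < r -> 0 < ball_rate x r.
Proof. by move=> r0; rewrite /ball_rate; case: ifP => _; exact: powR_gt0. Qed.

Lemma powR_osc (p : n.-tuple R -> R) (c : R) x y (r : R) : 0 < C -> log_holder C p ->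
  0 < r -> 4 * r <= 1 + enorm x -> edist x y < 2 * r ->
  powR r (c * (p y - p x)) <= expR (`|c| * (4 * C)).
Proof.
move=> C0 hp r0 near xy; rewrite powR_expR// ler_expR.
apply: le_trans (ler_norm _) _; rewrite !normrM -mulrA; apply: ler_wpM2l => //.
by rewrite distrC; exact: log_holder_near.
Qed.

(** Freezing turns r^(-n p(y)/p(x)) into r^(-n) up to a factor E; dividing by K gains at least 1/K
    since p >= 1, which absorbs E and the volume constant. *)
Lemma near_ball_modular (p : n.-tuple R -> R) : 0 < C -> (forall z, 1 <= p z) ->
  log_holder C p ->
  exists2 K : R, 1 <= K & forall x (r L : R), 0 < r -> 4 * r <= 1 + enorm x ->
  K * powR r (n%:R / p x) <= L ->
  (iint (fun y => (powR (ball_ind r x y / L) (p y))%:E) <= 1)%E.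
Proof.
move=> C0 p1' hp; pose E := expR (n%:R * (4 * C)).
have E0 : 0 <= E by exact: expR_ge0.
pose K := 1 + 2 ^+ n * E.
have K1 : 1 <= K by rewrite lerDl mulr_ge0// exprn_ge0.
exists K => // x r L r0 near hL; have K0 : 0 < K by ord_lra.
have w0 : 0 < powR r (n%:R / p x) by exact: powR_gt0.
have wK : 0 < K * powR r (n%:R / p x) by exact: mulr_gt0.
have rn0 : 0 < r ^+ n by rewrite exprn_gt0.
have c0 : 0 <= K^-1 * E / r ^+ n by rewrite !mulr_ge0 ?invr_ge0 ?(ltW rn0)// ltW.
apply: (@le_trans _ _ ((K^-1 * E / r ^+ n)%:E * iint (fun y => (ball_ind r x y)%:E))%E).
  rewrite -iintZl ?lee_fin//; last 2 first.
  - by apply/measurable_EFinP; exact: measurable_ball_ind.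
  - by move=> y; rewrite lee_fin ball_ind_ge0.
  apply: le_iint => y; first by rewrite lee_fin powR_ge0.
  have py := p1' y; have px := p1' x.
  rewrite -EFinM lee_fin /ball_ind; case: ifPn => [xy|_]; last first.
    by rewrite mul0r mulr0 powR0// gt_eqF//; ord_lra.
  rewrite mulr1 mul1r.
  apply: (@le_trans _ _ (powR (K * powR r (n%:R / p x))^-1 (p y))).
    have L0 : 0 < L by exact: lt_le_trans hL.
    by apply: ler_powR2r; [ord_lra|rewrite invr_ge0 ltW|rewrite lef_pV2].
  rewrite invfM powRM ?invr_ge0 ?(ltW K0) ?(ltW w0)//.
  rewrite -mulrA; apply: ler_pM; rewrite ?powR_ge0//.
    rewrite -[leRHS]powRr1 ?invr_ge0 ?(ltW K0)//.
    apply: ger_powR; last by ord_lra.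
    by rewrite invr_gt0 K0 invf_le1.
  rewrite -powRN -powRrM.
  have -> : - (n%:R / p x) * p y = - (n%:R / p x) * (p y - p x) + - n%:R.
    by field; rewrite gt_eqF//; ord_lra.
  rewrite powRDp// powRN powR_mulrn ?(ltW r0)//.
  apply: ler_wpM2r; first by rewrite invr_ge0 ltW.
  have xy2 : edist x y < 2 * r by ord_lra.
  apply: le_trans (powR_osc _ C0 hp r0 near xy2) _; rewrite ler_expR.
  apply: ler_wpM2r; first by ord_lra.
  rewrite normrN ger0_norm; last by rewrite divr_ge0//; ord_lra.
  by rewrite ler_pdivrMr ?ler_peMr//; ord_lra.
apply: le_trans (lee_wpmul2l _ (iint_ball_le x (ltW r0))) _; first by rewrite lee_fin.
rewrite -EFinM lee_fin exprMn.
rewrite [leLHS](_ : _ = (2 ^+ n * E) / K); last by field; rewrite !gt_eqF.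
by rewrite ler_pdivrMr// mul1r /K lerDr.
Qed.

(** Young's inequality at height h = r^(-n/p1(x)), in the role of Hölder's: frozen at x, h^(1 -
    p1(y)) is at most a multiple of h r^n = r^(n - n/p1(x)), and the modular is at most 1. *)
Lemma mass_near : admissible gamma s bt C C2 pinf p2i p1 p2 ->
  exists2 K : R, 0 < K & forall f x (r lam : R), measurable_fun setT f -> 0 < r ->
  4 * r <= 1 + enorm x -> 0 < lam ->
  (modular p1 (restr (fun y => (f y)%:E) x (2 * r)%R) lam <= 1)%E ->
  (mass (fun y => `|f y|%R) x (2 * r)%R <= (K * lam * powR r (n%:R - n%:R / p1 x))%:E)%E.
Proof.
move=> [n0 g0 gn s1 C0 C2p hp hp2 mp1 mp2 sp1 p12 p2b rel hpi hp2i spi pi2 p2ib rel_pi].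
pose E := expR (n%:R * (4 * C)).
have E0 : 0 < E by exact: expR_gt0.
exists (4 ^+ n + E); first by rewrite ltr_wpDl ?exprn_ge0.
move=> f x r lam mf r0 near l0 hm.
have p11 y : 1 < p1 y by have := sp1 y; ord_lra.
have p1x := p11 x.
pose u y := `|f y| / lam.
have u0 y : 0 <= u y by rewrite divr_ge0// ltW.
have mu : measurable_fun setT u.
  by apply: measurable_funM => //; exact: measurableT_comp.
pose h := powR r (- n%:R / p1 x).
have h0 : 0 < h by exact: powR_gt0.
have hrn : h * r ^+ n = powR r (n%:R - n%:R / p1 x).
  by rewrite -powR_mulrn ?(ltW r0)// /h -powRDp//; congr powR; ord_lra.
have -> : (fun y => `|f y|) = (fun y => lam * u y).
  by apply/funext => y; rewrite /u mulrC divfK// gt_eqF.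
rewrite massZ//; last exact: ltW.
rewrite [X in (_ <= X%:E)%E](_ : _ = lam * ((4 ^+ n + E) * (h * r ^+ n))); last first.
  by rewrite hrn; ring.
rewrite EFinM; apply: lee_wpmul2l; first by rewrite lee_fin ltW.
have r20 : 0 <= 2 * r by ord_lra.
have := mass_young x mu mp1 u0 (fun y => ltW (p11 y)) h0 r20.
move=> /le_trans; apply.
rewrite [X in (_ <= X%:E)%E]mulrDl EFinD; apply: leeD.
  rewrite lee_fin (_ : 2 * (2 * r) = 4 * r); last by ring.
  by rewrite exprMn mulrCA.
apply: (@le_trans _ _ ((E * (h * r ^+ n))%:E * mass (fun y => powR (u y) (p1 y)) x (2 * r)%R)%E).
  rewrite -massZ.
  - apply: le_mass_ball => y; first by rewrite mulr_ge0 ?powR_ge0// ltW.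
    move=> xy; rewrite powRM ?invr_ge0 ?(ltW h0)// mulrCA [leRHS]mulrC.
    apply: ler_wpM2l; first exact: powR_ge0.
    rewrite mulrCA; apply: ler_wpM2l; first exact: ltW.
    rewrite -powR_inv1 ?(ltW h0)// /h -!powRrM.
    have -> : - n%:R / p1 x * (-1 * p1 y) = n%:R + n%:R / p1 x * (p1 y - p1 x).
      by field; rewrite gt_eqF//; ord_lra.
    rewrite powRDp// powR_mulrn ?(ltW r0)// mulrC; apply: ler_wpM2r.
      by rewrite exprn_ge0// ltW.
    apply: le_trans (powR_osc _ C0 hp r0 near xy) _; rewrite ler_expR.
    apply: ler_wpM2r; first by ord_lra.
    rewrite ger0_norm; last by rewrite divr_ge0//; ord_lra.
    by rewrite ler_pdivrMr ?ler_peMr//; ord_lra.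
  - exact: measurable_powR2.
  - by move=> y; exact: powR_ge0.
  - by rewrite !mulr_ge0 ?exprn_ge0 ?(ltW E0) ?(ltW h0) ?(ltW r0).
rewrite mass_modular//; last by move=> y; have := p11 y; ord_lra.
rewrite -[leRHS]mule1; apply: lee_wpmul2l => //.
by rewrite lee_fin !mulr_ge0 ?exprn_ge0 ?(ltW E0) ?(ltW h0) ?(ltW r0).
Qed.

(** Now the height is r^(-n/pinf). Where |f|/lam <= 1, Young's inequality with exponent [pinf] is
    followed by a change to p1 with error [decay]; elsewhere |f|/lam is below its own power p1. The
    constants fit under r^(n - n/pinf) because 4 r >= 1. *)
Lemma mass_far : admissible gamma s bt C C2 pinf p2i p1 p2 ->
  exists2 K : R, 0 < K & forall f x (r lam : R), measurable_fun setT f ->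
  1 / 4 <= r -> 0 < lam ->
  (modular p1 (restr (fun y => (f y)%:E) x (2 * r)%R) lam <= 1)%E ->
  (mass (fun y => `|f y|%R) x (2 * r)%R <= (K * lam * powR r (n%:R - n%:R / pinf))%:E)%E.
Proof.
move=> [n0 g0 gn s1 C0 C2p hp hp2 mp1 mp2 sp1 p12 p2b rel hpi hp2i spi pi2 p2ib rel_pi].
have n0R : 0 < n%:R :> R by rewrite ltr0n.
have [H H0 hH] := @iint_decay R n.
pose E := expR (n.+1%:R * C).
have E0 : 0 < E by exact: expR_gt0.
have pi1 : 1 < pinf by ord_lra.
pose a := n%:R - n%:R / pinf.
have a0 : 0 <= a.
  rewrite /a subr_ge0 ler_pdivrMr; last by ord_lra.
  by rewrite ler_peMr//; ord_lra.
pose Q := powR 4 a.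
have Q0 : 0 <= Q by exact: powR_ge0.
exists (4 ^+ n + Q + (E + H)).
  by rewrite ltr_wpDl ?addr_ge0 ?exprn_ge0// ltr_wpDr.
move=> f x r lam mf r4 l0 hm.
have r0 : 0 < r by ord_lra.
have p11 y : 1 < p1 y by have := sp1 y; ord_lra.
pose u y := `|f y| / lam.
have u0 y : 0 <= u y by rewrite divr_ge0// ltW.
have mu : measurable_fun setT u.
  by apply: measurable_funM => //; exact: measurableT_comp.
pose h := powR r (- n%:R / pinf).
have h0 : 0 < h by exact: powR_gt0.
have hrn : h * r ^+ n = powR r a.
  by rewrite -powR_mulrn ?(ltW r0)// /h -powRDp//; congr powR; rewrite /a; ord_lra.
have hpi' : powR h (1 - pinf) = powR r a.
  by rewrite /h -powRrM /a; congr powR; field; rewrite gt_eqF//; ord_lra.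
have ra1 : 1 <= Q * powR r a.
  rewrite /Q -powRM ?(ltW r0)//.
  by rewrite -[leLHS](powRr0 (4 * r)); apply: ler_powR => //; ord_lra.
have -> : (fun y => `|f y|) = (fun y => lam * u y).
  by apply/funext => y; rewrite /u mulrC divfK// gt_eqF.
rewrite massZ//; last exact: ltW.
rewrite [X in (_ <= X%:E)%E](_ : _ = lam * ((4 ^+ n + Q + (E + H)) * powR r a)); last by rewrite /a; ring.
rewrite EFinM; apply: lee_wpmul2l; first by rewrite lee_fin ltW.
pose v y := powR (u y) (p1 y).
have v0 y : 0 <= v y by exact: powR_ge0.
have mv : measurable_fun setT v by exact: measurable_powR2.
have pw y : u y <= h + ((Q * powR r a + powR r a * E) * v y + powR r a * decay y).
  have ra0 : 0 <= powR r a by exact: powR_ge0.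
  have d0 := decay_ge0 y.
  have [u1|/ltW u1] := leP (u y) 1.
    have h1 : u y <= h + powR r a * powR (u y) pinf.
      have := @le_young _ (u y / h) pinf; rewrite divr_ge0 ?(ltW h0)// => /(_ isT).
      move=> /(_ (ltW pi1)); rewrite ler_pdivrMr// => /le_trans; apply.
      rewrite mulrDl mul1r lerD2l powRM ?invr_ge0 ?(ltW h0)// -mulrA mulrC.
      apply: ler_wpM2r; first exact: powR_ge0.
      rewrite -hpi' -powR_inv1 ?(ltW h0)// -powRrM -[X in _ * X]powRr1 ?(ltW h0)// -powRDp//.
      by rewrite le_eqVlt; apply/orP; left; apply/eqP; congr powR; ord_lra.
    apply: le_trans h1 _; rewrite lerD2l.
    have h2 := powR_le_decay (ltW C0) (_ : `|pinf - p1 y| <= C / lognorm y) (ltW pi1)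
      (ltW (p11 y)) (u0 y) u1.
    have {}h2 := h2 _; rewrite distrC in h2.
    apply: le_trans (ler_wpM2l ra0 (h2 (hpi y))) _.
    rewrite -/E -/(v y) mulrDr mulrA lerD2r; apply: ler_wpM2r => //.
    by rewrite lerDr mulr_ge0.
  have uv : u y <= v y by apply: le1r_powR => //; exact: ltW.
  apply: (@le_trans _ _ ((Q * powR r a) * v y)).
    apply: le_trans uv _; rewrite -[leLHS]mul1r; exact: ler_wpM2r.
  rewrite ler_wpDl ?(ltW h0)// mulrDl -addrA lerDl.
  by rewrite addr_ge0// !mulr_ge0// ltW.
have ra0 : 0 <= powR r a by exact: powR_ge0.
have k0 : 0 <= Q * powR r a + powR r a * E by rewrite addr_ge0// !mulr_ge0// ltW.
have md : measurable_fun setT (@decay R n) by exact: measurable_decay.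
apply: le_trans (le_mass x (2 * r) u0 pw) _.
rewrite massD; last 4 first.
- exact: measurable_cst.
- by apply: measurable_funD; apply: measurable_funM.
- by move=> y; exact: ltW.
- by move=> y; rewrite addr_ge0 ?mulr_ge0 ?decay_ge0.
rewrite massD; last 4 first.
- by apply: measurable_funM.
- by apply: measurable_funM.
- by move=> y; rewrite mulr_ge0.
- by move=> y; rewrite mulr_ge0 ?decay_ge0.
rewrite !massZ//; last by move=> y; exact: decay_ge0.
rewrite mass_modular//; last by move=> y; have := p11 y; ord_lra.
have -> : (4 ^+ n + Q + (E + H)) * powR r a =
   h * (2 * (2 * r)) ^+ n + ((Q * powR r a + powR r a * E) * 1 + powR r a * H).
  by rewrite (_ : 2 * (2 * r) = 4 * r); [rewrite exprMn [h * _]mulrCA hrn|]; ring.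
rewrite !EFinD; apply: leeD.
  by apply: mass_cst; [ord_lra|exact: ltW].
apply: leeD; rewrite [X in (_ <= X)%E]EFinM; apply: lee_wpmul2l; rewrite ?lee_fin//.
apply: le_trans hH; apply: le_mass_iint => y; exact: decay_ge0.
Qed.

Lemma mass_le_rate : admissible gamma s bt C C2 pinf p2i p1 p2 ->
  exists2 K : R, 0 < K & forall f x (r lam : R), measurable_fun setT f -> 0 < r ->
  0 < lam -> (modular p1 (restr (fun y => (f y)%:E) x (2 * r)%R) lam <= 1)%E ->
  (mass (fun y => `|f y|%R) x (2 * r)%R <= (K * mass_rate x r)%:E * lam%:E)%E.
Proof.
move=> adm; have [K1 K10 h1] := mass_near adm; have [K2 K20 h2] := mass_far adm.
exists (K1 + K2); first by rewrite addr_gt0.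
move=> f x r lam mf r0 l0 hm; rewrite /mass_rate -EFinM mulrAC; case: ifPn => near.
  apply: le_trans (h1 f x r lam mf r0 near l0 hm) _; rewrite lee_fin.
  apply: ler_wpM2r; first exact: powR_ge0.
  by apply: ler_wpM2r; rewrite ?lerDl ltW.
have r4 : 1 / 4 <= r.
  by move: near; rewrite -ltNge; have := enorm_ge0 x; ord_lra.
apply: le_trans (h2 f x r lam mf r4 l0 hm) _; rewrite lee_fin.
apply: ler_wpM2r; first exact: powR_ge0.
by apply: ler_wpM2r; rewrite ?lerDr ltW.
Qed.

Lemma ball_ind_norm_le : admissible gamma s bt C C2 pinf p2i p1 p2 ->
  exists2 K : R, 1 <= K & forall x (r : R), 0 < r ->
  (iint (fun y => (powR (ball_ind r x y / (K * ball_rate x r)) (p2 y))%:E) <= 1)%E.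
Proof.
move=> [n0 g0 gn s1 C0 C2p hp hp2 mp1 mp2 sp1 p12 p2b rel hpi hp2i spi pi2 p2ib rel_pi].
have n0R : 0 < n%:R :> R by rewrite ltr0n.
have [H H0 hH] := @iint_decay R n.
pose E2 := expR (n.+1%:R * C2).
have E20 : 0 < E2 by exact: expR_gt0.
pose K2 := 1 + (E2 * 2 ^+ n + H).
pose Q := powR 4 (n%:R / p2i) : R.
have p2i1 : 1 < p2i by ord_lra.
have Q1 : 1 <= Q.
  by rewrite /Q -[leLHS](powRr0 4); apply: ler_powR; [ord_lra|rewrite divr_ge0//; ord_lra].
have two0 : 0 <= 2 ^+ n :> R by rewrite exprn_ge0.
have K21 : 1 <= K2 by rewrite /K2 lerDl addr_ge0// mulr_ge0// ltW.
have p21 y : 1 < p2 y by have := sp1 y; have := p12 y; ord_lra.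
have [K1 K11 hK1] := near_ball_modular C0 (fun y => ltW (p21 y)) hp2.
exists (K1 * (K2 * Q)).
  by rewrite -[leLHS]mulr1; apply: ler_pM => //; rewrite -[leLHS]mulr1; apply: ler_pM.
move=> x r r0; rewrite /ball_rate; case: ifPn => near.
  apply: hK1 => //; rewrite -[leLHS]mulr1 mulrAC [_ * 1]mulrC.
  apply: ler_wpM2r; first exact: powR_ge0.
  by rewrite mul1r; apply: ler_peMr; [ord_lra|rewrite -[leLHS]mulr1; apply: ler_pM].
have r4 : 1 / 4 <= r.
  by move: near; rewrite -ltNge; have := enorm_ge0 x; ord_lra.
(* Built on 4 r >= 1 instead of r, so that v <= 1 as [powR_le_decay] requires. *)
pose v := powR (4 * r) (- (n%:R / p2i)); have v0 : 0 <= v by exact: powR_ge0.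
have v1 : powR (4 * r) (- (n%:R / p2i)) <= 1.
  rewrite -[leRHS](powRr0 (4 * r)); apply: ler_powR; first by ord_lra.
  by rewrite oppr_le0 divr_ge0//; ord_lra.
have md : measurable_fun setT (@decay R n) by exact: measurable_decay.
have hv : (mass (fun y => powR v (p2 y)) x r <= K2%:E)%E.
  have pw y : powR (powR (4 * r) (- (n%:R / p2i))) (p2 y) <=
      E2 * powR (4 * r) (- n%:R) + decay y.
    have -> : powR (4 * r) (- n%:R) = powR (powR (4 * r) (- (n%:R / p2i))) p2i.
      by rewrite -powRrM; congr powR; field; rewrite gt_eqF//; ord_lra.
    apply: powR_le_decay => //; rewrite ?powR_ge0// ?(ltW C2p) ?(ltW (p21 y))//.
    exact: ltW.
  apply: le_trans (le_mass x r _ pw) _; first by move=> y; exact: powR_ge0.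
  rewrite massD//; last 2 first.
  - by move=> y; rewrite mulr_ge0 ?powR_ge0// ltW.
  - by move=> y; exact: decay_ge0.
  apply: (@le_trans _ _ ((E2 * 2 ^+ n)%:E + H%:E)%E); last by rewrite -EFinD lee_fin /K2 lerDr.
  apply: leeD.
    apply: le_trans (mass_cst x (ltW r0) _) _; first by rewrite mulr_ge0 ?powR_ge0// ltW.
    rewrite lee_fin -mulrA; apply: ler_wpM2l; first exact: ltW.
    rewrite powRN powR_mulrn; last by ord_lra.
    rewrite ler_pdivrMl; last by rewrite exprn_gt0//; ord_lra.
    rewrite -exprMn; apply: lerXn2r; rewrite ?nnegrE; ord_lra.
  apply: le_trans hH; apply: le_mass_iint => y; exact: decay_ge0.
have K20 : 0 < K2 by lra.
have Q0 : 0 < Q by lra.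
have w0 : 0 < powR r (n%:R / p2i) by exact: powR_gt0.
have KL0 : 0 < K1 * (K2 * Q) by rewrite !mulr_gt0//; lra.
have hK : (K1 * (K2 * Q) * powR r (n%:R / p2i))^-1 <= v / K2.
  rewrite /v powRN powRM ?(ltW r0)// -/Q -invfM lef_pV2 ?posrE ?(mulr_gt0 KL0 w0)//; last first.
    exact: mulr_gt0 (mulr_gt0 Q0 w0) K20.
  rewrite [leRHS](_ : _ = K1 * (Q * powR r (n%:R / p2i) * K2)); last by ring.
  apply: ler_peMl => //; exact: ltW (mulr_gt0 (mulr_gt0 Q0 w0) K20).
apply: (@le_trans _ _ (K2^-1%:E * mass (fun y => powR v (p2 y)) x r)%E); last first.
  by rewrite lee_pdivrMl// mule1.
rewrite -massZ; last 3 first.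
- exact: measurable_powR2.
- by move=> y; exact: powR_ge0.
- by rewrite invr_ge0 ltW.
apply: le_iint => y; first by rewrite lee_fin powR_ge0.
rewrite lee_fin /ball_ind; case: ifP => _; last first.
  by rewrite !mul0r powR0// gt_eqF//; have := p21 y; ord_lra.
have L0 : 0 <= (K1 * (K2 * Q) * powR r (n%:R / p2i))^-1.
  by rewrite invr_ge0 ltW ?(mulr_gt0 KL0 w0).
rewrite !mul1r; apply: le_trans (ler_powR2r _ L0 hK) _.
  by have := p21 y; ord_lra.
rewrite [v / _]mulrC; apply: ge1r_powRZ => //; last by have := p21 y; ord_lra.
by rewrite invr_gt0 K20 invf_le1.
Qed.

End SingleBall.

(** * Local norms of the fractional integral *)

Section FractionalIntegralOnBalls.
Context {R : realType} {n : nat}.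
Implicit Types (x y : n.-tuple R) (f : n.-tuple R -> R).

(** Covers oo - oo as well, which is -oo by convention and has absolute value oo on both sides. *)
Lemma lee_abs_sub_ge0 (a b : \bar R) : (0 <= a)%E -> (0 <= b)%E -> (`|a - b| <= a + b)%E.
Proof.
case: a => [a| |]//; case: b => [b| |]//.
rewrite !lee_fin => a0 b0; rewrite ler_norml; apply/andP; split; ord_lra.
Qed.

Lemma measurable_frac_int (gamma : R) f : measurable_fun setT f ->
  measurable_fun setT (frac_int gamma f).
Proof.
move=> mf; apply: emeasurable_funB.
- apply: (@measurable_iint _ _ (n.-tuple R) n (fun z =>
    (Num.max (f z.2) 0 * powR (edist z.1 z.2) (gamma - n%:R))%:E)).
    apply/measurable_EFinP; apply: measurable_funM.
      by apply: measurable_maxr => //; exact: measurableT_comp.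
    by apply: measurable_powR2 => //; exact: measurable_edist.
  by move=> z; rewrite lee_fin mulr_ge0 ?powR_ge0// le_max lexx orbT.
- apply: (@measurable_iint _ _ (n.-tuple R) n (fun z =>
    (Num.max (- f z.2) 0 * powR (edist z.1 z.2) (gamma - n%:R))%:E)).
    apply/measurable_EFinP; apply: measurable_funM.
      by apply: measurable_maxr => //; apply: measurableT_comp => //; exact: measurableT_comp.
    by apply: measurable_powR2 => //; exact: measurable_edist.
  by move=> z; rewrite lee_fin mulr_ge0 ?powR_ge0// le_max lexx orbT.
Qed.

Lemma frac_int_le (gamma : R) f y : gamma < n%:R -> measurable_fun setT f ->
  (`|frac_int gamma f y| <=
   (2 * expR (n%:R - gamma))%:E * riesz_sum gamma (fun z => `|f z|%R) y)%E.
Proof.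
move=> gn mf.
have key (g : n.-tuple R -> R) : measurable_fun setT g -> (forall z, 0 <= g z) ->
    (forall z, g z <= `|f z|) ->
    (iint (fun z => (g z * powR (edist y z) (gamma - n%:R))%:E) <=
      (expR (n%:R - gamma))%:E * riesz_sum gamma (fun z => `|f z|%R) y)%E.
  move=> mg g0 gf; apply: le_trans (riesz_le_sum y gn mg g0) _.
  by apply: lee_wpmul2l; [rewrite lee_fin expR_ge0|exact: le_riesz_sum].
have i0 (g : n.-tuple R -> R) : (forall z, 0 <= g z) ->
    (0 <= iint (fun z => (g z * powR (edist y z) (gamma - n%:R))%:E))%E.
  by move=> g0; apply: iint_ge0 => z; rewrite lee_fin mulr_ge0 ?powR_ge0.
have max0 (t : R) : 0 <= Num.max t 0 by rewrite le_max lexx orbT.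
apply: le_trans (lee_abs_sub_ge0 (i0 _ _) (i0 _ _)) _ => //.
rewrite mulrDl mul1r EFinD ge0_muleDl ?lee_fin ?expR_ge0//.
apply: leeD; apply: key => //.
- exact: measurable_maxr.
- by move=> z; rewrite ge_max normr_ge0 ler_norm.
- by apply: measurable_maxr => //; exact: measurableT_comp.
- by move=> z; rewrite ge_max normr_ge0 -normrN ler_norm.
Qed.

(** The contribution of the scales above r, recentered from the points y of B(x, r) to x; this
    doubles the radii and makes it constant over the ball. *)
Definition tail_sum (gamma : R) f x (r : R) : \bar R :=
  (\sum_(i <oo) (if (r < erad i)%R then
     (powR (erad i) (gamma - n%:R))%:E * mass (fun y => `|f y|%R) x (2 * erad i)%R else 0))%E.

Lemma riesz_sum_split (gamma : R) f x y (r : R) : measurable_fun setT f -> 0 < r ->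
  edist x y < r ->
  (riesz_sum gamma (fun z => `|f z|%R) y <=
   riesz_sum gamma (fun z => ball_ind (2 * r) x z * `|f z|)%R y + tail_sum gamma f x r)%E.
Proof.
move=> mf r0 xy.
have g0 z : 0 <= ball_ind (2 * r) x z * `|f z| by rewrite mulr_ge0 ?ball_ind_ge0.
rewrite -nneseriesD; last 2 first.
- by move=> i _ _; exact: riesz_term_ge0.
- by move=> i _ _; case: ifP => // _; rewrite mule_ge0 ?mass_ge0// lee_fin powR_ge0.
apply: le_nneseries => i; first exact: riesz_term_ge0.
have e0 : 0 < erad i :> R := erad_gt0 i.
case: ifPn => [ri|].
  apply: (@le_trans _ _ (0 + (powR (erad i) gamma)%:E *
      avg (fun z => `|f z|%R) y (erad i))%E); first by rewrite add0e.
  apply: leeD; first exact: riesz_term_ge0.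
  rewrite /avg muleA -EFinM -powRDp//; apply: lee_wpmul2l.
    by rewrite lee_fin powR_ge0.
  apply: le_iint => z; rewrite lee_fin ?mulr_ge0 ?ball_ind_ge0//.
  by apply: ler_wpM2r => //; apply: ball_ind_sub; rewrite eudistC; ord_lra.
rewrite -leNgt => ri; rewrite adde0; apply: lee_wpmul2l; first by rewrite lee_fin powR_ge0.
apply: lee_wpmul2l; first by rewrite lee_fin powR_ge0.
apply: le_mass_ball => // z yz; rewrite /ball_ind ifT ?mul1r//.
by have := eudist_triangle y x z; ord_lra.
Qed.

(** Up to the factor 1/4, w is at most a weighted mean of u/C0 and v, hence at most half of their
    maximum; as p >= 1, the factors 1/2 and 1/C0 come out at least to the first power. If u has
    modular at most C0 and v at most 1, then w has modular at most 1/2 + 1/2. *)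
Lemma half_power (u v A B tau p C0 w : R) : 0 <= u -> 0 < A -> 0 < B -> 0 <= tau ->
  1 <= C0 -> 1 <= p -> 0 <= w -> w <= (A * (u / C0) + tau * B * v) / (4 * (A + tau * B)) ->
  0 <= v ->
  powR w p <= 2^-1 * C0^-1 * powR u p + 2^-1 * powR v p.
Proof.
move=> u0 A0 B0 t0 C1 p1 w0 hw v0.
have tB : 0 <= tau * B by rewrite mulr_ge0// ltW.
have AB : 0 < A + tau * B by rewrite ltr_wpDr.
pose m := Num.max (u / C0) v.
have uc0 : 0 <= u / C0 by rewrite divr_ge0//; ord_lra.
have m0 : 0 <= m by rewrite le_max uc0.
have wm : w <= 2^-1 * m.
  apply: le_trans hw _; rewrite ler_pdivrMr ?mulr_gt0//.
  have h1 : A * (u / C0) <= A * m by rewrite ler_pM2l// le_max lexx.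
  have h2 : tau * B * v <= tau * B * m by rewrite ler_wpM2l// le_max lexx orbT.
  have -> : 2^-1 * m * (4 * (A + tau * B)) = 2 * (A * m + tau * B * m) by field.
  have : 0 <= A * m by rewrite mulr_ge0// ltW.
  have : 0 <= tau * B * m by rewrite mulr_ge0.
  ord_lra.
have p0 : 0 <= p by ord_lra.
apply: le_trans (ler_powR2r p0 w0 wm) _.
apply: le_trans (ge1r_powRZ _ m0 p1) _; first by rewrite invr_gt0 ltr0n invf_le1// ler1n.
rewrite -mulrA -mulrDr; apply: ler_wpM2l; first by rewrite invr_ge0.
have i1 : powR (u / C0) p <= C0^-1 * powR u p.
  rewrite mulrC; apply: ge1r_powRZ => //; rewrite invr_gt0 invf_le1; ord_lra.
have i2 : 0 <= C0^-1 * powR u p by rewrite mulr_ge0 ?powR_ge0// invr_ge0; ord_lra.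
rewrite /m; case: (leP (u / C0) v) => _; first by rewrite ler_wpDl.
by apply: le_trans i1 _; rewrite lerDl powR_ge0.
Qed.

(** For y in B(x, r), the scales up to r see f only inside B(x, 2 r) and fall under [strong_type];
    the other scales contribute a constant, measured by the norm of the indicator. Both go into one
    admissible level through [half_power]. *)
Lemma frac_int_ball_norm (gamma s bt C C2 pinf p2i : R) (p1 p2 : n.-tuple R -> R) :
  admissible gamma s bt C C2 pinf p2i p1 p2 ->
  exists2 K : R, 0 < K & forall f, measurable_fun setT f -> forall x (r : R), 0 < r ->
  (lux_norm p2 (restr (frac_int gamma f) x r) <=
   K%:E * (grid_norm p1 f x (2 * r)%R + (ball_rate p2i p2 x r)%:E * tail_sum gamma f x r))%E.
Proof.
move=> adm; have [C0 C01 hC0] := strong_type adm.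
have [K K1 hK] := ball_ind_norm_le adm.
case: adm => n0 g0 gn s1 Cp0 C2p hp hp2 mp1 mp2 sp1 p12 p2b rel hpi hp2i spi pi2 p2ib rel_pi.
have p11 y : 1 < p1 y by have := sp1 y; ord_lra.
have p21 y : 1 < p2 y by have := p12 y; have := p11 y; ord_lra.
pose D := 2 * expR (n%:R - gamma).
have D0 : 0 < D by rewrite mulr_gt0// expR_gt0.
have C00 : 0 < C0 by ord_lra.
have K0 : 0 < K by ord_lra.
have D40 : 0 < 4 * D by apply: mulr_gt0.
have K40 : 0 < 4 * D * (C0 + K) by apply: mulr_gt0 => //; exact: addr_gt0.
exists (4 * D * (C0 + K)) => //.
move=> f mf x r r0.
have maf : measurable_fun setT (fun z => `|f z|) by exact: measurableT_comp.
have X0 := ball_rate_gt0 p2i p2 x r0; set X := ball_rate p2i p2 x r in X0 *.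
have G0 := grid_norm_ge0 p1 f x (2 * r).
have T0 : (0 <= tail_sum gamma f x r)%E.
  apply: nneseries_ge0 => i _ _; case: ifP => // _.
  by rewrite mule_ge0 ?mass_ge0// lee_fin powR_ge0.
case ET : (tail_sum gamma f x r) T0 => [tau| |]//; last first.
  move=> _; rewrite gt0_muley ?lte_fin// addey ?gt0_muley ?lte_fin ?leey//.
  by rewrite gt_eqF// (lt_le_trans _ G0)// ltNy0.
rewrite lee_fin => tau0.
have main (lam : R) : 0 < lam ->
    (modular p1 (restr (fun y => (f y)%:E) x (2 * r)) lam <= 1)%E ->
    (lux_norm p2 (restr (frac_int gamma f) x r) <= (4 * D * (C0 * lam + tau * (K * X)))%:E)%E.
  move=> l0 hlam.
  have A0 : 0 < C0 * lam by rewrite mulr_gt0.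
  have B0 : 0 < K * X by rewrite mulr_gt0.
  have AB : 0 < C0 * lam + tau * (K * X) by rewrite ltr_wpDr// mulr_ge0// ltW.
  have L0 : 0 < 4 * D * (C0 * lam + tau * (K * X)) by exact: mulr_gt0.
  apply: lux_norm_le => //.
  pose g z := ball_ind (2 * r) x z * `|f z|.
  pose gl z := ball_ind (2 * r) x z * `|f z| / lam.
  have gl0 z : 0 <= gl z by rewrite divr_ge0 ?mulr_ge0 ?ball_ind_ge0// ltW.
  have mgl : measurable_fun setT gl.
    apply: measurable_funM => //; apply: measurable_funM => //.
    exact: measurable_ball_ind.
  have glg : g = (fun z => lam * gl z).
    by apply/funext => z; rewrite /gl /g [RHS]mulrC divfK// gt_eqF.
  have hgl : (iint (fun y => (powR (gl y) (p1 y))%:E) <= 1%:E)%E.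
    by rewrite /gl -modular_restr.
  have := hC0 gl mgl gl0 hgl => hs.
  pose u := riesz_sum gamma gl.
  have u0 y : (0 <= u y)%E by exact: riesz_sum_ge0.
  have mu : measurable_fun setT (fun y => poweR (u y) (p2 y)).
    apply: measurable_poweR2 => //; first exact: measurable_riesz_sum.
    by move=> y; have := p21 y; ord_lra.
  pose v y := ball_ind r x y / (K * X).
  have v0 y : 0 <= v y by rewrite divr_ge0 ?ball_ind_ge0// ltW.
  have mv : measurable_fun setT (fun y => (powR (v y) (p2 y))%:E).
    apply/measurable_EFinP; apply: measurable_powR2 => //; apply: measurable_funM => //.
    exact: measurable_ball_ind.
  have hC2 : 0 <= 2^-1 * C0^-1 by rewrite mulr_ge0 ?invr_ge0// ltW.
  have h2 : 0 <= 2^-1 :> R by rewrite invr_ge0.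
  have pv0 y : (0 <= (powR (v y) (p2 y))%:E)%E by rewrite lee_fin powR_ge0.
  have [_ _ hlin] := iint_lin_le mu mv (fun y => poweR_ge0 (u y) (p2 y)) pv0 hC2 h2 hs
    (hK x r r0).
  apply: (le_trans (le_trans _ hlin)); last first.
    rewrite lee_fin; have -> : 2^-1 * C0^-1 * C0 + 2^-1 * 1 = 1 :> R by field; rewrite gt_eqF.
    exact: lexx.
  apply: le_iint => y; first exact: poweR_ge0.
  rewrite restrE abseM.
  have vE : v y = ball_ind r x y / (K * X) by [].
  have := vE; rewrite /ball_ind; case: ifPn => [xy|_] {}vE; last first.
    rewrite /= normr0 !mul0e poweR0r; last by rewrite gt_eqF//; have := p21 y; ord_lra.
    by rewrite adde_ge0// mule_ge0 ?poweR_ge0// lee_fin// powR_ge0.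
  rewrite /= normr1 mul1e.
  have Fle : (`|frac_int gamma f y| <= D%:E * (lam%:E * u y + tau%:E))%E.
    apply: le_trans (frac_int_le y gn mf) _; rewrite -/D.
    apply: lee_wpmul2l; first by rewrite lee_fin ltW.
    apply: le_trans (riesz_sum_split gamma mf r0 xy) _; rewrite ET.
    by rewrite -/g glg riesz_sumZ// ltW.
  have p2y := p21 y.
  case Eu : (u y) (u0 y) Fle => [t| |]//; last first.
    move=> _ _; rewrite poweRyr; last by rewrite gt_eqF//; ord_lra.
    rewrite gt0_muley ?lte_fin ?mulr_gt0 ?invr_gt0// addye ?leey//.
  rewrite lee_fin => t0 Fle0.
  have {Fle0} Fle : (`|frac_int gamma f y| <= (D * (lam * t + tau))%:E)%E by [].
  case: (`|frac_int gamma f y|)%E (abse_ge0 (frac_int gamma f y)) Fle => [w| |]//.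
  rewrite !lee_fin => w0 wle;
  apply: (half_power (A := C0 * lam) (B := K * X) (tau := tau)) => //.
  - exact: ltW.
  - by rewrite mulr_ge0// invr_ge0 ltW.
  - rewrite ler_pdivrMr// vE.
    have -> : (C0 * lam * (t / C0) + tau * (K * X) * (1 / (K * X))) /
      (4 * (C0 * lam + tau * (K * X))) * (4 * D * (C0 * lam + tau * (K * X))) =
      D * (lam * t + tau).
      by field; rewrite !gt_eqF.
    exact: wle.
(* The tail is finite here, so it is moved to the left before passing to the infimum over the
   grid. *)
have sub : (lux_norm p2 (restr (frac_int gamma f) x r) - (4 * D * (tau * (K * X)))%:E <=
    (4 * D * (C0 + K))%:E * grid_norm p1 f x (2 * r)%R)%E.
  apply: grid_norm_lb => // lam l0 hlam; rewrite leeBlDr// -EFinM -EFinD.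
  apply: le_trans (main lam l0 hlam) _; rewrite lee_fin -[_ * (C0 + K) * lam]mulrA -mulrDr.
  apply: ler_wpM2l; first exact: ltW.
  rewrite lerD2r; apply: ler_wpM2r; [exact: ltW|by rewrite lerDl ltW].
move: sub; rewrite leeBlDr// => /le_trans; apply.
rewrite ge0_muleDr ?mule_ge0 ?lee_fin ?(ltW X0)//; apply: leeD2l.
rewrite -!EFinM lee_fin -[_ * (C0 + K) * _]mulrA; apply: ler_wpM2l; first exact: ltW.
have -> : tau * (K * X) = K * (X * tau) by ring.
by apply: ler_wpM2r; [rewrite mulr_ge0// ltW|rewrite lerDr ltW].
Qed.

Lemma lebn_eball x (r : R) : lebn (eball x r) = iint (fun y => (ball_ind r x y)%:E).
Proof. by apply: eq_iint => y; rewrite ball_ind_indic. Qed.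

(** The exponent may have either sign, so both inequalities are read off from a bound on |ln |B(x,
    r)| - n ln r|. *)
Lemma weight_bounds (E : R) : 0 <= E -> exists2 K : R, 1 <= K &
  forall x (r e : R), 0 < r -> `|e| <= E ->
  powR (fine (lebn (eball x r))) e <= K * powR r (n%:R * e) /\
  powR r (n%:R * e) <= K * powR (fine (lebn (eball x r))) e.
Proof.
move=> E0; pose c : R := (2 / n.+1%:R) ^+ n.
have c0 : 0 < c by rewrite exprn_gt0// divr_gt0.
have t0 : 0 < 2 ^+ n :> R by rewrite exprn_gt0.
pose L := `|ln c| + `|ln (2 ^+ n : R)|.
have L0 : 0 <= L by rewrite addr_ge0.
exists (expR (E * L)); first by rewrite -[leLHS](@expR0 R) ler_expR mulr_ge0.
move=> x r e r0 eE; rewrite lebn_eball.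
have rn0 : 0 < r ^+ n by rewrite exprn_gt0.
have h1 := iint_ball_le x (ltW r0); have h2 := iint_ball_ge x r0.
set V := iint _ in h1 h2 *.
have Vfin : V \is a fin_num.
  rewrite ge0_fin_numE; first exact: le_lt_trans h1 (ltry _).
  by apply: iint_ge0 => y; rewrite lee_fin ball_ind_ge0.
move: h1 h2; rewrite -(fineK Vfin) !lee_fin /=; move: (fine V) => v h1 h2.
have h1' : v <= 2 ^+ n * r ^+ n by rewrite -exprMn.
have h2' : c * r ^+ n <= v.
  by rewrite /c -exprMn mulrAC -mulrA.
have v0 : 0 < v by apply: lt_le_trans h2'; rewrite mulr_gt0.
have lv : `|ln v - n%:R * ln r| <= L.
  have lr : n%:R * ln r = ln (r ^+ n) by rewrite lnXn// mulr_natl.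
  have u1 : ln v <= ln (2 ^+ n : R) + ln (r ^+ n).
    by rewrite -lnM ?posrE// ler_ln ?posrE ?mulr_gt0.
  have u2 : ln c + ln (r ^+ n) <= ln v.
    by rewrite -lnM ?posrE// ler_ln ?posrE ?mulr_gt0.
  have u3 := ler_norm (ln (2 ^+ n : R)); have u4 := ler_norm (- ln c).
  rewrite normrN in u4; have := normr_ge0 (ln c); have := normr_ge0 (ln (2 ^+ n : R)).
  by rewrite lr ler_norml /L => *; apply/andP; split; ord_lra.
have eb : `|e * (ln v - n%:R * ln r)| <= E * L by rewrite normrM; apply: ler_pM.
move: eb; rewrite ler_norml => /andP[e1 e2].
by rewrite !powR_expR// -!expRD !ler_expR; split; ord_lra.
Qed.

End FractionalIntegralOnBalls.

(** * Measurable weighted norms and their control by the Fofana norm *)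

Section Sufficiency.
Context {R : realType} {n : nat}.
Implicit Types (x y : n.-tuple R) (f : n.-tuple R -> R).

(** Rescaling the simple functions below the integrand gives one inequality for every nonnegative
    function, measurable or not; it is applied to Luxemburg norms as functions of the center. *)
Lemma integralZ_le d (T : measurableType d) (mu : {measure set T -> \bar R})
    (k : R) (u : T -> \bar R) : 0 < k -> (forall z, 0 <= u z)%E ->
  (\int[mu]_z (k%:E * u z) <= k%:E * \int[mu]_z u z)%E.
Proof.
move=> k0 u0; have ku0 z : (0 <= k%:E * u z)%E by rewrite mule_ge0// lee_fin ltW.
rewrite !ge0_integralTE//; apply: ge_ereal_sup => _ [h hf <-].
have ki0 : 0 <= k^-1 by rewrite invr_ge0 ltW.
rewrite -lee_pdivrMl//.
apply: ereal_sup_ubound; exists (scale_nnsfun h ki0); last by rewrite /= sintegralrM.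
by move=> z; rewrite /= EFinM lee_pdivrMl.
Qed.

Lemma iintZ_le m (k : R) (u : m.-tuple R -> \bar R) : 0 < k -> (forall z, 0 <= u z)%E ->
  (iint (fun z => k%:E * u z) <= k%:E * iint u)%E.
Proof.
move=> k0; elim: m u => [|m ih] u u0 //=.
apply: le_trans (integralZ_le _ k0 _); last by move=> t; exact: iint_ge0.
apply: ge0_le_integralT => t; last exact: ih.
by apply: iint_ge0 => y; rewrite mule_ge0// lee_fin ltW.
Qed.

Lemma poweR_le_inv (a : \bar R) (B q : R) : 0 < q -> (0 <= a)%E -> 0 <= B ->
  (poweR a q <= (powR B q)%:E)%E -> (a <= B%:E)%E.
Proof.
move=> q0 a0 B0 h; have qi : 0 <= q^-1 by rewrite invr_ge0 ltW.
have := le_poweR qi (poweR_ge0 a q) h.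
by rewrite -poweRrM mulfV ?gt_eqF// poweRe1// -poweR_EFin -poweRrM mulfV ?gt_eqF// poweRe1.
Qed.

Lemma le_grid_norm (p : n.-tuple R -> R) f x x' (r r' : R) : (forall y, 0 <= p y) ->
  edist x x' + r <= r' -> (grid_norm p f x r <= grid_norm p f x' r')%E.
Proof.
move=> p0 h; apply/ereal_infP => _ [i _ <-]; case: ifPn => [hi|_]; last exact: leey.
apply: ereal_inf_lbound; exists i => //; rewrite ifT//.
apply: le_trans hi; apply: le_modular => //; first exact: erad_gt0.
exact: le_restr.
Qed.

Lemma series_jensen (q Ck : R) (c : nat -> R) (Q : nat -> \bar R) : 1 <= q -> 0 <= Ck ->
  (forall i, 0 <= c i) -> (forall i, 0 <= Q i)%E ->
  (\sum_(i <oo) (c i)%:E <= Ck%:E)%E ->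
  (poweR (\sum_(i <oo) ((c i)%:E * Q i)) q <=
   (powR (Ck + 1) q)%:E * \sum_(i <oo) ((c i)%:E * poweR (Q i) q))%E.
Proof.
move=> q1 Ck0 c0 Q0 hc.
have cQ i : (0 <= (c i)%:E * Q i)%E by rewrite mule_ge0// lee_fin.
have cQq i : (0 <= (c i)%:E * poweR (Q i) q)%E by rewrite mule_ge0 ?poweR_ge0// lee_fin.
apply: young_optimal => //.
- by apply: nneseries_ge0 => i _ _.
- by apply: nneseries_ge0 => i _ _.
move=> lam l0; have ll0 : 0 <= powR lam (1 - q) by exact: powR_ge0.
have yQ i : (Q i <= lam%:E + (powR lam (1 - q))%:E * poweR (Q i) q)%E.
  case: (Q i) (Q0 i) => [t| |]//; last first.
    move=> _; rewrite poweRyr; last by rewrite gt_eqF//; ord_lra.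
    by rewrite gt0_muley ?lte_fin ?powR_gt0// addey.
  rewrite lee_fin => t0; rewrite /= -EFinM -EFinD lee_fin.
  have := @le_young _ (t / lam) q; rewrite divr_ge0 ?(ltW l0)// => /(_ isT q1).
  rewrite ler_pdivrMr// => /le_trans; apply.
  rewrite mulrDl mul1r lerD2l powRM ?invr_ge0 ?(ltW l0)// -mulrA mulrC.
  apply: ler_wpM2r; first exact: powR_ge0.
  rewrite -powR_inv1 ?(ltW l0)// -powRrM -[X in _ * X]powRr1 ?(ltW l0)// -powRDp//.
  by rewrite le_eqVlt; apply/orP; left; apply/eqP; congr powR; ord_lra.
apply: (@le_trans _ _ (\sum_(i <oo) (lam%:E * (c i)%:E +
    (powR lam (1 - q))%:E * ((c i)%:E * poweR (Q i) q)))%E).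
  apply: le_nneseries => // i.
  apply: le_trans (lee_wpmul2l _ (yQ i)) _; first by rewrite lee_fin.
  rewrite ge0_muleDr ?mule_ge0 ?poweR_ge0 ?lee_fin ?(ltW l0)//.
  by rewrite muleC leeD2l// muleCA.
rewrite nneseriesD; last 2 first.
- by move=> i _ _; rewrite mule_ge0// lee_fin// ltW.
- by move=> i _ _; rewrite mule_ge0// lee_fin.
rewrite !nneseriesZl//; last by move=> i _; rewrite lee_fin.
apply: leeD => //; rewrite mulrC EFinM.
by apply: lee_wpmul2l => //; rewrite lee_fin ltW.
Qed.

Definition wexp (p : n.-tuple R -> R) (q alpha : R) x : R := alpha^-1 - (p x)^-1 - q^-1.

(** Measurable substitute for the integrand of the Fofana norm: r^n replaces the volume and the grid
    norm the Luxemburg norm. The ball is doubled because the bound on B(x, r) involves f on B(x, 2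
    r). *)
Definition wnorm (p : n.-tuple R -> R) (q alpha : R) f (r : R) x : \bar R :=
  ((powR r (n%:R * wexp p q alpha x))%:E * grid_norm p f x (2 * r)%R)%E.

Lemma wnorm_ge0 p q alpha f r x : (0 <= wnorm p q alpha f r x)%E.
Proof. by rewrite mule_ge0 ?grid_norm_ge0// lee_fin powR_ge0. Qed.

Lemma measurable_wnorm (p : n.-tuple R -> R) (q alpha : R) f (r : R) :
  measurable_fun setT p -> (forall y, 1 <= p y) ->
  measurable_fun setT f -> measurable_fun setT (wnorm p q alpha f r).
Proof.
move=> mp p1 mf; have p0 y : 0 <= p y by have := p1 y; ord_lra.
apply: (@emeasurable_funM _ _ _ _ (fun x => (powR r (n%:R * wexp p q alpha x))%:E)).
  apply/measurable_EFinP; apply: measurable_powR2 => //; apply: measurable_funM => //.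
  apply: measurable_funB => //; apply: measurable_funB => //.
  have -> : (fun x => (p x)^-1) = (fun x => powR (p x) (- 1)).
    by apply/funext => x; rewrite powR_inv1.
  exact: measurable_powR2.
exact: measurable_grid_norm.
Qed.

Lemma wexp_bound (p : n.-tuple R -> R) (q alpha : R) x : 1 <= p x -> 1 <= q -> 1 <= alpha ->
  `|wexp p q alpha x| <= 3.
Proof.
move=> p1 q1 a1.
have h (t : R) : 1 <= t -> 0 <= t^-1 <= 1.
  by move=> t1; rewrite invr_ge0 invf_le1; ord_lra.
have /andP[? ?] := h _ p1; have /andP[? ?] := h _ q1; have /andP[? ?] := h _ a1.
by rewrite ler_norml /wexp; apply/andP; split; ord_lra.
Qed.

Lemma iint_wnorm (p : n.-tuple R -> R) (q alpha : R) : (forall y, 1 <= p y) ->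
  1 <= q -> 1 <= alpha ->
  exists2 K : R, 0 < K & forall f (N : R), 0 <= N ->
  (fofana_norm p q alpha (fun x => (f x)%:E) <= N%:E)%E -> forall r : R, 0 < r ->
  (iint (fun x => poweR (wnorm p q alpha f r x) q) <= (powR (K * N) q)%:E)%E.
Proof.
move=> p1 q1 a1; have [Kw Kw1 hw] := @weight_bounds R n 3 (ler0n _ _).
have p0 y : 0 <= p y by have := p1 y; ord_lra.
(* The Fofana norm is used at radius 2 r; as |wexp| <= 3, returning to r in the weight costs at most
   2^(3 n). *)
pose T : R := powR 2 (n%:R * 3).
have T0 : 0 < T by exact: powR_gt0.
have K0 : 0 < T * Kw * expR 1 by rewrite !mulr_gt0 ?expR_gt0//; ord_lra.
exists (T * Kw * expR 1) => // f N N0 hN r r0; set K := T * Kw * expR 1 in K0 *.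
have q0 : 0 < q by ord_lra.
pose h x := ((powR (fine (lebn (eball x (2 * r)))) (alpha^-1 - (p x)^-1 - q^-1))%:E
        * lux_norm p (restr (fun x => (f x)%:E) x (2 * r)%R))%E.
have h0 x : (0 <= h x)%E by rewrite mule_ge0 ?lux_norm_ge0// lee_fin powR_ge0.
have r20 : 0 < 2 * r by ord_lra.
have hLq : (Lq_norm q h <= N%:E)%E.
  by apply: le_trans hN; apply: ereal_sup_ubound; exists (2 * r).
have hi : (iint (fun x => poweR (h x) q) <= (powR N q)%:E)%E.
  have -> : (fun x => poweR (h x) q) = (fun x => poweR `|h x|%E q).
    by apply/funext => x; rewrite gee0_abs.
  have := le_poweR (ltW q0) _ hLq; rewrite /Lq_norm poweR_ge0 => /(_ isT).
  rewrite -poweRrM mulVf ?gt_eqF// poweRe1//.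
  by apply: iint_ge0 => x; exact: poweR_ge0.
have wh x : (wnorm p q alpha f r x <= K%:E * h x)%E.
  have eb := wexp_bound (p1 x) q1 a1; have [_ w2] := hw x (2 * r) (wexp p q alpha x) r20 eb.
  have g := grid_norm_le_lux f x (2 * r) p0.
  apply: le_trans (lee_wpmul2l _ g) _; first by rewrite lee_fin powR_ge0.
  rewrite muleA -EFinM /h muleA -EFinM; apply: lee_wpmul2r; first exact: lux_norm_ge0.
  rewrite lee_fin /K [leRHS]mulrAC; apply: ler_wpM2r; first exact: expR_ge0.
  have -> : powR r (n%:R * wexp p q alpha x) =
      powR 2 (- (n%:R * wexp p q alpha x)) * powR (2 * r) (n%:R * wexp p q alpha x).
    by rewrite powRM ?(ltW r0)// mulrA -powRDp// addNr powRr0 mul1r.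
  rewrite -[leRHS]mulrA; apply: ler_pM; rewrite ?powR_ge0//.
  apply: ler_powR; first by ord_lra.
  by rewrite -mulrN; apply: ler_wpM2l => //; move: eb; rewrite ler_norml => /andP[]; ord_lra.
apply: (@le_trans _ _ (iint (fun x => (powR K q)%:E * poweR (h x) q)%E)).
  apply: le_iint => x; first exact: poweR_ge0.
  apply: le_trans (le_poweR (ltW q0) (wnorm_ge0 _ _ _ _ _ _) (wh x)) _.
  by rewrite poweRM// lee_fin ltW.
apply: le_trans (iintZ_le _ _) _; first by rewrite powR_gt0.
  by move=> x; exact: poweR_ge0.
rewrite powRM// ?(ltW K0)// EFinM; apply: lee_wpmul2l => //.
by rewrite lee_fin powR_ge0.
Qed.

Lemma weight_far_le (m a b A Q c l rho : R) : 0 < m -> 1 <= a -> 1 <= b -> 0 < c ->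
  0 < rho -> `|a - b| <= c / l -> 1 <= l -> 0 <= ln rho -> ln rho <= l ->
  expR (- (m * c)) * powR rho (m * (A - b^-1 - Q)) <= powR rho (m * (A - a^-1 - Q)).
Proof.
move=> m0 a1 b1 c0 rho0 ab l1 lr0 lr.
rewrite !powR_expR// -expRD ler_expR.
have i1 : 0 <= a^-1 <= 1 by rewrite invr_ge0 invf_le1; ord_lra.
have i2 : 0 <= b^-1 <= 1 by rewrite invr_ge0 invf_le1; ord_lra.
have h1 : a^-1 - b^-1 <= c / l.
  have -> : a^-1 - b^-1 = (b - a) * (a^-1 * b^-1) by field; rewrite !gt_eqF//; ord_lra.
  apply: le_trans (ler_norm _) _; rewrite normrM distrC -[leRHS]mulr1.
  case/andP: i1 => i10 i11; case/andP: i2 => i20 i21.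
  apply: ler_pM => //.
  by rewrite ger0_norm ?mulr_ge0// -[leRHS]mulr1; apply: ler_pM.
have h2 : (a^-1 - b^-1) * ln rho <= c.
  apply: (@le_trans _ _ (c / l * l)); last by rewrite divfK// gt_eqF//; ord_lra.
  apply: (@le_trans _ _ (c / l * ln rho)); first exact: ler_wpM2r.
  by apply: ler_wpM2l => //; rewrite divr_ge0; ord_lra.
have := ler_wpM2l (ltW m0) h2.
by move: (ln rho) => w; ord_lra.
Qed.

(* At scales [r >= (1 + |x|) / 4] the weight at [x] is not comparable with
   [r ^ (n (1 / alpha - 1 / pinf - 1 / q))], but the one at points at distance
   about [10 r] from the origin is; the norm over [B(x, 2 r)] is estimated there. *)
Lemma far_norm_le (gamma s bt C C2 pinf p2i q alpha : R) (p1 p2 : n.-tuple R -> R) :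
  admissible gamma s bt C C2 pinf p2i p1 p2 -> 1 <= q -> 1 <= alpha ->
  exists2 K : R, 0 < K & forall f (N : R), 0 <= N ->
  (forall r : R, 0 < r ->
    (iint (fun x => poweR (wnorm p1 q alpha f r x) q) <= (powR N q)%:E)%E) ->
  forall x (r : R), 1 + enorm x < 4 * r ->
  (grid_norm p1 f x (2 * r) <= (K * N * powR r (n%:R / pinf - n%:R / alpha))%:E)%E.
Proof.
move=> [n0 g0 gn s1 C0 C2p hp hp2 mp1 mp2 sp1 p12 p2b rel hpi hp2i spi pi2 p2ib rel_pi] q1 a1.
have n0R : 0 < n%:R :> R by rewrite ltr0n.
have q0 : 0 < q by ord_lra.
have p11 y : 1 <= p1 y by have := sp1 y; ord_lra.
have p10 y : 0 <= p1 y by have := p11 y; ord_lra.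
pose ei := alpha^-1 - pinf^-1 - q^-1.
have eib : `|n%:R * ei| <= n%:R * 3.
  rewrite normrM ger0_norm//; apply: ler_wpM2l => //.
  have h (t : R) : 1 <= t -> 0 <= t^-1 <= 1.
    by move=> t1; rewrite invr_ge0 invf_le1; ord_lra.
  have /andP[? ?] := h _ q1; have /andP[? ?] := h _ a1.
  have /andP[? ?] : 0 <= pinf^-1 <= 1 by apply: h; ord_lra.
  by rewrite ler_norml /ei; apply/andP; split; ord_lra.
pose cv : R := (2 / n.+1%:R) ^+ n.
have cv0 : 0 < cv by rewrite exprn_gt0// divr_gt0.
pose E := expR (n%:R * C).
have E0 : 0 < E by exact: expR_gt0.
pose B : R := powR (17 / 2) (n%:R * 3).
have B0 : 0 < B by rewrite powR_gt0//; ord_lra.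
pose cq := powR cv q^-1.
have cq0 : 0 < cq by exact: powR_gt0.
exists (E * B / cq); first by rewrite divr_gt0// mulr_gt0.
move=> f N N0 hN x r far.
have x0 := enorm_ge0 x.
have r0 : 0 < r by ord_lra.
have [x1 hx1] := @exists_enorm R n (10 * r) n0 ltac:(ord_lra).
(* From |x| < 4 r and 9 r <= |y| <= 11 r for y in B(x1, r), the ball B(x, 2 r) lies in B(y, 17 r) =
   B(y, 2 rho), while rho <= |y| permits writing the weight at y with [pinf]. The factor [B] in the
   constant is the price of replacing rho by r afterwards. *)
pose rho := 17 / 2 * r.
have rho0 : 0 < rho by rewrite /rho; ord_lra.
pose b := expR (- (n%:R * C)) * powR rho (n%:R * ei).
have b0 : 0 < b by rewrite mulr_gt0 ?expR_gt0 ?powR_gt0.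
set g := grid_norm p1 f x (2 * r).
have g0' : (0 <= g)%E by exact: grid_norm_ge0.
have low y : edist x1 y < r -> (b%:E * g <= wnorm p1 q alpha f rho y)%E.
  move=> x1y.
  have ny1 : 9 * r <= enorm y.
    by have := enorm_le_edist x1 y; rewrite hx1; ord_lra.
  have ny2 : enorm y <= 11 * r.
    by have := enorm_le_edist y x1; rewrite hx1 eudistC; ord_lra.
  rewrite /wnorm; apply: lee_pmul; [by rewrite lee_fin ltW|exact: g0'| |].
    have lr : ln rho <= lognorm y.
      rewrite /lognorm ler_ln ?posrE ?enormD_gt0//; apply: le_trans (_ : 9 * r <= _).
        by rewrite /rho; clear -r0; ord_lra.
      by apply: le_trans ny1 _; rewrite lerDl expR_ge0.
    rewrite lee_fin; apply: weight_far_le (hpi y) (lognorm_ge1 y) _ lr => //.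
      by clear -spi s1; ord_lra.
    by rewrite ln_ge0// /rho; clear -far x0; ord_lra.
  apply: le_grid_norm p10 _.
  have : edist x y <= enorm x + enorm y.
    rewrite -(edist_cst_tuple0 x) -(edist_cst_tuple0 y) (eudistC y).
    exact: eudist_triangle.
  by rewrite /rho; move: far ny2; clear; ord_lra.
have bg0 : (0 <= b%:E * g)%E by rewrite mule_ge0// lee_fin ltW.
have vol : (poweR (b%:E * g) q * (cv * r ^+ n)%:E <= (powR N q)%:E)%E.
  apply: le_trans (hN rho rho0).
  apply: (@le_trans _ _ (poweR (b%:E * g) q * iint (fun y => (ball_ind r x1 y)%:E))%E).
    apply: lee_wpmul2l; first exact: poweR_ge0.
    apply: le_trans (iint_ball_ge x1 r0); rewrite lee_fin /cv -exprMn.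
    by rewrite mulrAC -mulrA.
  rewrite -iintZl.
  - apply: le_iint => y; first by rewrite mule_ge0 ?poweR_ge0// lee_fin ball_ind_ge0.
    rewrite /ball_ind; case: ifPn => h; last by rewrite mule0 poweR_ge0.
    by rewrite mule1; apply: le_poweR; [exact: ltW|exact: bg0|exact: low].
  - by apply/measurable_EFinP; exact: measurable_ball_ind.
  - by move=> y; rewrite lee_fin ball_ind_ge0.
  - exact: poweR_ge0.
have rn0 : 0 < r ^+ n by rewrite exprn_gt0.
have crn : 0 < cv * r ^+ n by rewrite mulr_gt0.
have fin : (b%:E * g <= (N / (cq * powR r (n%:R / q)))%:E)%E.
  have D0 : 0 < cq * powR r (n%:R / q) by rewrite mulr_gt0 ?powR_gt0.
  apply: (@poweR_le_inv _ _ q) => //; first by rewrite divr_ge0// ltW.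
  rewrite powRM// ?invr_ge0 ?(ltW D0)// -powR_inv1 ?(ltW D0)// powRAC.
  have -> : powR (cq * powR r (n%:R / q)) q = cv * r ^+ n.
    rewrite powRM ?powR_ge0 ?(ltW cq0)// /cq -!powRrM mulVf ?gt_eqF//.
    by rewrite divfK ?gt_eqF// powRr1 ?(ltW cv0)// powR_mulrn ?(ltW r0).
  rewrite powR_inv1 ?(ltW crn)// (EFinM (powR N q)).
  by rewrite lee_pdivlMr.
move: fin; rewrite muleC -lee_pdivlMr// => /le_trans; apply.
rewrite -EFinM lee_fin /b expRN -/E.
have re0 : 0 < powR rho (n%:R * ei) by exact: powR_gt0.
have -> : N / (cq * powR r (n%:R / q)) / (E^-1 * powR rho (n%:R * ei)) =
   E / cq * N * (powR rho (- (n%:R * ei)) * powR r (- (n%:R / q))).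
  by rewrite !powRN; field; rewrite !gt_eqF ?powR_gt0.
have -> : E * B / cq * N * powR r (n%:R / pinf - n%:R / alpha) =
   E / cq * N * (B * powR r (n%:R / pinf - n%:R / alpha)) by ring.
apply: ler_wpM2l; first by rewrite mulr_ge0// divr_ge0 ?(ltW E0)// ltW.
have -> : n%:R / pinf - n%:R / alpha = - (n%:R * ei) + - (n%:R / q).
  by rewrite /ei; ring.
rewrite powRDp// mulrA; apply: ler_wpM2r; first exact: powR_ge0.
rewrite /rho powRM ?(ltW r0)//.
apply: ler_wpM2r; first exact: powR_ge0.
apply: ler_powR; first by ord_lra.
by move: eib; rewrite ler_norml => /andP[]; ord_lra.
Qed.

End Sufficiency.

(** * Contribution of the large scales *)

Section FofanaBound.
Context {R : realType} {n : nat}.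
Implicit Types (x y : n.-tuple R) (f : n.-tuple R -> R).

(** Inserting n/p2 = n/p1 - gamma and gamma = n/alpha - n/beta, the powers of r and rho collapse to
    (r/rho)^(n (1/beta - 1/q)) times the weight at scale rho. The second alternative covers scales
    rho at which the weight at x must be replaced by its value at infinity. *)
Lemma tail_rate_le (gamma s C C2 pinf p2i q alpha beta : R) (p1 p2 : n.-tuple R -> R) :
  admissible gamma s beta C C2 pinf p2i p1 p2 -> 1 <= alpha ->
  gamma = n%:R / alpha - n%:R / beta ->
  forall x (r rho : R), 0 < r -> r < rho ->
  let A := powR r (n%:R * wexp p1 q alpha x) * ball_rate p2i p2 x r *
    (powR rho (gamma - n%:R) * mass_rate pinf p1 x rho) in
  let c := powR (r / rho) (n%:R * (beta^-1 - q^-1)) in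
  A <= powR 4 n%:R * (c * powR rho (n%:R * wexp p1 q alpha x)) \/
  (1 + enorm x < 4 * rho /\
   A * powR rho (n%:R / pinf - n%:R / alpha) <= powR 4 n%:R * (c * powR rho (- (n%:R / q)))).
Proof.
move=> [n0 g0 gn s1 C0 C2p _ _ _ _ sp1 p12 p2b rel _ _ spi pi2 p2ib rel_pi] a1 hg.
move=> x r rho r0 rrho A c.
have rho0 : 0 < rho by exact: lt_trans rrho.
have p1x := sp1 x; have p12x := p12 x; have relx := rel x.
have ub : n%:R / p1 x <= n%:R.
  by rewrite ler_pdivrMr ?ler_peMr//; ord_lra.
have uib : 0 <= n%:R / pinf by rewrite divr_ge0//; ord_lra.
have comp : pinf <= p1 x \/ (n%:R / pinf <= n%:R / p1 x /\ p1 x < pinf).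
  have [h|h] := leP pinf (p1 x); [by left|right; split => //].
  by apply: ler_wpM2l => //; rewrite lef_pV2 ?posrE; ord_lra.
have comp2 : pinf <= p1 x -> n%:R / p1 x <= n%:R / pinf.
  by move=> h; apply: ler_wpM2l => //; rewrite lef_pV2 ?posrE; ord_lra.
have n0R : 0 <= n%:R :> R by [].
have wE : n%:R * wexp p1 q alpha x = n%:R / alpha - n%:R / p1 x - n%:R / q.
  by rewrite /wexp; ring.
have eE : n%:R * (beta^-1 - q^-1) = n%:R / beta - n%:R / q by ring.
have lab : ln r < ln rho by rewrite ltr_ln ?posrE.
have l4 : 0 <= ln 4 :> R by rewrite ln_ge0//; ord_lra.
have lc : ln (r / rho) = ln r - ln rho by rewrite lnM ?posrE ?invr_gt0// lnV ?posrE.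
have far_r : ~~ (4 * r <= 1 + enorm x) -> - ln 4 <= ln r.
  rewrite -ltNge => far; rewrite -lnV ?posrE// ler_ln ?posrE ?invr_gt0//.
  by have := enorm_ge0 x; ord_lra.
have rr0 : 0 < r / rho by rewrite divr_gt0.
rewrite /A /c /ball_rate /mass_rate wE eE.
have key (t u : R) : t <= u -> expR t <= expR u by rewrite ler_expR.
have four : powR 4 n%:R = expR (n%:R * ln 4) :> R by rewrite powR_expR.
have nl4 : 0 <= n%:R * ln 4 :> R by exact: mulr_ge0.
clear sp1 p12 rel p2b C0 C2p.
case: ifPn => nearr; case: ifPn => nearR.
- left; rewrite four !powR_expR// -!expRD lc; apply: key.
  move: nl4 hg relx ub uib lab; clear.
  move: (n%:R * ln 4) (n%:R / alpha) (n%:R / beta) (n%:R / p1 x) (n%:R / p2 x) (n%:R / q).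
  move: (ln r) (ln rho) => a b l al be u u2 qq l0 -> e1 _ _ _.
  have -> : u2 = u - (al - be) by ord_lra.
  ord_lra.
- right; split; first by rewrite ltNge.
  rewrite four !powR_expR// -!expRD lc; apply: key.
  move: nl4 hg relx ub uib lab; clear.
  move: (n%:R * ln 4) (n%:R / alpha) (n%:R / beta) (n%:R / p1 x) (n%:R / p2 x) (n%:R / q).
  move: (n%:R / pinf) (ln r) (ln rho) => ui a b l al be u u2 qq l0 -> e1 _ _ _.
  have -> : u2 = u - (al - be) by ord_lra.
  ord_lra.
- by exfalso; move: nearr; rewrite -ltNge; ord_lra.
- have lr := far_r nearr.
  (* Both scales are large, which leaves a power of exponent n/pinf - n/p1(x). If it is nonnegative,
     it applies to r/rho <= 1 and is dropped; if it is negative, it applies to r > 1/4 and is at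
     most 4^n. *)
  case: comp => [h|[h _]].
    left; rewrite four !powR_expR// -!expRD lc; apply: key.
    have h2 := comp2 h.
    move: nl4 hg relx rel_pi ub uib lab h2; clear.
    move: (n%:R * ln 4) (n%:R / alpha) (n%:R / beta) (n%:R / p1 x) (n%:R / p2 x) (n%:R / q).
    move: (n%:R / pinf) (n%:R / p2i) (ln r) (ln rho) => ui u2i a b l al be u u2 qq l0 -> e1 e2.
    have -> : u2i = ui - (al - be) by ord_lra.
    move=> _ _ ab h2.
    have : 0 <= (b - a) * (ui - u) by apply: mulr_ge0; ord_lra.
    ord_lra.
  right; split; first by rewrite ltNge.
  rewrite four !powR_expR// -!expRD lc; apply: key.
  have h3 : (n%:R / pinf - n%:R / p1 x) * ln r <= n%:R * ln 4.
    apply: (@le_trans _ _ ((n%:R / p1 x - n%:R / pinf) * ln 4)).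
      have : 0 <= (n%:R / p1 x - n%:R / pinf) * (ln r + ln 4) by apply: mulr_ge0; ord_lra.
      ord_lra.
    by apply: ler_wpM2r => //; ord_lra.
  move: h3 hg relx rel_pi; clear.
  move: (n%:R * ln 4) (n%:R / alpha) (n%:R / beta) (n%:R / p1 x) (n%:R / p2 x) (n%:R / q).
  move: (n%:R / pinf) (n%:R / p2i) (ln r) (ln rho) => ui u2i a b l al be u u2 qq h3 -> e1 e2.
  have -> : u2i = ui - (al - be) by ord_lra.
  ord_lra.
Qed.

(* [majorant] collects the two kinds of bounds on the contribution of the scale
   [rho]: by the local norm at [x], or by the global norm [N] when [|x| < 4 rho]. *)
Definition majorant (p : n.-tuple R -> R) (q alpha : R) f (N rho : R) x : \bar R :=
  (wnorm p q alpha f rho x +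
   (powR rho (- (n%:R / q)) * N * ball_ind (4 * rho) (cst_tuple 0) x)%:E)%E.

Lemma majorant_ge0 p q alpha f (N rho : R) x : 0 <= N -> (0 <= majorant p q alpha f N rho x)%E.
Proof.
move=> N0; rewrite adde_ge0 ?wnorm_ge0// lee_fin.
by rewrite !mulr_ge0 ?powR_ge0 ?ball_ind_ge0.
Qed.

Lemma measurable_majorant (p : n.-tuple R -> R) (q alpha : R) f (N rho : R) :
  measurable_fun setT p -> (forall y, 1 <= p y) -> measurable_fun setT f ->
  measurable_fun setT (majorant p q alpha f N rho).
Proof.
move=> mp p1 mf; apply: (emeasurable_funD (f := wnorm p q alpha f rho)
  (g := fun x => (powR rho (- (n%:R / q)) * N * ball_ind (4 * rho) (cst_tuple 0) x)%:E)).
  exact: measurable_wnorm.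
apply/measurable_EFinP; apply: measurable_funM => //.
exact: measurable_ball_ind.
Qed.

(** The factor rho^(-n/q) normalizes the indicator of the ball of radius 4 rho in L^q, which makes
    its contribution independent of rho; 8^n comes from the volume of that ball. *)
Lemma iint_majorant (p : n.-tuple R -> R) (q alpha : R) f (N M rho : R) :
  measurable_fun setT p -> (forall y, 1 <= p y) -> measurable_fun setT f ->
  1 <= q -> 0 <= N -> 0 <= M -> 0 < rho ->
  (iint (fun x => poweR (wnorm p q alpha f rho x) q) <= (powR M q)%:E)%E ->
  (iint (fun x => poweR (majorant p q alpha f N rho x) q) <=
   (powR 2 q * (powR M q + 8 ^+ n * powR N q))%:E)%E.
Proof.
move=> mp p1 mf q1 N0 M0 rho0 hM.
have q0 : 0 < q by exact: lt_le_trans q1.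
pose v x := powR rho (- (n%:R / q)) * N * ball_ind (4 * rho) (cst_tuple 0) x.
have v0 x : 0 <= v x by rewrite !mulr_ge0 ?powR_ge0 ?ball_ind_ge0.
have mv : measurable_fun setT v.
  by apply: measurable_funM => //; exact: measurable_ball_ind.
have rn0 : 0 < rho ^+ n by exact: exprn_gt0.
have vq x : powR (v x) q = (rho ^+ n)^-1 * powR N q * ball_ind (4 * rho) (cst_tuple 0) x.
  rewrite /v powRM ?ball_ind_ge0 ?mulr_ge0 ?powR_ge0//; congr (_ * _); last first.
    by rewrite /ball_ind; case: ifP => _; rewrite ?powR1// powR0// gt_eqF.
  rewrite powRM ?powR_ge0//; congr (_ * _); rewrite -powRrM -powR_mulrn ?(ltW rho0)//.
  by rewrite -powRN; congr powR; rewrite mulNr divfK// gt_eqF.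
have iv : (iint (fun x => (powR (v x) q)%:E) <= (8 ^+ n * powR N q)%:E)%E.
  have k0 : 0 <= (rho ^+ n)^-1 * powR N q by rewrite mulr_ge0 ?powR_ge0// invr_ge0 ltW.
  under eq_iint do rewrite vq EFinM.
  rewrite iintZl ?lee_fin//; last 2 first.
  - by apply/measurable_EFinP; exact: measurable_ball_ind.
  - by move=> x; rewrite lee_fin ball_ind_ge0.
  have r40 : 0 <= 4 * rho by rewrite mulr_ge0// ltW.
  apply: le_trans (lee_wpmul2l _ (iint_ball_le _ r40)) _; first by rewrite lee_fin.
  rewrite -EFinM lee_fin.
  have -> : 2 * (4 * rho) = 8 * rho by ring.
  rewrite exprMn le_eqVlt; apply/orP; left; apply/eqP; field.
  by rewrite gt_eqF.
have mW : measurable_fun setT (fun x => poweR (wnorm p q alpha f rho x) q).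
  by apply: (measurableT_comp (measurable_poweR _)); exact: measurable_wnorm.
have mvq : measurable_fun setT (fun x => (powR (v x) q)%:E).
  by apply/measurable_EFinP; exact: measurable_powR2.
have two0 : 0 <= powR 2 q :> R by exact: powR_ge0.
have pv x : (0 <= (powR (v x) q)%:E)%E by rewrite lee_fin powR_ge0.
have [_ _ hlin] := iint_lin_le mW mvq (fun x => poweR_ge0 _ _) pv two0 two0 hM iv.
rewrite mulrDr; apply: le_trans hlin; apply: le_iint => x; first exact: poweR_ge0.
rewrite -ge0_muleDr ?poweR_ge0//.
by apply: poweRD_le; [exact: ltW|exact: wnorm_ge0|rewrite lee_fin; exact: v0].
Qed.

Lemma tail_term_le (K1 K2 gamma s C C2 pinf p2i q alpha beta : R) (p1 p2 : n.-tuple R -> R) :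
  admissible gamma s beta C C2 pinf p2i p1 p2 -> 1 <= alpha ->
  gamma = n%:R / alpha - n%:R / beta -> 0 <= K1 -> 0 <= K2 ->
  forall f x (N r rho : R), 0 <= N -> 0 < r -> r < rho ->
  (mass (fun y => `|f y|%R) x (2 * rho)%R <=
    (K1 * mass_rate pinf p1 x rho)%:E * grid_norm p1 f x (2 * rho)%R)%E ->
  (1 + enorm x < 4 * rho -> (grid_norm p1 f x (2 * rho)%R <=
    (K2 * N * powR rho (n%:R / pinf - n%:R / alpha))%:E)%E) ->
  ((powR r (n%:R * wexp p1 q alpha x) * ball_rate p2i p2 x r)%:E *
    ((powR rho (gamma - n%:R))%:E * mass (fun y => `|f y|%R) x (2 * rho)%R) <=
   (powR 4 n%:R * K1 * (1 + K2))%:E * ((powR (r / rho) (n%:R * (beta^-1 - q^-1)))%:E *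
     majorant p1 q alpha f N rho x))%E.
Proof.
move=> adm a1 hg K10 K20 f x N r rho N0 r0 rrho hm hfar.
have rho0 : 0 < rho by exact: lt_trans rrho.
have := tail_rate_le q adm a1 hg x r0 rrho.
set w := powR r _ * ball_rate _ _ _ _; set c := powR (r / rho) _.
set F := powR 4 n%:R; pose g := grid_norm p1 f x (2 * rho).
have w0 : 0 <= w by apply: mulr_ge0; [exact: powR_ge0|apply/ltW/ball_rate_gt0].
have c0 : 0 <= c by exact: powR_ge0.
have F0 : 0 <= F by exact: powR_ge0.
have G0 : (0 <= g)%E by exact: grid_norm_ge0.
have z0 : 0 <= powR rho (gamma - n%:R) by exact: powR_ge0.
have mr0 : 0 <= mass_rate pinf p1 x rho by apply/ltW/mass_rate_gt0.
have FK0 : 0 <= F * K1 * (1 + K2) by rewrite !mulr_ge0// addr_ge0.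
set A := w * (powR rho (gamma - n%:R) * mass_rate pinf p1 x rho).
have A0 : 0 <= A by apply: mulr_ge0 => //; exact: mulr_ge0.
have lhs : (w%:E * ((powR rho (gamma - n%:R))%:E * mass (fun y => `|f y|%R) x (2 * rho)%R) <=
    (K1 * A)%:E * g)%E.
  have wz0 : (0 <= (powR rho (gamma - n%:R))%:E)%E by rewrite lee_fin.
  apply: le_trans (lee_wpmul2l _ (lee_wpmul2l wz0 hm)) _; first by rewrite lee_fin.
  rewrite !muleA -!EFinM; apply: lee_wpmul2r => //; rewrite lee_fin /A.
  by rewrite le_eqVlt; apply/orP; left; apply/eqP; ring.
move=> h; apply: le_trans lhs _.
have W0 := wnorm_ge0 p1 q alpha f rho x.
have u0 : 0 <= powR rho (- (n%:R / q)) * N * ball_ind (4 * rho) (cst_tuple 0) x.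
  by rewrite !mulr_ge0 ?powR_ge0 ?ball_ind_ge0.
case: h => [hA|[far hA]].
  apply: (@le_trans _ _ ((F * K1 * (1 + K2))%:E * (c%:E * wnorm p1 q alpha f rho x))%E).
    rewrite /wnorm -/g !muleA -!EFinM; apply: lee_wpmul2r => //; rewrite lee_fin.
    apply: le_trans (ler_wpM2l K10 hA) _.
    rewrite [leRHS](_ : _ = K1 * (F * (c * powR rho (n%:R * wexp p1 q alpha x))) * (1 + K2)); last by ring.
    by apply: ler_peMr; rewrite ?lerDl// !mulr_ge0 ?powR_ge0.
  apply: lee_wpmul2l; first by rewrite lee_fin.
  apply: lee_wpmul2l; first by rewrite lee_fin.
  by rewrite /majorant leeDl// lee_fin.
apply: (@le_trans _ _ ((K1 * A)%:E * (K2 * N * powR rho (n%:R / pinf - n%:R / alpha))%:E)%E).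
  by apply: lee_wpmul2l; [rewrite lee_fin mulr_ge0|exact: hfar].
apply: (@le_trans _ _ ((F * K1 * (1 + K2))%:E * (c%:E *
    (powR rho (- (n%:R / q)) * N * ball_ind (4 * rho) (cst_tuple 0) x)%:E))%E).
  have -> : ball_ind (4 * rho) (cst_tuple 0) x = 1.
    rewrite ball_indC /ball_ind edist_cst_tuple0 ifT//.
    by move: far; clear; ord_lra.
  rewrite -!EFinM lee_fin mulr1.
  have -> : K1 * A * (K2 * N * powR rho (n%:R / pinf - n%:R / alpha)) =
     K1 * K2 * N * (A * powR rho (n%:R / pinf - n%:R / alpha)) by ring.
  have kn0 : 0 <= K1 * K2 * N by rewrite !mulr_ge0.
  apply: le_trans (ler_wpM2l kn0 hA) _.
  have P0 : 0 <= F * K1 * (c * (powR rho (- (n%:R / q)) * N)).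
    by rewrite !mulr_ge0 ?powR_ge0.
  have -> : K1 * K2 * N * (F * (c * powR rho (- (n%:R / q)))) =
     K2 * (F * K1 * (c * (powR rho (- (n%:R / q)) * N))) by ring.
  have -> : F * K1 * (1 + K2) * (c * (powR rho (- (n%:R / q)) * N)) =
     (1 + K2) * (F * K1 * (c * (powR rho (- (n%:R / q)) * N))) by ring.
  by apply: ler_wpM2r => //; rewrite lerDr.
apply: lee_wpmul2l; first by rewrite lee_fin.
apply: lee_wpmul2l; first by rewrite lee_fin.
by rewrite /majorant leeDr.
Qed.

End FofanaBound.

(** * The bound between Fofana spaces *)

Section FofanaTheorem.
Context {R : realType} {n : nat}.
Implicit Types (x y : n.-tuple R) (f : n.-tuple R -> R).

Definition scale_weight (dl r : R) (i : nat) : R :=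
  if r < erad i then powR (r / erad i) dl else 0.

Lemma scale_weight_ge0 dl r i : 0 <= scale_weight dl r i.
Proof. by rewrite /scale_weight; case: ifP => // _; exact: powR_ge0. Qed.

Lemma series_scale_weight (dl : R) : 0 < dl -> exists2 C : R, 0 <= C &
  forall r, 0 < r -> (\sum_(i <oo) (scale_weight dl r i)%:E <= C%:E)%E.
Proof.
move=> d0; have [C C0 hC] := series_kap (@ltr01 R) d0.
exists C => // r r0; have ri0 : 0 < r^-1 by rewrite invr_gt0.
apply: le_trans (hC _ ri0); apply: le_nneseries => i.
  by rewrite lee_fin scale_weight_ge0.
rewrite lee_fin /scale_weight; case: ifPn => [h|_]; last exact: kap_ge0.
have e0 : 0 < erad i :> R := erad_gt0 i.
rewrite powRr1 ?(ltW e0)//.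
have -> : powR (r / erad i) dl = powR (erad i * r^-1) (- dl).
  rewrite !powR_expR ?divr_gt0// !lnM ?posrE ?invr_gt0// !lnV ?posrE//.
  by congr expR; ring.
by apply: powRN_le_kap; rewrite ?(ltW d0)// ler_pdivlMr// mul1r ltW.
Qed.

Lemma iint_series_majorant (c : nat -> R) (Ck B : R) (p : n.-tuple R -> R)
    (q alpha N : R) f :
  measurable_fun setT p -> (forall y, 1 <= p y) -> measurable_fun setT f -> 0 <= N -> 0 <= B ->
  (forall i, 0 <= c i) -> (\sum_(i <oo) (c i)%:E <= Ck%:E)%E ->
  (forall i, iint (fun x => poweR (majorant p q alpha f N (erad i) x) q) <= B%:E)%E ->
  let S x := (\sum_(i <oo) ((c i)%:E * poweR (majorant p q alpha f N (erad i) x) q))%E in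
  [/\ measurable_fun setT S, (forall x, 0 <= S x)%E & (iint S <= (Ck * B)%:E)%E].
Proof.
move=> mp p1 mf N0 B0 c0 hc hB S.
have t0 i x : (0 <= (c i)%:E * poweR (majorant p q alpha f N (erad i) x) q)%E.
  by rewrite mule_ge0 ?poweR_ge0// lee_fin.
have mQ i : measurable_fun setT (fun x => poweR (majorant p q alpha f N (erad i) x) q).
  by apply: (measurableT_comp (measurable_poweR _)); exact: measurable_majorant.
have mt i : measurable_fun setT
    (fun x => (c i)%:E * poweR (majorant p q alpha f N (erad i) x) q)%E.
  exact: measurable_funeM.
split.
- exact: measurable_nneseries.
- by move=> x; apply: nneseries_ge0 => i _ _.
rewrite /S iint_nneseries//.
apply: (@le_trans _ _ (\sum_(i <oo) (B%:E * (c i)%:E))%E).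
  apply: le_nneseries => i; first exact: iint_ge0.
  rewrite iintZl ?lee_fin//; last by move=> x; exact: poweR_ge0.
  by rewrite muleC; apply: lee_wpmul2r; rewrite ?lee_fin.
rewrite nneseriesZl; last by move=> i _; rewrite lee_fin.
by rewrite mulrC EFinM; apply: lee_wpmul2l; rewrite ?lee_fin.
Qed.

Lemma frac_int_pointwise (gamma s C C2 pinf p2i q alpha beta : R)
    (p1 p2 : n.-tuple R -> R) :
  admissible gamma s beta C C2 pinf p2i p1 p2 -> 1 <= q -> 1 <= alpha -> 1 <= beta ->
  gamma = n%:R / alpha - n%:R / beta ->
  exists2 K : R, 0 < K & forall f (N : R), measurable_fun setT f -> 0 <= N ->
  (forall r : R, 0 < r ->
    (iint (fun x => poweR (wnorm p1 q alpha f r x) q) <= (powR N q)%:E)%E) ->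
  forall x (r : R), 0 < r ->
  ((powR (fine (lebn (eball x r))) (beta^-1 - (p2 x)^-1 - q^-1))%:E
        * lux_norm p2 (restr (frac_int gamma f) x r) <=
   K%:E * (wnorm p1 q alpha f r x + \sum_(i <oo)
     ((scale_weight (n%:R * (beta^-1 - q^-1)) r i)%:E * majorant p1 q alpha f N (erad i) x)))%E.
Proof.
move=> adm q1 a1 b1 hg.
have [Kw Kw1 hw] := @weight_bounds R n 3 (ler0n _ _).
have [K1 K10 hK1] := mass_le_rate adm.
have [Kf Kf0 hKf] := frac_int_ball_norm adm.
have [K4 K40 hK4] := far_norm_le adm q1 a1.
pose Kt := powR 4 n%:R * K1 * (1 + K4).
have Kt0 : 0 <= Kt by rewrite !mulr_ge0 ?powR_ge0 ?addr_ge0 ?(ltW K10) ?(ltW K40).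
have Kw0 : 0 < Kw by ord_lra.
exists (Kw * Kf * (1 + Kt)); first by rewrite !mulr_gt0// ltr_pwDl.
move=> f N mf N0 hN x r r0.
set e := wexp p1 q alpha x.
(* The relation between gamma, alpha and beta enters here: source and target space have the same
   weight at every point. *)
have eE : beta^-1 - (p2 x)^-1 - q^-1 = e.
  have := adm_rel adm x; have n0R : 0 < n%:R :> R by rewrite ltr0n (adm_n adm).
  rewrite hg => h.
  have : n%:R * (beta^-1 - (p2 x)^-1) = n%:R * (alpha^-1 - (p1 x)^-1).
    by move: h; rewrite !mulrBr => h; clear -h; ord_lra.
  by move/(mulfI (lt0r_neq0 n0R)) => ->.
have p11 y : 1 <= p1 y by have := adm_s adm; have := adm_s_le adm y; ord_lra.
have eb : `|e| <= 3 by exact: wexp_bound.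
have [w1 _] := hw x r e r0 eb.
rewrite eE.
have L0 := lux_norm_ge0 p2 (restr (frac_int gamma f) x r).
have G0 := grid_norm_ge0 p1 f x (2 * r).
have X0 := ltW (ball_rate_gt0 p2i p2 x r0).
have T0 : (0 <= tail_sum gamma f x r)%E.
  apply: nneseries_ge0 => i _ _; case: ifP => // _.
  by rewrite mule_ge0 ?mass_ge0// lee_fin powR_ge0.
set dl := n%:R * (beta^-1 - q^-1).
set S := (\sum_(i <oo) _)%E.
have Q0 i : (0 <= majorant p1 q alpha f N (erad i) x)%E by exact: majorant_ge0.
have S0 : (0 <= S)%E.
  apply: nneseries_ge0 => i _ _; rewrite mule_ge0// lee_fin.
  exact: scale_weight_ge0.
have re0 : 0 <= powR r (n%:R * e) by exact: powR_ge0.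
have tail : ((powR r (n%:R * e) * ball_rate p2i p2 x r)%:E * tail_sum gamma f x r <=
    Kt%:E * S)%E.
  rewrite /tail_sum -nneseriesZl; last first.
    by move=> i _; case: ifP => // _; rewrite mule_ge0 ?mass_ge0// lee_fin powR_ge0.
  rewrite /S -nneseriesZl; last first.
    by move=> i _; rewrite mule_ge0// lee_fin scale_weight_ge0.
  apply: le_nneseries => i.
    rewrite mule_ge0 ?lee_fin ?mulr_ge0//; case: ifP => // _.
    by rewrite mule_ge0 ?mass_ge0// lee_fin powR_ge0.
  rewrite /scale_weight; case: ifPn => [ri|_]; last first.
    by rewrite mule0 mul0e mule0.
  have i0 : 0 < erad i :> R := erad_gt0 i.
  refine (@tail_term_le _ _ K1 K4 gamma s C C2 pinf p2i q alpha beta p1 p2 adm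
    a1 hg (ltW K10) (ltW K40) f x N r (erad i) N0 r0 ri _ _).
    apply: grid_norm_lb; first by rewrite mulr_gt0// mass_rate_gt0.
    by move=> lam l0 hl; exact: hK1.
  by move=> far; exact: hK4.
apply: (@le_trans _ _ ((Kw * powR r (n%:R * e))%:E * (Kf%:E *
   (grid_norm p1 f x (2 * r)%R + (ball_rate p2i p2 x r)%:E * tail_sum gamma f x r)))%E).
  by apply: lee_pmul => //; [rewrite lee_fin powR_ge0|exact: hKf].
have rew : ((Kw * powR r (n%:R * e))%:E * (Kf%:E *
   (grid_norm p1 f x (2 * r)%R + (ball_rate p2i p2 x r)%:E * tail_sum gamma f x r)) =
   (Kw * Kf)%:E * (wnorm p1 q alpha f r x +
     (powR r (n%:R * e) * ball_rate p2i p2 x r)%:E * tail_sum gamma f x r))%E.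
  rewrite /wnorm -/e [(powR r (n%:R * e) * ball_rate p2i p2 x r)%:E]EFinM -muleA.
  rewrite -ge0_muleDr//; last by rewrite mule_ge0.
  by rewrite !muleA -!EFinM; congr ((_)%:E * _)%E; ring.
rewrite rew (EFinM (Kw * Kf) (1 + Kt)) -[X in (_ <= X)%E]muleA; apply: lee_wpmul2l.
  by rewrite lee_fin mulr_ge0// ltW.
have W0 := wnorm_ge0 p1 q alpha f r x.
apply: le_trans (leeD2l _ tail) _.
rewrite EFinD ge0_muleDl ?lee_fin// mul1e; apply: leeD; first by rewrite leeDl.
by apply: lee_wpmul2l; rewrite ?lee_fin// leeDr.
Qed.

(** For each radius r the pointwise majorant is measurable and may be split. The weights of the
    scales above r have a total bounded independently of r, so Jensen's inequality reduces their sum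
    to the bounds in L^q at single scales. *)
Theorem fofana_bound (gamma s C C2 pinf p2i q alpha beta : R) (p1 p2 : n.-tuple R -> R) :
  admissible gamma s beta C C2 pinf p2i p1 p2 -> 1 <= q -> 1 <= alpha -> 1 <= beta ->
  beta < q -> gamma = n%:R / alpha - n%:R / beta ->
  exists2 K : R, 0 <= K & forall f (N : R), measurable_fun setT f -> 0 <= N ->
  (fofana_norm p1 q alpha (fun x => (f x)%:E) <= N%:E)%E ->
  (fofana_norm p2 q beta (frac_int gamma f) <= (K * N)%:E)%E.
Proof.
move=> adm q1 a1 b1 bq hg.
have p11 y : 1 <= p1 y by have := adm_s adm; have := adm_s_le adm y; ord_lra.
have n0R : 0 < n%:R :> R by rewrite ltr0n (adm_n adm).
have q0 : 0 < q by ord_lra.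
have [K3 K30 hK3] := @iint_wnorm R n p1 q alpha p11 q1 a1.
have [KA KA0 hKA] := frac_int_pointwise adm q1 a1 b1 hg.
pose dl := n%:R * (beta^-1 - q^-1).
have dl0 : 0 < dl by rewrite mulr_gt0// subr_gt0 ltf_pV2 ?posrE; ord_lra.
have [Ck Ck0 hCk] := series_scale_weight dl0.
pose B0 := powR 2 q * (1 + 8 ^+ n).
pose Z := powR KA q * (powR 2 q * 1 + (powR 2 q * powR (Ck + 1) q) * (Ck * B0)).
have B00 : 0 <= B0 by rewrite mulr_ge0 ?powR_ge0// addr_ge0// exprn_ge0.
have Z0 : 0 <= Z.
  by rewrite /Z mulr_ge0 ?powR_ge0// addr_ge0 ?mulr_ge0 ?powR_ge0.
exists (powR Z q^-1 * K3); first by rewrite mulr_ge0 ?powR_ge0// ltW.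
move=> f N0' mf N00 hN; pose N := K3 * N0'.
have N0 : 0 <= N by rewrite mulr_ge0// ltW.
have hW := hK3 f N0' N00 hN.
rewrite -mulrA -/N; apply: ge_ereal_sup => _ [r r0 <-]; rewrite /= in r0.
set h := (fun x : n.-tuple R => _).
have h0 x : (0 <= h x)%E by rewrite mule_ge0 ?lux_norm_ge0// lee_fin powR_ge0.
rewrite /Lq_norm.
have qi : 0 <= q^-1 by rewrite invr_ge0 ltW.
suff main : (iint (fun x => poweR `|h x|%E q) <= (Z * powR N q)%:E)%E.
  apply: le_trans (le_poweR qi _ main) _.
    by apply: iint_ge0 => x; exact: poweR_ge0.
  rewrite poweR_EFin lee_fin powRM ?powR_ge0// -[powR (powR N q) _]powRrM mulfV ?gt_eqF//.
  by rewrite powRr1.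
pose c := scale_weight dl r.
have c0 i : 0 <= c i by exact: scale_weight_ge0.
pose Q i x := majorant p1 q alpha f N (erad i) x.
have Q0 i x : (0 <= Q i x)%E by exact: majorant_ge0.
have NB : 0 <= B0 * powR N q by rewrite mulr_ge0 ?powR_ge0.
have hQ i : (iint (fun x => poweR (Q i x) q) <= (B0 * powR N q)%:E)%E.
  apply: le_trans (iint_majorant (adm_m1 adm) p11 mf q1 N0 N0 (erad_gt0 i) (hW _ (erad_gt0 i))) _.
  by rewrite lee_fin /B0 le_eqVlt; apply/orP; left; apply/eqP; ring.
have [mS S0 iS] := iint_series_majorant (adm_m1 adm) p11 mf N0 NB c0 (hCk r r0) hQ.
set S := (fun x => \sum_(i <oo) _)%E in mS S0 iS.
have mW : measurable_fun setT (fun x => poweR (wnorm p1 q alpha f r x) q).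
  apply: (measurableT_comp (measurable_poweR _)).
  by apply: measurable_wnorm => //; exact: (adm_m1 adm).
have k1 : 0 <= powR 2 q :> R by exact: powR_ge0.
have k2 : 0 <= powR 2 q * powR (Ck + 1) q by rewrite mulr_ge0 ?powR_ge0.
have [mF F0 iF] := iint_lin_le mW mS (fun x => poweR_ge0 _ _) S0 k1 k2 (hW r r0) iS.
apply: (@le_trans _ _ ((powR KA q)%:E * (powR 2 q * powR N q +
   (powR 2 q * powR (Ck + 1) q) * (Ck * (B0 * powR N q)))%:E)%E); last first.
  by rewrite -EFinM lee_fin /Z le_eqVlt; apply/orP; left; apply/eqP; ring.
apply: le_trans (lee_wpmul2l _ iF); last by rewrite lee_fin powR_ge0.
rewrite -iintZl ?lee_fin ?powR_ge0//.
apply: le_iint => x; first exact: poweR_ge0.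
rewrite gee0_abs//.
apply: le_trans (le_poweR (ltW q0) (h0 x) (hKA f N mf N0 hW x r r0)) _.
set W := wnorm _ _ _ _ _ _; set T := (\sum_(i <oo) _)%E.
have W0 : (0 <= W)%E by exact: wnorm_ge0.
have T0 : (0 <= T)%E.
  by apply: nneseries_ge0 => i _ _; rewrite mule_ge0 ?lee_fin ?scale_weight_ge0 ?majorant_ge0.
rewrite poweRM ?adde_ge0 ?lee_fin ?(ltW KA0)//.
apply: lee_wpmul2l; first by rewrite lee_fin powR_ge0.
apply: le_trans (poweRD_le (ltW q0) W0 T0) _.
rewrite ge0_muleDr ?poweR_ge0//; apply: leeD2l.
rewrite (EFinM (powR 2 q)) -muleA; apply: lee_wpmul2l; first by rewrite lee_fin.
exact: (series_jensen (Q := fun i => Q i x) q1 Ck0 c0 (fun i => Q0 i x) (hCk r r0)).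
Qed.

(** If the norm over B(x, r) were infinite, so would be the one over B(y, 2 r) for all y in B(x, r);
    the integrand of the Fofana norm at radius 2 r would be infinite on a set of positive
    measure. *)
Lemma frac_int_Lp_loc (gamma q beta : R) (p2 : n.-tuple R -> R) f (N : R) : 0 < q ->
  (forall y, 0 <= p2 y) -> (fofana_norm p2 q beta (frac_int gamma f) <= N%:E)%E ->
  Lp_loc p2 (frac_int gamma f).
Proof.
move=> q0 p0 hN x r r0.
have [//|] := ltP (lux_norm p2 (restr (frac_int gamma f) x r)) +oo%E.
rewrite leye_eq => /eqP inf.
pose h y := ((powR (fine (lebn (eball y (2 * r)))) (beta^-1 - (p2 y)^-1 - q^-1))%:E
        * lux_norm p2 (restr (frac_int gamma f) y (2 * r)%R))%E.
have r20 : 0 < 2 * r by ord_lra.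
have hy y : edist x y < r -> h y = +oo%E.
  move=> xy; have li : lux_norm p2 (restr (frac_int gamma f) y (2 * r)) = +oo%E.
    apply/eqP; rewrite -leye_eq -inf; apply: le_lux_norm => //.
    by apply: le_restr; ord_lra.
  rewrite /h li gt0_muley// lte_fin powR_gt0// lebn_eball.
  have v1 := iint_ball_ge y r20; have v2 := iint_ball_le y (ltW r20).
  have vp : 0 < (2 * (2 * r / n.+1%:R)) ^+ n by rewrite exprn_gt0 ?mulr_gt0 ?divr_gt0.
  rewrite fine_gt0//; apply/andP; split; first by apply: lt_le_trans v1; rewrite lte_fin.
  by apply: le_lt_trans v2 (ltry _).
have big : (iint (fun y => poweR `|h y|%E q) = +oo)%E.
  apply/eqP; rewrite -leye_eq.
  have b := iint_ball_ge x r0.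
  have vp : 0 < (2 * (r / n.+1%:R)) ^+ n by rewrite exprn_gt0 ?mulr_gt0 ?divr_gt0.
  apply: (@le_trans _ _ (+oo * iint (fun y => (ball_ind r x y)%:E))%E).
    by rewrite gt0_mulye//; apply: lt_le_trans b; rewrite lte_fin.
  rewrite -iintZl//.
  - apply: le_iint => y; first by rewrite mule_ge0// lee_fin ball_ind_ge0.
    rewrite /ball_ind; case: ifPn => hb; last by rewrite mule0 poweR_ge0.
    by rewrite hy// mule1/= gt_eqF.
  - by apply/measurable_EFinP; exact: measurable_ball_ind.
  - by move=> y; rewrite lee_fin ball_ind_ge0.
have : (Lq_norm q h <= N%:E)%E.
  by apply: le_trans hN; apply: ereal_sup_ubound; exists (2 * r).
by rewrite /Lq_norm big poweRyr ?leye_eq// invr_eq0 gt_eqF.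
Qed.

End FofanaTheorem.

(** * Indicators of balls and their fractional integrals *)

Section TestFunction.
Context {R : realType} {n : nat}.
Implicit Types (x y : n.-tuple R) (p : n.-tuple R -> R).

Lemma iint0 : iint (fun _ : n.-tuple R => 0%E) = 0%E.
Proof.
transitivity (0%:E * iint (fun _ : n.-tuple R => 0%:E))%E; last by rewrite mul0e.
by rewrite -iintZl//; apply: eq_iint => y; rewrite mule0.
Qed.

Lemma powR_osc_inv (C c : R) p x y (r : R) : 0 < C -> (forall z, 1 <= p z) ->
  log_holder C p -> 0 < r -> 4 * r <= 1 + enorm x -> edist x y < 2 * r ->
  powR r (c * ((p x)^-1 - (p y)^-1)) <= expR (`|c| * (4 * C)).
Proof.
move=> C0 p1 hp r0 near xy; have px := p1 x; have py := p1 y.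
have -> : c * ((p x)^-1 - (p y)^-1) = c / (p x * p y) * (p y - p x).
  by field; rewrite !gt_eqF//; ord_lra.
apply: le_trans (powR_osc _ C0 hp r0 near xy) _; rewrite ler_expR.
have pp : 1 <= p x * p y by rewrite -[leLHS]mulr1; apply: ler_pM.
apply: ler_wpM2r; first by ord_lra.
rewrite normrM (@ger0_norm _ (p x * p y)^-1); last by rewrite invr_ge0; ord_lra.
by rewrite ler_piMr// invf_le1; ord_lra.
Qed.

Lemma lux_near_ball (C : R) p : 0 < C -> (forall z, 1 <= p z) -> log_holder C p ->
  exists2 K : R, 1 <= K & forall x (r : R) (g : n.-tuple R -> \bar R), 0 < r ->
  4 * r <= 1 + enorm x -> (forall y, `|g y| <= (ball_ind r x y)%:E)%E ->
  (lux_norm p g <= (K * powR r (n%:R / p x))%:E)%E.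
Proof.
move=> C0 p1 hp; have [K K1 hK] := near_ball_modular C0 p1 hp.
exists K => // x r g r0 near hg.
have L0 : 0 < K * powR r (n%:R / p x) by rewrite mulr_gt0 ?powR_gt0//; ord_lra.
apply: lux_norm_le => //; apply: le_trans (hK x r _ r0 near (lexx _)).
apply: le_iint => y; first exact: poweR_ge0.
rewrite -poweR_EFin EFinM; apply: le_poweR; first by have := p1 y; ord_lra.
  by rewrite mule_ge0// lee_fin invr_ge0 ltW.
by apply: lee_wpmul2r => //; rewrite lee_fin invr_ge0 ltW.
Qed.

(** On the test ball the kernel is at least (2 rho)^(gamma - n), except at the point x itself, where
    it is 0 by convention. A small ball around x is therefore left out, its volume being added to
    the other side. *)
Lemma frac_int_ball_ge (gamma : R) : (0 < n)%N -> gamma < n%:R ->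
  exists2 c : R, 0 < c & forall x0 (rho : R) x, 0 < rho -> edist x0 x < rho ->
  ((c * powR rho gamma)%:E <= frac_int gamma (ball_ind rho x0) x)%E.
Proof.
move=> n0 gn; pose c := powR 2 (gamma - n%:R) * (2^-1 * (2 / n.+1%:R) ^+ n) : R.
have v0 : 0 < (2 / n.+1%:R) ^+ n :> R by rewrite exprn_gt0 ?divr_gt0.
exists c => [|x0 rho x r0 hx]; first by rewrite !mulr_gt0 ?powR_gt0.
rewrite /frac_int [X in (_ - X)%E](_ : _ = 0)%E; last first.
  rewrite -iint0; apply: eq_iint => y.
  by rewrite max_r ?mul0r// oppr_le0 ball_ind_ge0.
rewrite sube0; set J := iint _.
pose k := powR (2 * rho) (gamma - n%:R).
have k0 : 0 < k by rewrite powR_gt0 ?mulr_gt0.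
(* Half of the half side of the cube used to bound the volume of the test ball from below: since n
   >= 1, the excluded ball takes away at most half of that bound. *)
pose dl := rho / (2 * n.+1%:R).
have dl0 : 0 < dl by rewrite divr_gt0 ?mulr_gt0.
have J0 : (0 <= J)%E.
  by apply: iint_ge0 => y; rewrite lee_fin mulr_ge0 ?powR_ge0// le_max lexx orbT.
have mb r z : measurable_fun setT (fun y : n.-tuple R => (ball_ind r z y)%:E).
  by apply/measurable_EFinP; exact: measurable_ball_ind.
have b0 r z y : (0 <= (ball_ind r z y)%:E)%E by rewrite lee_fin ball_ind_ge0.
have up : (k%:E * iint (fun y => (ball_ind rho x0 y)%:E) <=
    J + k%:E * iint (fun y => (ball_ind dl x y)%:E))%E.
  rewrite -!iintZl ?lee_fin ?(ltW k0)//.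
  rewrite /J -iintD.
  - apply: le_iint => y; first by rewrite mule_ge0// lee_fin ltW.
    rewrite -!EFinM -EFinD lee_fin max_l ?ball_ind_ge0//.
    rewrite {1}/ball_ind; case: ifPn => hy; last first.
      rewrite mulr0 addr_ge0 ?mulr_ge0 ?powR_ge0 ?ball_ind_ge0//; exact: ltW.
    rewrite /ball_ind hy mulr1 mul1r; case: ifPn => hd.
      by rewrite mulr1 lerDr powR_ge0.
    rewrite mulr0 addr0 /k.
    have d0 : 0 < edist x y by apply: lt_le_trans dl0 _; rewrite leNgt.
    rewrite -opprB !powRN lef_pV2 ?posrE ?powR_gt0 ?mulr_gt0//.
    apply: ge0_ler_powR; rewrite ?nnegrE ?(ltW d0) ?mulr_ge0 ?(ltW r0)//; first by ord_lra.
    by have := eudist_triangle x0 x y; rewrite (eudistC x x0); ord_lra.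
  - apply/measurable_EFinP; apply: measurable_funM.
      by apply: measurable_maxr => //; exact: measurable_ball_ind.
    apply: measurable_powR2 => //; exact: measurable_edist.
  - by apply: measurable_funeM.
  - by move=> y; rewrite lee_fin mulr_ge0 ?powR_ge0// le_max lexx orbT.
  - by move=> y; rewrite mule_ge0// lee_fin ltW.
have lo := iint_ball_ge x0 r0.
have hi := iint_ball_le x (ltW dl0).
have {lo hi up} fin : ((k * (2 * (rho / n.+1%:R)) ^+ n)%:E <= J + (k * (2 * dl) ^+ n)%:E)%E.
  rewrite !EFinM; apply: le_trans (lee_wpmul2l _ lo) _; first by rewrite lee_fin ltW.
  by apply: le_trans up _; apply: leeD2l; apply: lee_wpmul2l; rewrite // lee_fin ltW.
have e1 : k * (2 * (rho / n.+1%:R)) ^+ n = 2 * (c * powR rho gamma).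
  have -> : powR rho gamma = powR rho (gamma - n%:R) * rho ^+ n.
    by rewrite -powR_mulrn ?(ltW r0)// -powRDp//; congr powR; ring.
  rewrite /k /c powRM ?(ltW r0)// (_ : 2 * (rho / n.+1%:R) = (2 / n.+1%:R) * rho); last by ring.
  by rewrite exprMn; field.
have e2 : k * (2 * dl) ^+ n <= c * powR rho gamma.
  rewrite -(@ler_pM2l _ 2)// -e1 mulrCA; apply: ler_wpM2l; first exact: ltW.
  have -> : 2 * (rho / n.+1%:R) = 2 * (2 * dl).
    have : n.+1%:R != 0 :> R by rewrite pnatr_eq0.
    by rewrite /dl; move: (n.+1%:R : R) => m m0; field.
  rewrite [leRHS]exprMn; apply: ler_wpM2r; first by rewrite exprn_ge0 ?mulr_ge0 ?ltW.
  have two1 : 1 <= 2 :> R by ord_lra.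
  by rewrite -[leLHS]expr1; apply: ler_weXn2l.
move: fin; rewrite e1; move: J0 e2; case: J => [j| |]//; last by move=> *; rewrite leey.
by rewrite -!EFinD !lee_fin => *; ord_lra.
Qed.

End TestFunction.

(** * Lower bound for the fractional integral of an indicator *)

Section LowerBound.
Context {R : realType} {n : nat}.
Implicit Types (x y : n.-tuple R) (p : n.-tuple R -> R).

(** For a level below the asserted bound, the integrand of the modular is at least k r^(-n) / E on
    the ball, by freezing the exponent; [k] is chosen so that the integral k v / E exceeds 1. *)
Lemma lux_ball_ge (C : R) p : 0 < C -> (forall z, 1 <= p z) -> log_holder C p ->
  exists2 c : R, 0 < c & forall x (r t : R) (g : n.-tuple R -> \bar R), 0 < r -> 0 < t ->
  4 * r <= 1 + enorm x -> (forall y, ((t * ball_ind r x y)%:E <= `|g y|)%E) ->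
  ((c * t * powR r (n%:R / p x))%:E <= lux_norm p g)%E.
Proof.
move=> C0 p1 hp; pose E := expR (n%:R * (4 * C)).
have E0 : 0 < E by exact: expR_gt0.
pose v : R := (2 / n.+1%:R) ^+ n.
have v0 : 0 < v by rewrite exprn_gt0// divr_gt0.
pose k := 1 + E / v.
have k1 : 1 <= k by rewrite lerDl divr_ge0// ltW.
have k0 : 0 < k by ord_lra.
exists k^-1 => [|x r t g r0 t0 near hg]; first by rewrite invr_gt0.
set w := powR r (n%:R / p x); have w0 : 0 < w by exact: powR_gt0.
apply/ereal_infP => _ [lam [l0 hl] <-]; rewrite lee_fin leNgt; apply/negP => small.
move: hl; rewrite leNgt => /negP; apply.
have rn0 : 0 < r ^+ n by rewrite exprn_gt0.
have a0 : 0 <= k / (E * r ^+ n) by rewrite divr_ge0 ?mulr_ge0// ltW.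
apply: (@lt_le_trans _ _ ((k / (E * r ^+ n))%:E * iint (fun y => (ball_ind r x y)%:E))%E).
  apply: lt_le_trans (lee_wpmul2l _ (iint_ball_ge x r0)); last by rewrite lee_fin.
  rewrite -EFinM lte_fin mulrA (mulrAC 2) exprMn -/v.
  rewrite [ltRHS](_ : _ = k * v / E); last by field; rewrite !gt_eqF.
  by rewrite ltr_pdivlMr// mul1r /k mulrDl divfK ?gt_eqF// mul1r ltrDr.
rewrite -iintZl ?lee_fin//; last 2 first.
- by apply/measurable_EFinP; exact: measurable_ball_ind.
- by move=> y; rewrite lee_fin ball_ind_ge0.
apply: le_iint => y; first by rewrite mule_ge0// lee_fin ball_ind_ge0.
have py := p1 y; have px := p1 x.
have [xy|nxy] := boolP (edist x y < r); last first.
  by rewrite /ball_ind (negbTE nxy) mule0 poweR_ge0.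
have := hg y; rewrite {1}/ball_ind xy mulr1 => {}hg.
apply: (@le_trans _ _ (poweR (k / w)%:E (p y))); last first.
  apply: le_poweR; first by ord_lra.
    by rewrite lee_fin divr_ge0// ltW.
  apply: (@le_trans _ _ (t%:E * (lam^-1)%:E)%E); last first.
    by apply: lee_wpmul2r => //; rewrite lee_fin invr_ge0 ltW.
  rewrite -EFinM lee_fin ler_pdivlMr// mulrAC ler_pdivrMr// mulrC.
  by rewrite -ler_pdivlMr// (le_trans (ltW small))// -mulrA mulrC.
rewrite poweR_EFin -EFinM lee_fin /ball_ind xy mulr1.
rewrite powRM ?invr_ge0 ?(ltW k0) ?(ltW w0)//.
apply: ler_pM; rewrite ?invr_ge0 ?mulr_ge0 ?(ltW k0) ?(ltW E0) ?(ltW rn0)//.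
  by rewrite -[leLHS]powRr1 ?(ltW k0)//; apply: ler_powR.
rewrite -(powR_inv1 (ltW w0)) /w -!powRrM.
rewrite -[leLHS]mul1r ler_pdivrMr ?mulr_gt0//.
have xy2 : edist x y < 2 * r by ord_lra.
have := powR_osc (n%:R / p x) C0 hp r0 near xy2.
have -> : n%:R / p x * (-1 * p y) = - (n%:R / p x * (p y - p x)) + - n%:R.
  by field; rewrite gt_eqF//; ord_lra.
rewrite powRDp// 2!powRN powR_mulrn ?(ltW r0)// => h.
rewrite mulrA -[X in _ <= X * _]mulrA.
have z0 : 0 < powR r (n%:R / p x * (p y - p x)) by exact: powR_gt0.
rewrite [leRHS](_ : _ = E / powR r (n%:R / p x * (p y - p x))); last first.
  by field; rewrite !gt_eqF.
rewrite ler_pdivlMr// mul1r; apply: le_trans h _; rewrite ler_expR.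
apply: ler_wpM2r; first by ord_lra.
rewrite ger0_norm; last by rewrite divr_ge0//; ord_lra.
by rewrite ler_pdivrMr ?ler_peMr//; ord_lra.
Qed.

(** The radius 2 rho and the centers in B(x0, rho) suffice: B(x, 2 rho) then contains the test ball.
    Freezing the exponent of the weight at x0 cancels n/p(x0), and rho^(gamma + n/beta - n/q)
    remains; the norm in L^q over the centers supplies rho^(n/q). *)
Lemma fofana_frac_int_ball_ge (C gamma q beta : R) p : (0 < n)%N -> 0 < C ->
  (forall z, 1 <= p z) -> log_holder C p -> gamma < n%:R -> 1 <= q -> 1 <= beta ->
  exists2 c : R, 0 < c & forall x0 (rho : R), 0 < rho -> 8 * rho <= 1 + enorm x0 ->
  ((c * powR rho (gamma + n%:R / beta))%:E <=
   fofana_norm p q beta (frac_int gamma (ball_ind rho x0)))%E.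
Proof.
move=> n0 C0 p1 hp gn q1 b1.
have q0 : 0 < q by ord_lra.
have [Kw Kw1 hw] := @weight_bounds R n 3 (ler0n _ _).
have [cA cA0 hA] := @frac_int_ball_ge R n gamma n0 gn.
have [c2 c20 hc2] := lux_ball_ge C0 p1 hp.
pose E := expR (n%:R * (4 * C)).
have E0 : 0 < E by exact: expR_gt0.
pose D := powR 2 (3 * n%:R) * E.
have D0 : 0 < D by rewrite mulr_gt0// powR_gt0.
have Kw0 : 0 < Kw by ord_lra.
pose c3 := c2 * cA / (Kw * D).
have c30 : 0 < c3 by rewrite divr_gt0 ?mulr_gt0.
pose v : R := (2 / n.+1%:R) ^+ n.
have v0 : 0 < v by rewrite exprn_gt0// divr_gt0.
exists (c3 * powR v q^-1) => [|x0 rho r0 near]; first by rewrite mulr_gt0 ?powR_gt0.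
have near4 : 4 * rho <= 1 + enorm x0 by ord_lra.
have r20 : 0 < 2 * rho by ord_lra.
set T := powR rho (gamma + n%:R / beta - n%:R / q).
have T0 : 0 < T by exact: powR_gt0.
apply: (@le_trans _ _ (Lq_norm q (fun x => (c3 * T * ball_ind rho x0 x)%:E))).
  rewrite /Lq_norm.
  have cT : 0 <= powR (c3 * T) q by exact: powR_ge0.
  have lo : ((powR (c3 * T) q * (v * rho ^+ n))%:E <=
      iint (fun x => poweR `|(c3 * T * ball_ind rho x0 x)%:E| q))%E.
    apply: (@le_trans _ _ ((powR (c3 * T) q)%:E * iint (fun y => (ball_ind rho x0 y)%:E))%E).
      rewrite EFinM; apply: lee_wpmul2l; first by rewrite lee_fin.
      apply: le_trans (iint_ball_ge x0 r0); rewrite lee_fin /v -exprMn.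
      by rewrite le_eqVlt; apply/orP; left; apply/eqP; congr (_ ^+ n); ring.
    rewrite -iintZl ?lee_fin//; last 2 first.
    - by apply/measurable_EFinP; exact: measurable_ball_ind.
    - by move=> y; rewrite lee_fin ball_ind_ge0.
    apply: le_iint => y; first by rewrite mule_ge0// lee_fin ball_ind_ge0.
    rewrite -EFinM abse_EFin poweR_EFin lee_fin /ball_ind; case: ifP => _.
      by rewrite !mulr1 ger0_norm// mulr_ge0 ?ltW.
    by rewrite mulr0 powR_ge0.
  have qi : 0 <= q^-1 by rewrite invr_ge0 ltW.
  apply: le_trans (le_poweR qi _ lo).
    rewrite poweR_EFin lee_fin powRM ?mulr_ge0 ?exprn_ge0 ?(ltW v0) ?(ltW r0)//.
    rewrite -[powR (powR _ _) _]powRrM mulfV ?gt_eqF// powRr1; last by rewrite mulr_ge0// ltW.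
    rewrite powRM ?exprn_ge0 ?(ltW v0) ?(ltW r0)// -powR_mulrn ?(ltW r0)// -powRrM.
    rewrite [leRHS](_ : _ = c3 * powR v q^-1 * (T * powR rho (n%:R / q))); last by ring.
    rewrite /T -powRDp// le_eqVlt; apply/orP; left; apply/eqP; congr (_ * powR _ _); ord_lra.
  by rewrite lee_fin !mulr_ge0 ?exprn_ge0 ?(ltW v0) ?(ltW r0).
apply: (@le_trans _ _ (Lq_norm q (fun x =>
      ((powR (fine (lebn (eball x (2 * rho)%R))) (beta^-1 - (p x)^-1 - q^-1))%:E
        * lux_norm p (restr (frac_int gamma (ball_ind rho x0)) x (2 * rho)%R))%E)));
  last by apply: ereal_sup_ubound; exists (2 * rho).
rewrite /Lq_norm; apply: le_poweR; first by rewrite invr_ge0 ltW.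
  by apply: iint_ge0 => x; exact: poweR_ge0.
apply: le_iint => x; first exact: poweR_ge0.
apply: le_poweR; [exact: ltW|by []|].
have h0 : (0 <= (powR (fine (lebn (eball x (2 * rho)))) (beta^-1 - (p x)^-1 - q^-1))%:E
        * lux_norm p (restr (frac_int gamma (ball_ind rho x0)) x (2 * rho)))%E.
  by rewrite mule_ge0 ?lux_norm_ge0// lee_fin powR_ge0.
rewrite (gee0_abs h0).
have b0 : 0 <= c3 * T * ball_ind rho x0 x by rewrite mulr_ge0 ?ball_ind_ge0// mulr_ge0 ?ltW.
rewrite abse_EFin (ger0_norm b0).
rewrite {1}/ball_ind; case: ifPn => hx; last by rewrite mulr0.
rewrite mulr1.
have px := p1 x; have eb := wexp_bound px q1 b1.
have [_ w2] := hw x (2 * rho) (wexp p q beta x) r20 eb.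
have L : ((c2 * (cA * powR rho gamma) * powR rho (n%:R / p x0))%:E <=
    lux_norm p (restr (frac_int gamma (ball_ind rho x0)) x (2 * rho)))%E.
  apply: hc2 => //; first by rewrite mulr_gt0 ?powR_gt0.
  move=> y; rewrite {1}/ball_ind; case: ifPn => hy; last by rewrite mulr0 abse_ge0.
  rewrite mulr1 restrE /ball_ind ifT ?mul1e; last first.
    by have := eudist_triangle x0 x y; have := eudist_triangle x x0 y; rewrite (eudistC x x0); ord_lra.
  by apply: le_trans (hA x0 rho y r0 hy) (lee_abs _).
apply: (@le_trans _ _ ((Kw^-1 * powR (2 * rho) (n%:R * wexp p q beta x))%:E *
   (c2 * (cA * powR rho gamma) * powR rho (n%:R / p x0))%:E)%E); last first.
  apply: lee_pmul => //.
  - by rewrite lee_fin mulr_ge0 ?powR_ge0// invr_ge0 ltW.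
  - by rewrite lee_fin !mulr_ge0 ?powR_ge0 ?(ltW c20) ?(ltW cA0).
  - by rewrite lee_fin ler_pdivrMl.
rewrite -EFinM lee_fin.
set e := wexp p q beta x.
have hT : T <= D * (powR (2 * rho) (n%:R * e) * powR rho gamma * powR rho (n%:R / p x0)).
  have -> : T = powR rho (n%:R * e) * powR rho gamma * powR rho (n%:R / p x0) *
      powR rho (- n%:R * ((p x0)^-1 - (p x)^-1)).
    by rewrite -!powRDp//; congr powR; rewrite /e /wexp; ring.
  have xy2 : edist x0 x < 2 * rho by ord_lra.
  have osc := powR_osc_inv (- n%:R) C0 p1 hp r0 near4 xy2.
  rewrite normrN ger0_norm// -/E in osc.
  rewrite [leRHS](_ : _ = (powR 2 (3 * n%:R) * powR (2 * rho) (n%:R * e)) * powR rho gamma *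
     powR rho (n%:R / p x0) * E); last by rewrite /D; ring.
  apply: ler_pM; rewrite ?mulr_ge0 ?powR_ge0//.
  apply: ler_wpM2r; first exact: powR_ge0.
  apply: ler_wpM2r; first exact: powR_ge0.
  rewrite powRM ?(ltW r0)// mulrA -powRDp//.
  apply: ler_peMl; first exact: powR_ge0.
  rewrite -[leLHS](powRr0 2); apply: ler_powR; first by ord_lra.
  rewrite (mulrC 3) -mulrDr mulr_ge0//.
  by move: eb; rewrite ler_norml -/e => /andP[e3 _]; ord_lra.
rewrite -ler_pdivrMl// in hT.
rewrite [leLHS](_ : _ = c2 * cA / Kw * (D^-1 * T)); last first.
  by rewrite /c3; field; rewrite !gt_eqF.
rewrite [leRHS](_ : _ = c2 * cA / Kw * (powR (2 * rho) (n%:R * e) * powR rho gamma *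
  powR rho (n%:R / p x0))); last by ring.
by apply: ler_wpM2l => //; rewrite divr_ge0 ?mulr_ge0// ltW.
Qed.

End LowerBound.

(** * Upper bound for the Fofana norm of an indicator *)

Section UpperBound.
Context {R : realType} {n : nat}.
Implicit Types (x y : n.-tuple R) (p : n.-tuple R -> R).

Lemma lux_norm_eq0 p (g : n.-tuple R -> \bar R) : (forall y, 0 < p y) ->
  (forall y, g y = 0%E) -> lux_norm p g = 0%E.
Proof.
move=> p0 g0; apply/eqP; rewrite eq_le lux_norm_ge0 andbT.
apply/lee_addgt0Pr => e e0; rewrite add0e; apply: lux_norm_le => //.
rewrite /modular (eq_iint (g := fun=> 0%E)) => [|y]; last first.
  by rewrite g0 abse0 mul0e poweR0r// gt_eqF.
by rewrite iint0.
Qed.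

(** The q-th power of the weight r^(n wexp) is r^(defect) r^(-n). The defect is negative wherever p
    < alpha and n, q are positive. *)
Definition defect p (q alpha : R) x : R := n%:R * q * (alpha^-1 - (p x)^-1).

(** Isolates what the norm estimate asks of the position of [x0]: over balls too large for freezing,
    r^(defect x) must be on average at most a multiple of rho^(defect x0). *)
Definition far_bound p (q alpha M rho : R) x0 : Prop := forall r : R, 1 + enorm x0 < 8 * r ->
  (iint (fun x => (ball_ind (2 * r) x0 x * powR r (defect p q alpha x))%:E) <=
   (M * (r ^+ n * powR rho (defect p q alpha x0)))%:E)%E.

(** While 8 r <= 1 + |x0| the defect is frozen at x0; being nonpositive there, it allows r to be
    replaced by the smaller rho. The remaining radii are those of [far_bound]. *)
Lemma ball_defect_le (C q alpha M : R) p : (0 < n)%N -> 0 < C -> (forall z, 1 <= p z) ->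
  log_holder C p -> measurable_fun setT p -> 1 <= q -> (forall z, p z < alpha) -> 0 <= M ->
  exists2 K : R, 0 <= K & forall x0 (rho r : R), 0 < rho -> 
  far_bound p q alpha M rho x0 -> rho < r ->
  (iint (fun x => (ball_ind (2 * r) x0 x * powR r (defect p q alpha x))%:E) <=
   (K * (r ^+ n * powR rho (defect p q alpha x0)))%:E)%E.
Proof.
move=> n0 C0 p1 hp mp q1 pa M0; pose E := expR (n%:R * q * (4 * C)).
have E0 : 0 <= E by exact: expR_ge0.
exists (M + 4 ^+ n * E); first by rewrite addr_ge0 ?mulr_ge0 ?exprn_ge0.
move=> x0 rho r rho0 far rr; have r0 : 0 < r by ord_lra.
have rn0 : 0 <= r ^+ n by rewrite exprn_ge0// ltW.
have w0 : 0 <= powR rho (defect p q alpha x0) by exact: powR_ge0.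
have [near|/far] := leP (8 * r) (1 + enorm x0); last first.
  move/le_trans; apply; rewrite lee_fin; apply: ler_wpM2r; first exact: mulr_ge0.
  by rewrite lerDl mulr_ge0// exprn_ge0.
have cE : 0 <= E * powR rho (defect p q alpha x0) by exact: mulr_ge0.
apply: (@le_trans _ _ ((E * powR rho (defect p q alpha x0))%:E *
   iint (fun x => (ball_ind (2 * r) x0 x)%:E))%E).
  rewrite -iintZl ?lee_fin//; last 2 first.
  - by apply/measurable_EFinP; exact: measurable_ball_ind.
  - by move=> y; rewrite lee_fin ball_ind_ge0.
  apply: le_iint => x; first by rewrite lee_fin mulr_ge0 ?powR_ge0 ?ball_ind_ge0.
  rewrite -EFinM lee_fin /ball_ind; case: ifPn => hx; last by rewrite mulr0 mul0r.
  rewrite mul1r mulr1.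
  have -> : defect p q alpha x = n%:R * q * ((p x0)^-1 - (p x)^-1) + defect p q alpha x0.
    by rewrite /defect; ring.
  rewrite powRDp//; apply: ler_pM; rewrite ?powR_ge0//.
    have near4 : 4 * r <= 1 + enorm x0 by ord_lra.
    apply: le_trans (powR_osc_inv _ C0 p1 hp r0 near4 hx) _.
    by rewrite ger0_norm// mulr_ge0//; ord_lra.
  have px0 := p1 x0; have pa0 := pa x0.
  have d0 : 0 <= - defect p q alpha x0.
    rewrite /defect -mulrN opprB mulr_ge0 ?mulr_ge0//; first by ord_lra.
    by rewrite subr_ge0 lef_pV2 ?posrE ?ltW//; ord_lra.
  rewrite -[X in powR r X]opprK -[X in powR rho X]opprK powRN [leRHS]powRN.
  rewrite lef_pV2 ?posrE ?powR_gt0//.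
  by apply: ler_powR2r => //; exact: ltW.
have r20 : 0 <= 2 * r by ord_lra.
apply: le_trans (lee_wpmul2l _ (iint_ball_le x0 r20)) _; first by rewrite lee_fin.
rewrite -EFinM lee_fin (_ : 2 * (2 * r) = 4 * r); last by ring.
rewrite exprMn [leLHS](_ : _ = 4 ^+ n * E * (r ^+ n * powR rho (defect p q alpha x0))); last by ring.
by apply: ler_wpM2r; rewrite ?mulr_ge0// lerDr.
Qed.

(** For r <= rho the restricted indicator has norm O(r^(n/p(x))), so the weighted norm is
    O(r^(n/alpha - n/q)), increasing in r since alpha < q, over centers in B(x0, 2 rho); the factor
    8 leaves room for that displacement. For r > rho the norm is O(rho^(n/p(x0))), the centers fill
    B(x0, 2 r), and [ball_defect_le] integrates the weight. *)
Lemma fofana_ball_le (C q alpha M : R) p : (0 < n)%N -> 0 < C -> (forall z, 1 <= p z) ->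
  log_holder C p -> measurable_fun setT p -> 1 <= q -> 1 <= alpha ->
  (forall z, p z < alpha) -> alpha < q -> 0 <= M ->
  exists2 K : R, 0 <= K & forall x0 (rho : R), 0 < rho -> 8 * rho <= 1 + enorm x0 ->
  far_bound p q alpha M rho x0 ->
  (fofana_norm p q alpha (fun y => (ball_ind rho x0 y)%:E) <=
   (K * powR rho (n%:R / alpha))%:E)%E.
Proof.
move=> n0 C0 p1 hp mp q1 a1 pa aq M0.
have q0 : 0 < q by ord_lra.
have a0 : 0 < alpha by ord_lra.
have [Kw Kw1 hw] := @weight_bounds R n 3 (ler0n _ _).
have [Kl Kl1 hl] := lux_near_ball C0 p1 hp.
have [Kd Kd0 hd] := ball_defect_le n0 C0 p1 hp mp q1 pa M0.
pose A := powR (Kw * Kl) q; have A0 : 0 <= A by exact: powR_ge0.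
pose Z := A * (4 ^+ n + Kd).
have Z0 : 0 <= Z by rewrite mulr_ge0// addr_ge0// exprn_ge0.
have Kw0 : 0 <= Kw by ord_lra.
have Kl0 : 0 <= Kl by ord_lra.
exists (powR Z q^-1); first exact: powR_ge0.
move=> x0 rho rho0 near far; apply: ge_ereal_sup => _ [r r0 <-]; rewrite /= in r0.
set h := (fun x : n.-tuple R => _).
have h0 x : (0 <= h x)%E by rewrite mule_ge0 ?lux_norm_ge0// lee_fin powR_ge0.
suff main : (iint (fun x => poweR `|h x|%E q) <= (Z * powR rho (n%:R * q / alpha))%:E)%E.
  have qi : 0 <= q^-1 by rewrite invr_ge0 ltW.
  apply: le_trans (le_poweR qi _ main) _.
    by apply: iint_ge0 => x; exact: poweR_ge0.
  rewrite poweR_EFin lee_fin powRM ?powR_ge0// -powRrM le_eqVlt; apply/orP; left.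
  by apply/eqP; congr (_ * powR _ _); field; rewrite !gt_eqF.
have hpt x (L : R) : 0 <= L ->
    (lux_norm p (restr (fun y => (ball_ind rho x0 y)%:E) x r) <= (Kl * L)%:E)%E ->
    (poweR `|h x| q <= (A * powR (powR r (n%:R * wexp p q alpha x) * L) q)%:E)%E.
  move=> L0 hL; have eb := wexp_bound (p1 x) q1 a1.
  have [w1 _] := hw x r (wexp p q alpha x) r0 eb.
  rewrite /A -powRM ?mulr_ge0 ?powR_ge0// -poweR_EFin.
  rewrite gee0_abs//; apply: le_poweR; [exact: ltW|by []|].
  rewrite [X in (_ <= X%:E)%E](_ : _ =
    (Kw * powR r (n%:R * wexp p q alpha x)) * (Kl * L)); last by ring.
  rewrite EFinM; apply: lee_pmul; rewrite ?lee_fin ?powR_ge0 ?lux_norm_ge0//.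
have hout x : r + rho <= edist x0 x -> poweR `|h x|%E q = 0%E.
  move=> xx; rewrite /h lux_norm_eq0 ?mule0 ?abse0 ?poweR0r ?gt_eqF//.
    by move=> y; have := p1 y; ord_lra.
  move=> y; rewrite restrE /ball_ind; case: ifP => h1; last by rewrite mul0e.
  case: ifP => h2; last by rewrite mule0.
  have := eudist_triangle y x0 x; rewrite (eudistC y x) => d.
  by have := lt_le_trans (ltrD h1 h2) (le_trans xx d); rewrite addrC ltxx.
have mb s : measurable_fun setT (fun y : n.-tuple R => (ball_ind s x0 y)%:E).
  by apply/measurable_EFinP; exact: measurable_ball_ind.
have b0 s y : (0 <= (ball_ind s x0 y)%:E)%E by rewrite lee_fin ball_ind_ge0.
have [rr|rr] := leP r rho.
  pose c := A * powR r (n%:R * (q / alpha - 1)).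
  have c0 : 0 <= c by rewrite mulr_ge0 ?powR_ge0.
  apply: (@le_trans _ _ (c%:E * iint (fun x => (ball_ind (2 * rho) x0 x)%:E))%E).
    rewrite -iintZl ?lee_fin//; apply: le_iint => x; first exact: poweR_ge0.
    have [hx|hx] := ltP (edist x0 x) (2 * rho); last first.
      by rewrite hout ?mule_ge0 ?lee_fin ?ball_ind_ge0//; ord_lra.
    rewrite /ball_ind hx mule1.
    have nearx : 4 * r <= 1 + enorm x by have := enorm_le_edist x0 x; ord_lra.
    apply: le_trans (hpt x (powR r (n%:R / p x)) (powR_ge0 _ _) _) _.
      apply: hl => // y; rewrite restrE -EFinM abse_EFin lee_fin.
      by rewrite ger0_norm ?mulr_ge0 ?ball_ind_ge0// ler_piMr ?ball_ind_ge0 ?ball_ind_le1.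
    rewrite lee_fin -powRDp// -powRrM /c le_eqVlt; apply/orP; left; apply/eqP.
    have px := p1 x.
    congr (_ * powR _ _); rewrite /wexp; field.
    by rewrite !gt_eqF//; ord_lra.
  have r20 : 0 <= 2 * rho by ord_lra.
  apply: le_trans (lee_wpmul2l _ (iint_ball_le x0 r20)) _; first by rewrite lee_fin.
  rewrite -EFinM lee_fin (_ : 2 * (2 * rho) = 4 * rho); last by ring.
  have ex : 0 <= n%:R * (q / alpha - 1).
    by rewrite mulr_ge0// subr_ge0 ler_pdivlMr// mul1r ltW.
  have := ler_powR2r ex (ltW r0) rr => mono.
  rewrite exprMn /c [Z]mulrDr [leRHS]mulrDl ler_wpDr ?mulr_ge0 ?powR_ge0//.
  rewrite [leLHS](_ : _ = A * 4 ^+ n * (powR r (n%:R * (q / alpha - 1)) * rho ^+ n)); last by ring.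
  apply: ler_wpM2l; first by rewrite mulr_ge0// exprn_ge0.
  apply: le_trans (ler_wpM2r _ mono) _; first by rewrite exprn_ge0// ltW.
  rewrite -powR_mulrn ?(ltW rho0)// -powRDp// le_eqVlt; apply/orP; left; apply/eqP.
  by congr powR; ring.
pose c := A * (powR rho (n%:R * q / p x0) / r ^+ n).
have rn0 : 0 < r ^+ n by rewrite exprn_gt0.
have c0 : 0 <= c by rewrite mulr_ge0// divr_ge0 ?powR_ge0// ltW.
pose J x := (ball_ind (2 * r) x0 x * powR r (defect p q alpha x))%:E.
apply: (@le_trans _ _ (c%:E * iint J)%E).
  rewrite -iintZl ?lee_fin//; last 2 first.
  - apply/measurable_EFinP; apply: measurable_funM; first exact: measurable_ball_ind.
    apply: measurable_powR2 => //; apply: measurable_funM => //.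
    apply: measurable_funB => //.
    have -> : (fun x => (p x)^-1) = (fun x => powR (p x) (- 1)).
      by apply/funext => x; rewrite powR_inv1//; have := p1 x; ord_lra.
    exact: measurable_powR2.
  - by move=> x; rewrite lee_fin mulr_ge0 ?ball_ind_ge0 ?powR_ge0.
  apply: le_iint => x; first exact: poweR_ge0.
  have [hx|hx] := ltP (edist x0 x) (2 * r); last first.
    rewrite hout; last by ord_lra.
    by apply: mule_ge0; rewrite lee_fin// mulr_ge0 ?ball_ind_ge0 ?powR_ge0.
  rewrite /J /ball_ind hx mul1r.
  have near4 : 4 * rho <= 1 + enorm x0 by ord_lra.
  apply: le_trans (hpt x (powR rho (n%:R / p x0)) (powR_ge0 _ _) _) _.
    apply: hl => // y; rewrite restrE -EFinM abse_EFin lee_fin.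
    by rewrite ger0_norm ?mulr_ge0 ?ball_ind_ge0// ler_piMl ?ball_ind_ge0 ?ball_ind_le1.
  rewrite -EFinM lee_fin powRM ?powR_ge0// -!powRrM /c -!mulrA; apply: ler_wpM2l => //.
  have -> : n%:R * (wexp p q alpha x * q) = defect p q alpha x + - n%:R.
    by rewrite /wexp /defect; field; rewrite !gt_eqF//; have := p1 x; ord_lra.
  rewrite powRDp// powRN powR_mulrn ?(ltW r0)// le_eqVlt; apply/orP; left; apply/eqP.
  rewrite [RHS](_ : _ = powR r (defect p q alpha x) / r ^+ n * powR rho (n%:R * (q / p x0))); last by ring.
  by congr (_ * powR _ _); ring.
apply: le_trans (lee_wpmul2l _ (hd x0 rho r rho0 far rr)) _; first by rewrite lee_fin.
rewrite -EFinM lee_fin /c.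
rewrite [leLHS](_ : _ = A * Kd * (powR rho (n%:R * q / p x0) * powR rho (defect p q alpha x0))); last first.
  by field; rewrite gt_eqF.
rewrite -powRDp// [Z]mulrDr [leRHS]mulrDl ler_wpDl ?mulr_ge0 ?powR_ge0 ?exprn_ge0//.
rewrite le_eqVlt; apply/orP; left; apply/eqP; congr (_ * powR _ _).
by rewrite /defect; ring.
Qed.

End UpperBound.

(** * Necessity of the scaling relation *)

Section Necessity.
Context {R : realType} {n : nat}.
Implicit Types (x y : n.-tuple R) (p : n.-tuple R -> R).

Lemma defect_bounds p (q alpha : R) x : 1 <= p x -> p x < alpha -> 1 <= q ->
  - (n%:R * q) <= defect p q alpha x <= 0.
Proof.
move=> px pa q1; have nq : 0 <= n%:R * q by rewrite mulr_ge0//; ord_lra.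
have a1 : 0 <= alpha^-1 by rewrite invr_ge0; ord_lra.
have b1 : (p x)^-1 <= 1 by rewrite invf_le1; ord_lra.
have ab : alpha^-1 <= (p x)^-1 by rewrite lef_pV2 ?posrE; ord_lra.
rewrite /defect; apply/andP; split.
  rewrite -[leLHS]mulrN1; apply: ler_wpM2l => //; ord_lra.
by apply: mulr_ge0_le0 => //; ord_lra.
Qed.

(** Around the origin the radii in question exceed 1/8, so r^(defect) is at most 8^(n q), whereas
    rho <= 1 makes rho^(defect) at least 1. *)
Lemma far_bound_small p (q alpha : R) : (forall z, 1 <= p z) ->
  (forall z, p z < alpha) -> 1 <= q ->
  exists2 M : R, 0 <= M & forall rho : R, 0 < rho -> rho <= 1 ->
  far_bound p q alpha M rho (cst_tuple 0).
Proof.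
move=> p1 pa q1; pose o : n.-tuple R := cst_tuple 0.
have w0 : 0 <= powR 8 (n%:R * q) :> R by exact: powR_ge0.
exists (powR 8 (n%:R * q) * 4 ^+ n); first by rewrite mulr_ge0 ?exprn_ge0.
move=> rho rho0 rho1 r; rewrite enorm_cst_tuple// mulr0 addr0 => r8.
have r0 : 0 < r by ord_lra.
have rn0 : 0 <= r ^+ n by rewrite exprn_ge0// ltW.
apply: (@le_trans _ _ ((powR 8 (n%:R * q))%:E * iint (fun x => (ball_ind (2 * r) o x)%:E))%E).
  rewrite -iintZl ?lee_fin//; last 2 first.
  - by apply/measurable_EFinP; exact: measurable_ball_ind.
  - by move=> y; rewrite lee_fin ball_ind_ge0.
  apply: le_iint => x; first by rewrite lee_fin mulr_ge0 ?powR_ge0 ?ball_ind_ge0.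
  rewrite -EFinM lee_fin mulrC; apply: ler_wpM2r; first exact: ball_ind_ge0.
  have /andP[d1 d2] := defect_bounds (p1 x) (pa x) q1.
  have -> : powR r (defect p q alpha x) = powR r^-1 (- defect p q alpha x).
    by rewrite -[r^-1]powR_inv1 ?(ltW r0)// -powRrM mulN1r opprK.
  apply: (@le_trans _ _ (powR 8 (- defect p q alpha x))).
    apply: ler_powR2r; [ord_lra|by rewrite invr_ge0 ltW|].
    by rewrite -[leRHS]invrK lef_pV2 ?posrE ?invr_gt0//; ord_lra.
  by apply: ler_powR; ord_lra.
have r20 : 0 <= 2 * r by ord_lra.
apply: le_trans (lee_wpmul2l _ (iint_ball_le o r20)) _; first by rewrite lee_fin.
rewrite -EFinM lee_fin (_ : 2 * (2 * r) = 4 * r); last by ring.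
rewrite exprMn -!mulrA; apply: ler_wpM2l => //.
apply: ler_wpM2l; first by rewrite exprn_ge0.
apply: ler_peMr => //.
have /andP[d1 d2] := defect_bounds (p1 o) (pa o) q1.
by rewrite -[leLHS](powRr0 rho); apply: ger_powR; rewrite ?rho0.
Qed.

Lemma log_holder_far (C rho : R) p x y : 0 < C -> log_holder C p -> 1 < rho ->
  rho <= enorm x -> rho <= enorm y -> `|p x - p y| * ln rho <= C.
Proof.
move=> C0 [_ hp] rho1 hx hy; have l0 : 0 < ln rho by exact: ln_gt0.
have key u v : rho <= enorm u -> enorm u <= enorm v -> `|p u - p v| * ln rho <= C.
  move=> hu uv; rewrite -ler_pdivlMr//; apply: le_trans (hp u v uv) _.
  have e0 := expR_gt0 (1 : R).
  apply: ler_wpM2l; first exact: ltW.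
  have ule : ln rho <= ln (enorm u + expR 1) by rewrite ler_ln ?posrE; ord_lra.
  by rewrite lef_pV2 ?posrE//; ord_lra.
have [xy|/ltW yx] := leP (enorm x) (enorm y); first exact: key.
by rewrite distrC; exact: key.
Qed.

(** Outside B(0, rho^q) the decay condition makes rho^(defect x) comparable with rho^(defect x0).
    Inside, r^(defect) <= 1 and only the volume counts: it is of order rho^(n q), which r^n rho^(-n
    q) dominates since 8 r > rho^(2 q). This is where the exponent 2 q of |x0| comes from. *)
Lemma far_bound_large (C q alpha : R) p : 0 < C -> (forall z, 1 <= p z) ->
  log_holder C p -> (forall z, p z < alpha) -> 1 <= q ->
  exists2 M : R, 0 <= M & forall (rho : R) x0, 8 <= rho -> enorm x0 = powR rho (2 * q) ->
  far_bound p q alpha M rho x0.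
Proof.
move=> C0 p1 hp pa q1; pose E := expR (n%:R * q * C); pose o : n.-tuple R := cst_tuple 0.
have E0 : 0 <= E by exact: expR_ge0.
exists (16 ^+ n + 4 ^+ n * E); first by rewrite addr_ge0 ?mulr_ge0 ?exprn_ge0.
move=> rho x0 rho8 hx0 r; rewrite hx0 => hr.
have rho0 : 0 < rho by ord_lra.
have rho1 : 1 <= rho by ord_lra.
have rq : rho <= powR rho q by rewrite -[leLHS]powRr1 ?(ltW rho0)//; apply: ler_powR.
have r2q : powR rho (2 * q) = powR rho q * powR rho q by rewrite -powRDp//; congr powR; ring.
have rr : rho <= r by move: hr; rewrite r2q; nra.
have r0 : 0 < r by ord_lra.
set d0 := defect p q alpha x0.
have /andP[d01 d02] : - (n%:R * q) <= d0 <= 0 by exact: defect_bounds.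
have w0 : 0 <= powR rho d0 by exact: powR_ge0.
have k0 : 0 <= E * powR rho d0 by rewrite mulr_ge0.
have mb s z : measurable_fun setT (fun y : n.-tuple R => (ball_ind s z y)%:E).
  by apply/measurable_EFinP; exact: measurable_ball_ind.
have b0 s z y : (0 <= (ball_ind s z y)%:E)%E by rewrite lee_fin ball_ind_ge0.
apply: (@le_trans _ _ (iint (fun x => (ball_ind (powR rho q) o x)%:E) +
   (E * powR rho d0)%:E * iint (fun x => (ball_ind (2 * r) x0 x)%:E))%E).
  rewrite -iintZl ?lee_fin// -iintD//; last 2 first.
  - by apply: measurable_funeM.
  - by move=> x; rewrite mule_ge0// lee_fin.
  apply: le_iint => x; first by rewrite lee_fin mulr_ge0 ?powR_ge0 ?ball_ind_ge0.
  rewrite -EFinM -EFinD lee_fin.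
  have /andP[d1 d2] := defect_bounds (p1 x) (pa x) q1.
  have [hx|hx] := ltP (enorm x) (powR rho q).
    rewrite [ball_ind (powR rho q) o x]/ball_ind eudistC edist_cst_tuple0 hx.
    apply: (@le_trans _ _ 1); last by rewrite lerDl mulr_ge0// ball_ind_ge0.
    rewrite mulr_ile1 ?ball_ind_ge0 ?ball_ind_le1 ?powR_ge0//.
    by rewrite -[leRHS](powRr0 r); apply: ler_powR; ord_lra.
  rewrite addrC ler_wpDr ?ball_ind_ge0// mulrC; apply: ler_wpM2r; first exact: ball_ind_ge0.
  apply: (@le_trans _ _ (powR rho (defect p q alpha x))).
    rewrite -[X in powR r X]opprK -[X in powR rho X]opprK powRN [leRHS]powRN.
    rewrite lef_pV2 ?posrE ?powR_gt0//; apply: ler_powR2r; rewrite ?(ltW rho0)//; ord_lra.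
  have -> : powR rho (defect p q alpha x) =
      powR rho (n%:R * q * ((p x0)^-1 - (p x)^-1)) * powR rho d0.
    by rewrite -powRDp//; congr powR; rewrite /d0 /defect; ring.
  apply: ler_wpM2r => //; rewrite powR_expR// ler_expR.
  have px := p1 x; have px0 := p1 x0; have pp : 1 <= p x * p x0.
    by rewrite -[leLHS]mulr1; apply: ler_pM.
  have -> : (n%:R * q * ((p x0)^-1 - (p x)^-1)) * ln rho =
      n%:R * q * ((p x - p x0) * ln rho / (p x * p x0)).
    by field; rewrite !gt_eqF//; ord_lra.
  apply: ler_wpM2l; first by rewrite mulr_ge0//; ord_lra.
  have rho1' : 1 < rho by ord_lra.
  have l0 : 0 < ln rho by exact: ln_gt0.
  rewrite ler_pdivrMr; last by ord_lra.
  apply: (@le_trans _ _ C); last by rewrite ler_peMr// ltW.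
  have hx0' : rho <= enorm x0 by rewrite hx0 r2q; nra.
  have := log_holder_far C0 hp rho1' (le_trans rq hx) hx0'.
  by apply: le_trans; apply: ler_wpM2r; [exact: ltW|exact: ler_norm].
have r20 : 0 <= 2 * r by ord_lra.
have h1 := iint_ball_le o (powR_ge0 rho q).
have h2 := lee_wpmul2l (_ : 0 <= (E * powR rho d0)%:E)%E (iint_ball_le x0 r20).
rewrite lee_fin in h2; apply: le_trans (leeD h1 (h2 k0)) _.
rewrite -EFinM -EFinD lee_fin (_ : 2 * (2 * r) = 4 * r); last by ring.
rewrite [leRHS]mulrDl; apply: lerD; last first.
  by rewrite exprMn le_eqVlt; apply/orP; left; apply/eqP; ring.
have rn : (powR rho (2 * q)) ^+ n <= (8 * r) ^+ n.
  by apply: lerXn2r; rewrite ?nnegrE ?powR_ge0//; ord_lra.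
have lo : powR rho (- (n%:R * q)) <= powR rho d0 by apply: ler_powR.
have e8 : 2 ^+ n * 8 ^+ n = 16 ^+ n :> R.
  by rewrite -exprMn; congr (_ ^+ n); ring.
apply: (@le_trans _ _ (2 ^+ n * ((powR rho (2 * q)) ^+ n * powR rho (- (n%:R * q))))).
  rewrite exprMn le_eqVlt; apply/orP; left; apply/eqP; congr (_ * _).
  rewrite -!powR_mulrn ?powR_ge0// -!powRrM -powRDp//.
  by congr powR; ring.
rewrite -e8 -mulrA; apply: ler_wpM2l; first by rewrite exprn_ge0.
rewrite mulrA -exprMn; apply: ler_pM; rewrite ?powR_ge0 ?exprn_ge0 ?powR_ge0//.
Qed.

Lemma powR_bounded_eq0 (t K : R) : (forall rho : R, 0 < rho -> rho <= 1 / 8 -> powR rho t <= K) ->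
  (forall rho : R, 8 <= rho -> powR rho t <= K) -> t = 0.
Proof.
move=> small large; apply/eqP/negP => /negP t0.
pose s := 8 + `|K| / `|t|.
have at0 : 0 < `|t| by rewrite normr_gt0.
have Kt : 0 <= `|K| / `|t| by rewrite divr_ge0.
have s8 : 8 <= s by rewrite lerDl.
have es : 8 <= expR s by have := expR_ge1Dx s; ord_lra.
have big : K < expR (`|t| * s).
  apply: le_lt_trans (ler_norm K) _; apply: (@lt_le_trans _ _ (1 + `|t| * s)); last exact: expR_ge1Dx.
  rewrite /s mulrDr [X in _ + (_ + X)]mulrC divfK ?gt_eqF//.
  have : 0 <= `|t| * 8 by rewrite mulr_ge0// ltW.
  by ord_lra.
have pE u : powR (expR u) t = expR (t * u) by rewrite powR_expR ?expR_gt0// expRK.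
have [tn|tp] := ltP t 0.
  have h8 : expR (- s) <= 1 / 8.
    by rewrite expRN -[1 / 8]invrK lef_pV2 ?posrE ?expR_gt0 ?invr_gt0//; ord_lra.
  have := small _ (expR_gt0 _) h8; rewrite pE leNgt => /negP; apply.
  by move: big; rewrite ltr0_norm// mulNr mulrN.
have := large _ es; rewrite pE leNgt => /negP; apply.
by move: big; rewrite ger0_norm.
Qed.

Lemma ball_ind_in_fofana (q alpha : R) (C : R) p x0 (rho : R) : 0 < C ->
  (forall z, 1 <= p z) -> log_holder C p -> 0 < rho -> 8 * rho <= 1 + enorm x0 ->
  (fofana_norm p q alpha (fun y => (ball_ind rho x0 y)%:E) < +oo)%E ->
  in_fofana p q alpha (fun y => (ball_ind rho x0 y)%:E).
Proof.
move=> C0 p1 hp rho0 near fin; split; last split => //.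
  by apply/measurable_EFinP; exact: measurable_ball_ind.
have [K K1 hK] := lux_near_ball C0 p1 hp.
move=> x r r0; have near4 : 4 * rho <= 1 + enorm x0 by ord_lra.
apply: le_lt_trans (hK x0 rho _ rho0 near4 _) (ltry _) => y.
rewrite restrE -EFinM abse_EFin lee_fin ger0_norm ?mulr_ge0 ?ball_ind_ge0//.
by rewrite ler_piMl ?ball_ind_ge0 ?ball_ind_le1.
Qed.

Theorem frac_bounded_scaling (C gamma q alpha beta : R) (p1 p2 : n.-tuple R -> R) :
  (0 < n)%N -> 0 < C -> log_holder C p1 -> log_holder C p2 -> measurable_fun setT p1 ->
  (forall z, 1 <= p1 z) -> (forall z, 1 <= p2 z) -> gamma < n%:R -> 1 <= q ->
  1 <= alpha -> 1 <= beta -> (forall z, p1 z < alpha) -> alpha < q ->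
  frac_bounded gamma p1 q alpha p2 beta -> gamma = n%:R / alpha - n%:R / beta.
Proof.
move=> n0 C0 hp1 hp2 mp p11 p21 gn q1 a1 b1 pa aq [B [B0 hB]].
have [c c0 hc] := fofana_frac_int_ball_ge n0 C0 p21 hp2 gn q1 b1.
have key M : 0 <= M -> exists K, forall x0 (rho : R), 0 < rho -> 8 * rho <= 1 + enorm x0 ->
    far_bound p1 q alpha M rho x0 -> powR rho (gamma + n%:R / beta - n%:R / alpha) <= K.
  move=> M0; have [K K0 hK] := fofana_ball_le n0 C0 p11 hp1 mp q1 a1 pa aq M0.
  exists (B * K / c) => x0 rho rho0 near far.
  have up := hK x0 rho rho0 near far; have lo := hc x0 rho rho0 near.
  have fin := ball_ind_in_fofana C0 p11 hp1 rho0 near (le_lt_trans up (ltry _)).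
  have [_ le] := hB _ fin.
  have := le_trans lo (le_trans le (lee_wpmul2l _ up)).
  rewrite lee_fin -EFinM lee_fin => /(_ B0) h.
  rewrite powRDp// powRN ler_pdivrMr ?powR_gt0// [B * K / c * _]mulrAC ler_pdivlMr//.
  by rewrite -[leRHS]mulrA [leLHS]mulrC.
have [M1 M10 h1] := @far_bound_small p1 q alpha p11 pa q1.
have [M2 M20 h2] := far_bound_large C0 p11 hp1 pa q1.
have [K1 hK1] := key _ M10; have [K2 hK2] := key _ M20.
suff : gamma + n%:R / beta - n%:R / alpha = 0 by ord_lra.
apply: (@powR_bounded_eq0 _ (Num.max K1 K2)) => [rho rho0 rho8|rho rho8].
  rewrite le_max (hK1 (cst_tuple 0) rho rho0)// ?enorm_cst_tuple ?mulr0//; first by ord_lra.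
  by apply: h1 => //; ord_lra.
have rho0 : 0 < rho by ord_lra.
have [x0 hx0] := exists_enorm n0 (powR_ge0 rho (2 * q)).
rewrite le_max (hK2 x0 rho rho0) ?orbT//; last exact: h2.
(* As rho >= 8, one has 8 rho <= rho^2 <= rho^(2 q) = |x0|. *)
have rq : powR rho 2 <= powR rho (2 * q) by apply: ler_powR; ord_lra.
rewrite hx0; move: rq; rewrite (powR_mulrn 2 (ltW rho0)) expr2; nra.
Qed.

End Necessity.

(** * From essential bounds to bounds at every point *)

Section Everywhere.
Context {R : realType} {n : nat}.
Implicit Types (x y : n.-tuple R) (p : n.-tuple R -> R).

(** The local condition makes p continuous: a point with p x < c has a ball around it on which p <
    c, and a ball is not a null set. *)
Lemma ae_ge_everywhere (C c : R) p : 0 < C -> log_holder C p -> ae (fun x => c <= p x) ->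
  forall x, c <= p x.
Proof.
move=> C0 [hp _] [N [_ [N0 hN]]] x; rewrite leNgt; apply/negP => pc.
pose e := c - p x; have e0 : 0 < e by rewrite subr_gt0.
(* With this [L], the oscillation of p at distances below exp (- L) is less than C / L < e. *)
pose L := C / e + 1; have L1 : 1 <= L by rewrite lerDr divr_ge0// ltW.
pose dl := expR (- L); have dl0 : 0 < dl by exact: expR_gt0.
have dl2 : dl <= 1 / 2.
  rewrite /dl expRN -div1r ler_pdivrMr ?expR_gt0//.
  by have := expR_ge1Dx L; ord_lra.
have sub y : edist x y < dl -> N y.
  move=> xy; apply: hN; apply/negP; rewrite -ltNge.
  suff : `|p x - p y| < e.
    by rewrite distrC ltr_norml /e ltrD2r => /andP[].
  have le2 : edist x y <= 1 / 2 by ord_lra.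
  apply: le_lt_trans (hp x y le2) _.
  have [->|d0] := eqVneq (edist x y) 0; first by rewrite ln0// oppr0 invr0 mulr0.
  have dp : 0 < edist x y by rewrite lt_neqAle eq_sym d0 eudist_ge0.
  have lL : L < - ln (edist x y).
    by rewrite ltrNr -(expRK (- L)) ltr_ln ?posrE.
  have l0 : 0 < - ln (edist x y) by ord_lra.
  rewrite ltr_pdivrMr// mulrC -ltr_pdivrMr//.
  by apply: lt_trans lL; rewrite ltrDl.
have := iint_ball_ge x dl0; rewrite leNgt => /negP; apply.
apply: (@le_lt_trans _ _ 0%E); last by rewrite lte_fin exprn_gt0 ?mulr_gt0 ?divr_gt0.
rewrite -N0; apply: le_iint => y; first by rewrite lee_fin ball_ind_ge0.
rewrite lee_fin /ball_ind; case: ifPn => [/sub Ny|_]; last by [].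
by rewrite indicE mem_set.
Qed.

Lemma exists_exponent_gt1 (C : R) p : 0 < C -> log_holder C p -> (1%:E < essinf p)%E ->
  exists2 s : R, 1 < s & forall x, s <= p x.
Proof.
move=> C0 hp /ereal_sup_gt[_ [s hs <-]]; rewrite lte_fin => s1.
by exists s => //; exact: ae_ge_everywhere C0 hp hs.
Qed.

Lemma fofana_norm_ge0 p (q alpha : R) (g : n.-tuple R -> \bar R) :
  (0 <= fofana_norm p q alpha g)%E.
Proof.
apply: (@le_trans _ _ (Lq_norm q (fun x => ((powR (fine (lebn (eball x 1))) (alpha^-1 - (p x)^-1 - q^-1))%:E
    * lux_norm p (restr g x 1%R))%E))); first exact: poweR_ge0.
by apply: ereal_sup_ubound; exists 1 => //=; exact: ltr01.
Qed.

End Everywhere.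

Theorem theorem4p1 (R : realType) (n : nat) (p1 p2 : n.-tuple R -> R)
    (gamma q alpha beta : R) :
  var_exp p1 -> var_exp p2 ->
  (exists C : R, 0 < C /\ log_holder C p1 /\ log_holder C p2) ->
  0 < gamma -> gamma < n%:R / fine (esssup p1) ->
  1 <= q -> 1 <= alpha ->
  (forall x, p1 x < alpha) -> alpha < q ->
  (forall x, p2 x < beta) -> beta < q ->
  (forall x, n%:R / p1 x - n%:R / p2 x = gamma) ->
  (frac_bounded gamma p1 q alpha p2 beta <->
   gamma = n%:R / alpha - n%:R / beta).
Proof.
move=> [mp1 [p11 [ess1 _]]] [mp2 [p21 _]] [C [C0 [hp1 hp2]]] g0 gs q1 a1 pa aq pb bq rel.
(* For n = 0 the upper bound on gamma would be 0. *)
have n0 : (0 < n)%N.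
  rewrite lt0n; apply/eqP => nz; move: (fine _) gs => t; rewrite [in X in X -> _]nz mul0r; ord_lra.
have gn : gamma < n%:R.
  pose o : n.-tuple R := cst_tuple 0; rewrite -(rel o).
  have p1o := p11 o; have p2o := p21 o.
  have : n%:R / p1 o <= n%:R by rewrite ler_pdivrMr ?ler_peMr//; ord_lra.
  have : 0 < n%:R / p2 o by rewrite divr_gt0 ?ltr0n//; ord_lra.
  by ord_lra.
have b1 : 1 <= beta.
  by have := p21 (cst_tuple 0); have := pb (cst_tuple 0); ord_lra.
split; first exact: frac_bounded_scaling hp1 hp2 mp1 p11 p21 gn q1 a1 b1 pa aq.
move=> hg; have [s s1 hs] := exists_exponent_gt1 C0 hp1 ess1.
have p20 x : 0 < p2 x by have := p21 x; ord_lra.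
(* [beta] serves as the uniform upper bound [bt] of the exponents. *)
have p2b x : p2 x <= beta := ltW (pb x).
have [C2 [pinf [p2i adm]]] := exists_admissible n0 g0 gn s1 C0 hp1 hp2 mp1 mp2 hs p20 p2b rel.
have [K K0 hK] := fofana_bound adm q1 a1 b1 bq hg.
exists K; split; first exact: K0.
move=> f [/measurable_EFinP mf [_ fin]].
have f0 := fofana_norm_ge0 p1 q alpha (fun x => (f x)%:E).
have ffin : fofana_norm p1 q alpha (fun x => (f x)%:E) \is a fin_num.
  by rewrite ge0_fin_numE.
have up : (fofana_norm p2 q beta (frac_int gamma f) <=
    (K * fine (fofana_norm p1 q alpha (fun x => (f x)%:E)))%:E)%E.
  by apply: hK; rewrite ?fine_ge0// fineK.
split; last by move: up; rewrite EFinM fineK.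
split; first exact: measurable_frac_int.
split; last exact: le_lt_trans up (ltry _).
by apply: frac_int_Lp_loc up => [|x]; [ord_lra|exact: ltW].
Qed.
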